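(* Let $\mathcal{C}:=B_{2D}(0,1)\times[-1,1]\subset\mathbb{R}^3$, where $B_{2D}(0,1)$ is the unit disc of $\mathbb{R}^2$, and for $\delta\in\mathbb{R}$ let $$u_\delta(r,\theta,z):=\sqrt{\frac{2r}{\pi}}\,\sin(\theta/2)+\delta z,\qquad r>0,\ \theta\in\,]-\pi,\pi[,\ z\in\mathbb{R}.$$ If $\delta>\sqrt{3-\frac{2}{\pi}}$, then $u_\delta$ is not a minimizer of the problem $$\min\Big\{\int_{\mathcal{C}}|\nabla u|^2\,dx+\mathcal{H}^2(S_u)\ ;\ u\in SBV(\mathcal{C})\ \text{and}\ u=u_\delta\ \text{on}\ \partial\mathcal{C}\Big\}.$$
   Context: Cylindrical coordinates: $(x,y,z)=(r\cos\theta,r\sin\theta,z)$. $SBV$ denotes the space of special functions of bounded variation, $\nabla u$ the approximate gradient (density of the absolutely continuous part of $Du$), $S_u$ the approximate discontinuity set of $u$, and $\mathcal{H}^2$ the two-dimensional Hausdorff measure. The condition $u=u_\delta$ on $\partial\mathcal{C}$ is understood in the sense of traces. The singular set of $u_\delta$ is the half-plane $P_0=\,]-\infty,0]\times\{0\}\times\mathbb{R}$. *)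

(* Defs.v *)
From HB Require Import structures.
From mathcomp Require Import all_boot all_order all_algebra.
From mathcomp Require Import all_classical all_reals all_analysis.

Set Implicit Arguments.
Unset Strict Implicit.
Unset Printing Implicit Defensive.

Import Order.TTheory GRing.Theory Num.Theory.
Import numFieldNormedType.Exports.

Local Open Scope classical_set_scope.
Local Open Scope ring_scope.

(* Points of R^3 are triples ((x, y), z).  The norm that the library puts on
   products is the max norm, hence the explicit Euclidean norm below. *)
Notation R3 R := (R * R * R)%type.

(* The same carrier, with the product of the Borel sigma-algebras. *)
Notation mR3 R :=
  (measurableTypeR R * measurableTypeR R * measurableTypeR R)%type.

Definition leb3 (R : realType) : set (mR3 R) -> \bar R :=
  ((@lebesgue_measure R \x @lebesgue_measure R) \x @lebesgue_measure R)%E.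

HB.instance Definition _ (R : realType) := Measure.on (@leb3 R).

Section SBV.
Context {R : realType}.
Implicit Types (O A : set (R3 R)) (u v : R3 R -> R) (x y : R3 R).

Definition enorm x : R :=
  Num.sqrt (x.1.1 ^+ 2 + x.1.2 ^+ 2 + x.2 ^+ 2).

Definition eball x (r : R) : set (R3 R) := [set y | enorm (y - x) < r].

Definition basis_vec (i : 'I_3) : R3 R :=
  ((i == 0 :> nat)%:R, (i == 1 :> nat)%:R, (i == 2 :> nat)%:R).

(* The element 0 makes the diameter of the empty set equal to 0. *)
Definition diam A : \bar R :=
  ereal_sup (0%E |` [set (enorm (p.1 - p.2))%:E | p in A `*` A]).

(* Normalized with omega_2 = pi, that is, each set of the covering counts for
   pi * (diam / 2)^2. *)
Definition hausdorff2_pre (e : R) A : \bar R :=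
  ereal_inf [set (\sum_(0 <= k <oo) (pi / 4)%:E * diam (F k) ^+ 2)%E |
    F in [set F : nat -> set (R3 R) |
      A `<=` \bigcup_k F k /\ forall k, (diam (F k) <= e%:E)%E]].

Definition hausdorff2 A : \bar R :=
  ereal_sup [set hausdorff2_pre e A | e in [set e : R | 0 < e]].

Definition mean_dev O u x (a r : R) : \bar R :=
  ((leb3 (O `&` eball x r))^-1 *
   \int[@leb3 R]_(y in O `&` eball x r) `|u y - a|%:E)%E.

(* For O open and x in O this says that a is the approximate limit of u at x;
   for O Lipschitz, u in BV(O) and x on the boundary of O, it says that a is
   the value at x of the trace of u. *)
Definition has_mean_limit O u x (a : R) : Prop :=
  mean_dev O u x a r @[r --> 0^'+] --> 0%E.

(* The approximate discontinuity set S_u of u in O. *)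
Definition disc_set O u : set (R3 R) :=
  [set x | O x /\ ~ exists a, has_mean_limit O u x a].

Definition test_fun O (phi : R3 R -> R) : Prop :=
  [/\ continuous phi,
      forall i x, derivable phi x (basis_vec i),
      forall i, continuous ('D_(basis_vec i) phi),
      compact (closure [set x | phi x != 0]) &
      closure [set x | phi x != 0] `<=` O].

(* Integration against a signed measure; the value does not depend on the
   chosen Hahn decomposition. *)
Definition charge_integral d (T : measurableType d)
    (nu : {charge set T -> \bar R}) (f : T -> R) : \bar R :=
  let: exist P exN := cid (Hahn_decomposition nu) in
  let: exist N nuPN := cid exN in
  (\int[jordan_pos nuPN]_x (f x)%:E - \int[jordan_neg nuPN]_x (f x)%:E)%E.

(* Charges are finite-valued, so D is a finite R^3-valued measure; only its
   values on measurable subsets of O are meaningful. *)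
Definition is_distr_deriv O u (D : 'I_3 -> {charge set (mR3 R) -> \bar R}) :=
  forall i phi, test_fun O phi ->
    (\int[@leb3 R]_(x in O) (u x * 'D_(basis_vec i) phi x)%:E =
     - charge_integral (D i) phi)%E.

(* g is the density of the absolutely continuous part of D on O: Lebesgue
   decomposition D = g leb3 + D restricted to a null set N. *)
Definition is_ac_density O (D : 'I_3 -> {charge set (mR3 R) -> \bar R})
    (g : R3 R -> 'I_3 -> R) : Prop :=
  (forall i, (@leb3 R).-integrable O (fun x => (g x i)%:E)) /\
  exists N : set (mR3 R), [/\ measurable N, leb3 N = 0%E &
    forall i (A : set (mR3 R)), measurable A -> A `<=` O ->
      D i A = (\int[@leb3 R]_(x in A) (g x i)%:E + D i (A `&` N))%E].

(* The last clause is the vanishing of the Cantor part, i.e., of the singular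
   part of Du outside S_u. *)
Definition SBV O u : Prop :=
  (@leb3 R).-integrable O (fun x => (u x)%:E) /\
  exists D g, [/\ is_distr_deriv O u D, is_ac_density O D g &
    forall i (A : set (mR3 R)), measurable A -> A `<=` O `\` disc_set O u ->
      D i A = (\int[@leb3 R]_(x in A) (g x i)%:E)%E].

(* Determined almost everywhere in O when u is in BV(O). *)
Definition approx_grad O u : R3 R -> 'I_3 -> R :=
  xget (fun _ _ => 0)
    [set g | exists2 D, is_distr_deriv O u D & is_ac_density O D g].

Definition energy O u : \bar R :=
  (\int[@leb3 R]_(x in O) (\sum_(i < 3) (approx_grad O u x i) ^+ 2)%:E
   + hausdorff2 (disc_set O u))%E.

Definition frontier A : set (R3 R) := closure A `\` interior A.

Definition same_trace O u v : Prop :=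
  hausdorff2 [set x | frontier O x /\
    ~ exists a, has_mean_limit O u x a /\ has_mean_limit O v x a] = 0%E.

Definition admissible O w u : Prop := SBV O u /\ same_trace O u w.

Definition is_minimizer O w u : Prop :=
  admissible O w u /\
  forall v, admissible O w v -> (energy O u <= energy O v)%E.

(* The variational problem is posed on the interior of this set, which has the
   same frontier and differs from it by a Lebesgue negligible set. *)
Definition cylinder : set (R3 R) :=
  [set p | p.1.1 ^+ 2 + p.1.2 ^+ 2 < 1 /\ -1 <= p.2 <= 1].

(* The angle of (x, y) in ]-pi, pi] (see u_delta_polar below). *)
Definition polar_angle (x y : R) : R :=
  let t := acos (x / Num.sqrt (x ^+ 2 + y ^+ 2)) in
  if 0 <= y then t else - t.

(* On the half-plane P_0 = ]-oo, 0] x {0} x R, which is Lebesgue negligible,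
   the values of this representative are immaterial. *)
Definition u_delta (delta : R) (p : R3 R) : R :=
  let r := Num.sqrt (p.1.1 ^+ 2 + p.1.2 ^+ 2) in
  Num.sqrt (2 * r / pi) * sin (polar_angle p.1.1 p.1.2 / 2) + delta * p.2.

Lemma u_delta_polar (delta r theta z : R) :
  0 < r -> - pi < theta < pi ->
  u_delta delta ((r * cos theta, r * sin theta), z) =
  Num.sqrt (2 * r / pi) * sin (theta / 2) + delta * z.
Proof.
move=> r0 /andP[t1 t2]; rewrite /u_delta /polar_angle /=.
have -> : (r * cos theta) ^+ 2 + (r * sin theta) ^+ 2 = r ^+ 2.
  by rewrite !exprMn -mulrDr cos2Dsin2 mulr1.
rewrite sqrtr_sqr gtr0_norm// [r * cos theta]mulrC mulfK ?gt_eqF//.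
congr (_ * sin (_ / 2) + _); rewrite pmulr_rge0//.
have [t0|t0] := leP 0 theta.
  by rewrite sin_ge0_pi ?cosK// ?in_itv/= t0 ltW.
have st : sin theta < 0.
  by rewrite -oppr_gt0 -sinN sin_gt0_pi// oppr_gt0 t0 ltrNl.
rewrite leNgt st /= -cosN cosK ?opprK// in_itv/= oppr_ge0 (ltW t0)/=.
by rewrite lerNl ltW.
Qed.

End SBV.

(* Main.v *)
(* Fix 0 < rho < 1 and compare u_delta with the function v which vanishes on the
   closed cylinder K = {r <= rho, |z| <= rho} and equals u_delta elsewhere.  In
   polar coordinates |grad u_delta|^2 = 1 / (2 pi r) + delta^2, so the gradient
   energy of v is smaller than that of u_delta by at least
   2 rho^2 + 2 pi delta^2 rho^3.  On the other hand the discontinuity set of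
   u_delta has area at least 2, while that of v is contained in the boundary of
   K, of area 6 pi rho^2, and in the part of the half-plane P_0 outside K, of
   area at most 4 (1 - rho).  At rho = 1 the energy of u_delta thus exceeds that
   of v by 4 + 2 pi delta^2 - 6 pi, which is positive exactly when
   delta^2 > 3 - 2 / pi; by continuity rho slightly smaller than 1 still gives a
   contradiction, and then v = u_delta near the boundary of the domain.

   The derivative of v is computed by integration by parts on the lines parallel
   to the axes, and the energy depends only on this derivative because a finite
   measure on the open cylinder is determined by its integrals against test
   functions.  The lower bound for the Hausdorff measure comes from the
   isodiametric inequality, proved by Steiner symmetrization. *)

Require Import Defs.
From HB Require Import structures.
From mathcomp Require Import all_boot all_order all_algebra.
From mathcomp Require Import all_classical all_reals all_analysis.
From mathcomp Require Import measurable_realfun ring lra.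

Import Order.TTheory GRing.Theory Num.Theory.
Import numFieldNormedType.Exports.

Local Open Scope classical_set_scope.
Local Open Scope ring_scope.
Set Implicit Arguments.
Unset Strict Implicit.
Unset Printing Implicit Defensive.

(** * Borel sets and Fubini on R^3 *)

(** The two energies are equal at the threshold with [rho = 1], so the Hausdorff bounds must be
    sharp. A covering set counts for [pi / 4 * diam ^ 2], hence plain squares cost [pi / 2] per unit
    of area. Replacing each square by its inscribed disc and treating the remainder in the same way
    again brings the price down to 1; discs are then reached by exhaustion, the lateral surface and
    the slit by 1-Lipschitz maps.

    The discontinuity set of the competitor is needed from both sides: from above for its area, and
    from below because the Cantor part vanishes only if all the jump mass sits on that set. The jump
    part is written without any surface measure, as the image of densities on the plane that
    parametrizes the lines of a given direction.

    [u_delta] is itself the competitor for [rho = -1], whose cylinder is empty. Therefore most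
    lemmas assume only [rho < 1], and one formula gives both energies. The gradient in the energy is
    a choice among the possible densities, so it can be computed only after uniqueness is known. *)

Notation mR2 R := (measurableTypeR R * measurableTypeR R)%type.

Definition leb2 (R : realType) : set (mR2 R) -> \bar R :=
  (@lebesgue_measure R \x @lebesgue_measure R)%E.
HB.instance Definition _ (R : realType) := Measure.on (@leb2 R).

Lemma product_sigma_finite d1 d2 (T1 : measurableType d1)
    (T2 : measurableType d2) (R : realType)
    (m1 : {sigma_finite_measure set T1 -> \bar R})
    (m2 : {sigma_finite_measure set T2 -> \bar R}) :
  sigma_finite setT (m1 \x m2)%E.
Proof.
have /sigma_finiteP[F [TF ndF Foo]] := sigma_finiteT m1.
have /sigma_finiteP[G [TG ndG Goo]] := sigma_finiteT m2.
exists (fun n => F n `*` G n).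
  rewrite -setXTT TF TG predeqE => -[x y]; split.
    move=> [/= [n _ Fnx] [k _ Gky]]; exists (maxn n k) => //; split.
    - by move: x Fnx; exact/subsetPset/ndF/leq_maxl.
    - by move: y Gky; exact/subsetPset/ndG/leq_maxr.
  by move=> [n _ []/= ? ?]; split; exists n.
move=> k; have [? ?] := Foo k; have [? ?] := Goo k.
split; first exact: measurableX.
by rewrite product_measure1E// lte_mul_pinfty// ge0_fin_numE.
Qed.

HB.instance Definition _ (R : realType) :=
  Measure_isSigmaFinite.Build _ _ _ (@leb2 R)
    (@product_sigma_finite _ _ _ _ R (@lebesgue_measure R) (@lebesgue_measure R)).
HB.instance Definition _ (R : realType) :=
  Measure_isSigmaFinite.Build _ _ _ (@leb3 R)
    (@product_sigma_finite _ _ _ _ R (@leb2 R) (@lebesgue_measure R)).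

Section OpenMeasurable.
Context {R : realType}.

(** A countable base made of members of [M]. Countability is what places the open sets of a product
    in the product of the sigma-algebras. *)
Definition open_base (T : topologicalType) (M : set (set T)) : Prop :=
  exists B : nat -> set T, (forall n, M (B n)) /\
  forall x U, nbhs x U -> exists n, B n x /\ B n `<=` U.

Lemma open_base_open (T : topologicalType) (M : set (set T)) (A : set T) :
  M set0 -> (forall F : nat -> set T, (forall n, M (F n)) -> M (\bigcup_n F n)) ->
  open_base M -> open A -> M A.
Proof.
move=> M0 MU [B [mB BP]] oA.
rewrite (_ : A = \bigcup_n (if `[< B n `<=` A >] then B n else set0)).
  by apply: MU => n; case: ifPn.
apply/seteqP; split => [x Ax|x [n _]].
  have [n [Bx BA]] := BP x A (open_nbhs_nbhs (conj oA Ax)).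
  by exists n => //; case: asboolP.
by case: asboolP => // BA /BA.
Qed.

Lemma open_base_real : open_base (measurable : set (set (measurableTypeR R))).
Proof.
pose f (n : nat) : set R :=
  if unpickle n is Some ab then `](ratr ab.1), (ratr ab.2)[%classic
  else (set0 : set R) .
exists (fun n => f n : set (measurableTypeR R)); split.
  move=> n; rewrite /f; case: unpickle => [[a b]|//] /=; exact: measurable_itv.
move=> x U /nbhs_ballP[/= e e0 xU].
have xe : x - e < x by rewrite ltrBlDr ltrDl.
have ex : x < x + e by rewrite ltrDl.
have [a] := rat_in_itvoo xe; rewrite in_itv/= => /andP[a1 a2].
have [b] := rat_in_itvoo ex; rewrite in_itv/= => /andP[b1 b2].
exists (pickle (a, b)); rewrite /f pickleK/= in_itv/= a2 b1; split => //.
move=> y /=; rewrite in_itv/= => /andP[y1 y2]; apply: xU.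
rewrite /ball/= ltr_norml; lra.
Qed.

Lemma open_base_prod (T1 T2 : topologicalType) (M1 : set (set T1))
    (M2 : set (set T2)) (M : set (set (T1 * T2))) :
  (forall A B, M1 A -> M2 B -> M (A `*` B)) ->
  open_base M1 -> open_base M2 -> open_base M.
Proof.
move=> MX [B1 [mB1 B1P]] [B2 [mB2 B2P]].
pose f (n : nat) : set (T1 * T2) :=
  if unpickle n is Some ab then B1 ab.1 `*` B2 ab.2 else B1 0%N `*` B2 0%N.
exists f; split; first by move=> n; rewrite /f; case: unpickle => [?|]; exact: MX.
move=> [x y] U [[/= V W] [xV yW] VWU].
have [m [B1x B1V]] := B1P x V xV; have [n [B2y B2W]] := B2P y W yW.
exists (pickle (m, n)); rewrite /f pickleK/=; split => // -[a b] [/= ? ?].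
by apply: VWU; split; [exact: B1V|exact: B2W].
Qed.

Lemma open_measurable3 (A : set (R3 R)) : open A -> measurable (A : set (mR3 R)).
Proof.
apply: open_base_open; first exact: measurable0.
  by move=> F mF; exact: bigcupT_measurable.
apply: (@open_base_prod _ _ (measurable : set (set (mR2 R)))
   (measurable : set (set (measurableTypeR R)))).
- by move=> B C mB mC; exact: measurableX.
- apply: open_base_prod; [|exact: open_base_real..].
  by move=> B C mB mC; exact: measurableX.
- exact: open_base_real.
Qed.

Lemma closed_measurable3 (A : set (R3 R)) :
  closed A -> measurable (A : set (mR3 R)).
Proof.
move=> cA; rewrite -(setCK A); apply: (@measurableC _ (mR3 R)).
by apply: open_measurable3; exact: closed_openC.
Qed.

Lemma open_measurable2 (A : set (R * R)) : open A -> measurable (A : set (mR2 R)).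
Proof.
apply: open_base_open; first exact: measurable0.
  by move=> F mF; exact: bigcupT_measurable.
apply: open_base_prod; [|exact: open_base_real..].
by move=> B C mB mC; exact: measurableX.
Qed.

Lemma closed_measurable2 (A : set (R * R)) :
  closed A -> measurable (A : set (mR2 R)).
Proof.
move=> cA; rewrite -(setCK A); apply: (@measurableC _ (mR2 R)).
by apply: open_measurable2; exact: closed_openC.
Qed.

Lemma continuous_measurable3 (f : R3 R -> R) :
  continuous f -> measurable_fun [set: mR3 R] f.
Proof.
move=> /continuousP cf; apply: (measurability _ (RGenOpens.measurableE R)).
move=> _ [_ [a [b ->] <-]]; apply: measurableI => //.
by apply: open_measurable3; exact/cf/interval_open.
Qed.

Lemma continuous_measurable2 (f : R * R -> R) :
  continuous f -> measurable_fun [set: mR2 R] f.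
Proof.
move=> /continuousP cf; apply: (measurability _ (RGenOpens.measurableE R)).
move=> _ [_ [a [b ->] <-]]; apply: measurableI => //.
by apply: open_measurable2; exact/cf/interval_open.
Qed.

End OpenMeasurable.

Section Fubini3.
Context {R : realType}.
Implicit Types f : mR3 R -> \bar R.
Notation mu := (@lebesgue_measure R).

Lemma fubini_tonelli_z f : measurable_fun [set: mR3 R] f ->
  (forall x, (0 <= f x)%E) ->
  (\int[@leb3 R]_p f p = \int[@leb2 R]_q \int[mu]_z f (q, z))%E.
Proof. exact: (@fubini_tonelli1 _ _ _ _ R (@leb2 R) mu). Qed.

Lemma fubini_z f : (@leb3 R).-integrable setT f ->
  (\int[@leb3 R]_p f p = \int[@leb2 R]_q \int[mu]_z f (q, z))%E.
Proof. by move=> /(@integral12_prod_meas1 _ _ _ _ R (@leb2 R) mu) <-. Qed.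

End Fubini3.

Section Lines.
Context {R : realType}.
Implicit Types f : mR3 R -> \bar R.
Notation mu := (@lebesgue_measure R).

(* The line through which the [i]-th coordinate varies, the other two
   coordinates being given by [q] in increasing order. *)
Definition emb (i : nat) (q : R * R) (t : R) : R3 R :=
  if i is 0 then ((t, q.1), q.2) else
  if i is 1 then ((q.1, t), q.2) else (q, t).

Lemma measurable_emb i (p : mR3 R -> mR2 R) (g : mR3 R -> measurableTypeR R) :
  measurable_fun [set: mR3 R] p -> measurable_fun [set: mR3 R] g ->
  measurable_fun [set: mR3 R] ((fun x => emb i (p x) (g x)) : mR3 R -> mR3 R).
Proof.
move=> mp mg.
have m1 : measurable_fun [set: mR3 R] (fst \o p).
  exact: measurableT_comp.
have m2 : measurable_fun [set: mR3 R] (snd \o p).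
  exact: measurableT_comp.
case: i => [|[|i]] /=.
- apply: measurable_fun_pair => //; exact: measurable_fun_pair.
- apply: measurable_fun_pair => //; exact: measurable_fun_pair.
- exact: measurable_fun_pair.
Qed.

Definition perm3 (i : nat) (p : mR3 R) : mR3 R := emb i p.1 p.2.

Lemma measurable_perm3 i : measurable_fun [set: mR3 R] (perm3 i).
Proof. by apply: measurable_emb. Qed.

(** Freezing [z] on both sides leaves, for each value of [z], an iterated planar integral in one of
    its two orders; direction 2 is the order in which [leb3] is built. *)
Lemma tonelli_emb i f : measurable_fun [set: mR3 R] f ->
  (forall x, (0 <= f x)%E) ->
  (\int[@leb3 R]_p f p = \int[@leb2 R]_q \int[mu]_t f (emb i q t))%E.
Proof.
move=> mf f0.
have mfp j : measurable_fun [set: mR3 R] (f \o perm3 j).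
  by apply: measurableT_comp => //; exact: measurable_perm3.
have mfz z : measurable_fun [set: mR2 R] (fun q => f (q, z)).
  by apply: (measurableT_comp mf); exact: measurable_pair2.
case: i => [|[|i]] /=; last exact: fubini_tonelli_z.
- rewrite [LHS](@fubini_tonelli2 _ _ _ _ R (@leb2 R) mu)//.
  rewrite [RHS](@fubini_tonelli2 _ _ _ _ R mu mu)//.
  + apply: eq_integral => z _.
    by rewrite /fubini_G [LHS](@fubini_tonelli2 _ _ _ _ R mu mu).
  + exact: (@measurable_fun_fubini_tonelli_F _ _ (mR2 R) (measurableTypeR R) R mu (f \o perm3 0%N) (mfp 0%N) (fun=> f0 _)).
  + by move=> q; exact: integral_ge0.
- rewrite [LHS](@fubini_tonelli2 _ _ _ _ R (@leb2 R) mu)//.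
  rewrite [RHS](@fubini_tonelli2 _ _ _ _ R mu mu)//.
  + apply: eq_integral => z _.
    by rewrite /fubini_G [LHS](@fubini_tonelli1 _ _ _ _ R mu mu).
  + exact: (@measurable_fun_fubini_tonelli_F _ _ (mR2 R) (measurableTypeR R) R mu (f \o perm3 1%N) (mfp 1%N) (fun=> f0 _)).
  + by move=> q; exact: integral_ge0.
Qed.

Lemma leb3_perm3 i (A : set (mR3 R)) : measurable A ->
  leb3 (perm3 i @^-1` A) = leb3 A.
Proof.
move=> mA.
have mpA : measurable (perm3 i @^-1` A).
  by rewrite -[X in measurable X]setTI; exact: measurable_perm3.
have E (B : set (mR3 R)) : measurable B ->
    leb3 B = (\int[@leb3 R]_p (\1_B p)%:E)%E.
  by move=> mB; rewrite integral_indic// setIT.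
have mI (B : set (mR3 R)) : measurable B ->
    measurable_fun [set: mR3 R] (fun p => (\1_B p)%:E).
  by move=> mB; apply/measurable_EFinP; exact: measurable_indic.
rewrite !E// fubini_tonelli_z//; last exact: mI.
rewrite [RHS](@tonelli_emb i)//; exact: mI.
Qed.

(** Permuting the coordinates maps [leb3] to itself. Tonelli for absolute values gives
    integrability, and Fubini in the last variable then extends to signed functions in every
    direction. *)
Lemma integral_perm3 i f : (@leb3 R).-integrable setT f ->
  (\int[@leb3 R]_p f p = \int[@leb3 R]_p f (perm3 i p))%E /\
  (@leb3 R).-integrable setT (f \o perm3 i).
Proof.
move=> intf.
have mfp : measurable_fun [set: mR3 R] (f \o perm3 i).
  apply: measurableT_comp => //; last exact: measurable_perm3.
  by case/integrableP : intf.
have intfp : (@leb3 R).-integrable setT (f \o perm3 i).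
  apply/integrableP; split => //.
  case/integrableP : intf => mf.
  rewrite (@tonelli_emb i)//; last exact: measurableT_comp.
  by rewrite fubini_tonelli_z//; exact: measurableT_comp.
split => //.
transitivity (\int[pushforward (@leb3 R) (perm3 i)]_p f p)%E.
  apply: eq_measure_integral => [|mp A mA _]; first exact: measurable_perm3.
  exact/esym/leb3_perm3.
rewrite integral_pushforward//; first exact: measurable_perm3.
by case/integrableP : intf.
Qed.

Lemma fubini_emb i f : (@leb3 R).-integrable setT f ->
  (\int[@leb3 R]_p f p = \int[@leb2 R]_q \int[mu]_t f (emb i q t))%E.
Proof.
by move=> /(integral_perm3 i)[-> intfp]; rewrite fubini_z.
Qed.

End Lines.

(** * Integration against charges *)

Section ChargeIntegral.
Context d (T : measurableType d) (R : realType).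
Implicit Types (phi : T -> R) (nu : {charge set T -> \bar R}).
Local Open Scope ereal_scope.

Lemma bounded_integrable (m : {measure set T -> \bar R}) phi C :
  m setT < +oo -> measurable_fun setT phi -> (forall x, `|phi x| <= C)%R ->
  m.-integrable setT (EFin \o phi).
Proof.
move=> mT mphi phiC; apply: measurable_bounded_integrable => //.
exists C; split; first exact: num_real.
by move=> M CM x _; exact: le_trans (phiC x) (ltW CM).
Qed.

(** Independence of the Hahn decomposition: [Jp - Jn = m1 - m2] is rewritten as [Jp + m2 = Jn + m1],
    an equality of finite measures, against which the bounded function [phi] is integrated. *)
Lemma charge_integral_diff nu (m1 m2 : {measure set T -> \bar R}) phi C :
  m1 setT < +oo -> m2 setT < +oo ->
  (forall A, measurable A -> nu A = m1 A - m2 A) ->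
  measurable_fun setT phi -> (forall x, `|phi x| <= C)%R ->
  charge_integral nu phi = \int[m1]_x (phi x)%:E - \int[m2]_x (phi x)%:E.
Proof.
move=> m1T m2T nuE mphi phiC; rewrite /charge_integral.
case: cid => P exN; case: cid => N nuPN.
set Jp := jordan_pos nuPN; set Jn := jordan_neg nuPN.
have bI (m : {measure set T -> \bar R}) : m setT < +oo ->
  m.-integrable setT (EFin \o phi) by move=> ?; exact: bounded_integrable phiC.
have finm (m : {measure set T -> \bar R}) A : m setT < +oo -> measurable A ->
    m A \is a fin_num.
  move=> mT mA; rewrite ge0_fin_numE// (le_lt_trans _ mT)//.
  by apply: le_measure => //; rewrite inE.
have JpT : Jp setT < +oo by rewrite -ge0_fin_numE// fin_num_measure.
have JnT : Jn setT < +oo by rewrite -ge0_fin_numE// fin_num_measure.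
have key (a b c e : \bar R) : a \is a fin_num -> b \is a fin_num ->
    c \is a fin_num -> e \is a fin_num -> a - b = c - e -> a + e = b + c.
  move: a b c e => [a| |] [b| |] [c| |] [e| |]//= _ _ _ _ [] ?.
  by congr EFin; lra.
have key' (a b c e : \bar R) : a \is a fin_num -> b \is a fin_num ->
    c \is a fin_num -> e \is a fin_num -> a + e = b + c -> a - b = c - e.
  move: a b c e => [a| |] [b| |] [c| |] [e| |]//= _ _ _ _ [] ?.
  by congr EFin; lra.
have addE A : measurable A -> measure_add Jp m2 A = measure_add Jn m1 A.
  move=> mA; rewrite !measure_addE; apply: key; rewrite ?fin_num_measure//.
  - exact: finm.
  - exact: finm.
  - by rewrite -nuE// (jordan_decomp nuPN mA) /cadd/= cscaleN1.
have : \int[measure_add Jp m2]_x (phi x)%:E =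
       \int[measure_add Jn m1]_x (phi x)%:E.
  by apply: eq_measure_integral => A mA _; exact: addE.
rewrite !integral_measure_add//; try exact: bI.
have finI (m : {measure set T -> \bar R}) : m setT < +oo ->
    \int[m]_x (phi x)%:E \is a fin_num.
  by move=> mT; apply: integrable_fin_num => //; exact: bI.
by apply: key'; exact: finI.
Qed.

End ChargeIntegral.

Section ChargeIntegralTheory.
Context d (T : measurableType d) (R : realType).
Implicit Types (phi : T -> R) (nu : {charge set T -> \bar R}).
Local Open Scope ereal_scope.

Lemma charge_jordan nu : exists m1 m2 : {finite_measure set T -> \bar R},
  forall A, measurable A -> nu A = m1 A - m2 A.
Proof.
have [P [N nuPN]] := Hahn_decomposition nu.
exists (jordan_pos nuPN), (jordan_neg nuPN) => A mA.
by rewrite (jordan_decomp nuPN mA) /cadd/= cscaleN1.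
Qed.

Lemma finite_measureT (m : {finite_measure set T -> \bar R}) : m setT < +oo.
Proof. by rewrite -ge0_fin_numE// fin_num_measure. Qed.

Lemma charge_integral_cadd nu1 nu2 phi C :
  measurable_fun setT phi -> (forall x, `|phi x| <= C)%R ->
  charge_integral (cadd nu1 nu2) phi =
  charge_integral nu1 phi + charge_integral nu2 phi.
Proof.
move=> mphi phiC.
have [m1 [m2 E12]] := charge_jordan nu1; have [m3 [m4 E34]] := charge_jordan nu2.
have F (m : {finite_measure set T -> \bar R}) := finite_measureT m.
have B (m : {finite_measure set T -> \bar R}) :=
  bounded_integrable (F m) mphi phiC.
rewrite (charge_integral_diff (F m1) (F m2) E12 mphi phiC).
rewrite (charge_integral_diff (F m3) (F m4) E34 mphi phiC).
have F2 (m m' : {finite_measure set T -> \bar R}) :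
    measure_add m m' [set: T] < +oo by rewrite measure_addE lte_add_pinfty//; exact: F.
have E A : measurable A ->
    cadd nu1 nu2 A = measure_add m1 m3 A - measure_add m2 m4 A.
  move=> mA; rewrite /cadd/= E12// E34// !measure_addE.
  rewrite oppeD; first by rewrite addeACA.
  by apply: fin_num_adde_defl; rewrite fin_num_measure.
rewrite (charge_integral_diff (F2 m1 m3) (F2 m2 m4) E mphi phiC).
rewrite !integral_measure_add//; [|exact: B..].
have finI (m : {finite_measure set T -> \bar R}) :
    \int[m]_x (phi x)%:E \is a fin_num.
  by apply: integrable_fin_num => //; exact: B.
by rewrite (oppeD (fin_num_adde_defl _ (finI m4))) addeACA.
Qed.

Lemma charge_integral_copp nu phi C :
  measurable_fun setT phi -> (forall x, `|phi x| <= C)%R ->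
  charge_integral (copp nu) phi = - charge_integral nu phi.
Proof.
move=> mphi phiC.
have [m1 [m2 E]] := charge_jordan nu.
have F (m : {finite_measure set T -> \bar R}) := finite_measureT m.
rewrite (charge_integral_diff (F m1) (F m2) E mphi phiC).
have finI (m : {finite_measure set T -> \bar R}) :
    \int[m]_x (phi x)%:E \is a fin_num.
  apply: integrable_fin_num => //; exact: (bounded_integrable (F m) mphi phiC).
have Ec A : measurable A -> copp nu A = m2 A - m1 A.
  move=> mA; rewrite /copp/= E// fin_num_oppeB; first by rewrite addeC.
  exact: fin_num_measure.
rewrite (charge_integral_diff (F m2) (F m1) Ec mphi phiC).
by rewrite (fin_num_oppeB _ (finI m2)) addeC.
Qed.

(** The density [h] and the Radon-Nikodym derivative of [m] have the same integral over every
    measurable set, hence agree almost everywhere. *)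
Lemma integral_density (mu : {sigma_finite_measure set T -> \bar R})
    (h : T -> R) (m : {finite_measure set T -> \bar R}) phi C :
  mu.-integrable setT (EFin \o h) ->
  (forall A, measurable A -> m A = \int[mu]_(x in A) (h x)%:E) ->
  measurable_fun setT phi -> (forall x, `|phi x| <= C)%R ->
  \int[m]_x (phi x)%:E = \int[mu]_x (phi x * h x)%:E.
Proof.
move=> ih mE mphi phiC.
have mh : measurable_fun setT (EFin \o h) by exact: measurable_int ih.
have mmu : m `<< mu.
  apply/null_content_dominatesP => A mA muA.
  by rewrite mE//; apply: null_set_integral => //; exact: measurable_funTS.
rewrite -(Radon_Nikodym_change_of_variables mmu)//; last first.
  exact: bounded_integrable (finite_measureT m) mphi phiC.
have mphi' : measurable_fun setT (EFin \o phi) by exact/measurable_EFinP.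
have iRN : mu.-integrable setT (Radon_Nikodym (charge_of_finite_measure m) mu).
  by apply: Radon_Nikodym_integrable; exact: mmu.
under [RHS]eq_integral do rewrite EFinM.
apply: ae_eq_integral => //.
- by apply: emeasurable_funM => //; exact: measurable_int iRN.
- exact: emeasurable_funM.
- apply: ae_eqe_mul2l; apply: integral_ae_eq => // A _ mA.
  by rewrite -mE// -Radon_Nikodym_integral//; exact: mmu.
Qed.

(** The positive and negative parts of [h] are densities of two finite measures whose difference is
    the induced charge. *)
Lemma charge_integral_induced (mu : {sigma_finite_measure set T -> \bar R})
    (h : T -> R) (ih : mu.-integrable setT (EFin \o h)) phi C :
  measurable_fun setT phi -> (forall x, `|phi x| <= C)%R ->
  charge_integral (induced_charge ih) phi = \int[mu]_x (phi x * h x)%:E.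
Proof.
move=> mphi phiC.
have mh : measurable_fun setT h by apply/measurable_EFinP/(measurable_int _ ih).
have ip : mu.-integrable setT (EFin \o h^\+%R).
  have := integrable_funepos measurableT ih.
  by rewrite funerpos.
have in_ : mu.-integrable setT (EFin \o h^\-%R).
  have := integrable_funeneg measurableT ih.
  by rewrite funerneg.
have pp A : 0 <= induced_charge ip A.
  by apply: integral_ge0 => x _ /=; rewrite lee_fin funrpos_ge0.
have pn A : 0 <= induced_charge in_ A.
  by apply: integral_ge0 => x _ /=; rewrite lee_fin funrneg_ge0.
pose mp : {measure set T -> \bar R} := measure_of_charge _ pp.
pose mn : {measure set T -> \bar R} := measure_of_charge _ pn.
have mpT : mp setT < +oo.
  by rewrite -ge0_fin_numE//; exact: (@fin_num_measure _ _ _ (induced_charge ip)).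
have mnT : mn setT < +oo.
  by rewrite -ge0_fin_numE//; exact: (@fin_num_measure _ _ _ (induced_charge in_)).
have E A : measurable A -> induced_charge ih A = mp A - mn A.
  move=> mA; rewrite /induced_charge/= /mp /mn /measure_of_charge /=.
  rewrite /induced_charge -integralB//.
  + by apply: eq_integral => x _ /=; rewrite -EFinB -[in LHS](funrposBneg h).
  + exact: (integrableS measurableT mA (@subsetT _ _) ip).
  + exact: (integrableS measurableT mA (@subsetT _ _) in_).
rewrite (charge_integral_diff mpT mnT E mphi phiC).
have D (k : T -> R) (ik : mu.-integrable setT (EFin \o k))
    (m : {measure set T -> \bar R}) (mT : m setT < +oo) :
    (forall A, measurable A -> m A = \int[mu]_(x in A) (k x)%:E) ->
    \int[m]_x (phi x)%:E = \int[mu]_x (phi x * k x)%:E.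
  move=> mE.
  (* Restriction to the whole space changes no value; it only presents [m] as a finite measure. *)
  have RE A : mfrestr measurableT mT A = m A by rewrite /mfrestr /mrestr setIT.
  rewrite -(@integral_density mu k (mfrestr measurableT mT) phi C)//.
    by apply: eq_measure_integral => A mA _; exact/esym/RE.
  by move=> A mA; rewrite -mE//; exact: RE.
have I (k : T -> R) (ik : mu.-integrable setT (EFin \o k)) :
    mu.-integrable setT (fun x => (phi x * k x)%:E).
  have bphi : [bounded phi x | x in setT].
    exists C; split; first exact: num_real.
    by move=> M CM x /= _; exact: le_trans (phiC x) (ltW CM).
  exact: (integrableMr measurableT mphi bphi ik).
rewrite (D _ ip)// (D _ in_)// -integralB//; [|exact: I..].
apply: eq_integral => x _; rewrite -EFinB -mulrBr.
by rewrite -[in RHS](funrposBneg h).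
Qed.

End ChargeIntegralTheory.

Lemma charge_integral_pushforward d d' (T : measurableType d)
  (T' : measurableType d') (R : realType) (nu : {charge set T -> \bar R})
  (f : T -> T') (mf : measurable_fun setT f) (phi : T' -> R) C
  (nuf : {charge set T' -> \bar R}) :
  (forall A, measurable A -> nuf A = nu (f @^-1` A)) ->
  measurable_fun setT phi -> (forall x, `|phi x| <= C)%R ->
  charge_integral nuf phi = charge_integral nu (phi \o f).
Proof.
move=> nufE mphi phiC.
have [m1 [m2 E]] := charge_jordan nu.
have F (m : {finite_measure set T -> \bar R}) := finite_measureT m.
have mphif : measurable_fun setT (phi \o f) by exact: measurableT_comp.
have phifC x : `|(phi \o f) x| <= C by exact: phiC.
rewrite (charge_integral_diff (F m1) (F m2) E mphif phifC).
have Ef A : measurable A -> (nuf A = pushforward m1 f A - pushforward m2 f A)%E.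
  move=> mA; rewrite nufE// E// -[X in measurable X]setTI; exact: mf.
have Ff (m : {finite_measure set T -> \bar R}) :
  (pushforward m f [set: T'] < +oo)%E by exact: F.
have I (m : {finite_measure set T -> \bar R}) :
    (\int[pushforward m f]_x (phi x)%:E = \int[m]_x ((phi \o f) x)%:E)%E.
  rewrite integral_pushforward//; first exact/measurable_EFinP.
  exact: (bounded_integrable (F m) mphif phifC).
rewrite -!I.
exact: (charge_integral_diff (Ff m1) (Ff m2) Ef mphi phiC).
Qed.

(** * Area of the disc *)

Section DiscArea.
Context {R : realType}.
Notation mu := (@lebesgue_measure R).

Definition disc (r : R) : set (R * R) := [set q | q.1 ^+ 2 + q.2 ^+ 2 < r ^+ 2].

Lemma open_disc r : open (disc r).
Proof.
rewrite (_ : disc r = (fun q => q.1 ^+ 2 + q.2 ^+ 2) @^-1` [set x | x < r ^+ 2])//.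
apply: open_comp; last exact: open_lt.
move=> q _; apply: cvgD; apply: cvgM; (exact: cvg_fst || exact: cvg_snd).
Qed.

Lemma measurable_disc r : measurable (disc r : set (mR2 R)).
Proof. by apply: open_measurable2; exact: open_disc. Qed.

(** The sections have length [2 * sqrt (r ^ 2 - x ^ 2)]; the substitution [x = r * sin t] leads to
    [2 * r ^ 2 * cos t ^ 2], with primitive [r ^ 2 * (t + sin t * cos t)]. *)
Lemma leb2_disc (r : R) : 0 <= r -> leb2 (disc r) = (pi * r ^+ 2)%:E.
Proof.
rewrite le_eqVlt => /predU1P[<-|r0].
  rewrite expr0n mulr0 (_ : disc 0 = set0) ?measure0//.
  apply/seteqP; split => // -[x y]; rewrite /disc/= expr0n/=.
  by rewrite ltNge addr_ge0 ?sqr_ge0.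
rewrite /leb2 /product_measure1.
transitivity (\int[mu]_(x in `[(- r)%R, r]) (2 * Num.sqrt (r ^+ 2 - x ^+ 2))%:E)%E.
  rewrite [RHS]integral_mkcond; apply: eq_integral => x _ /=.
  rewrite patchE.
  (* For [|x| >= r] the root of a nonpositive number is 0 and both sides are empty. *)
  have -> : xsection (disc r) x =
      `](- Num.sqrt (r ^+ 2 - x ^+ 2)), Num.sqrt (r ^+ 2 - x ^+ 2)[%classic.
    apply/seteqP; split => y; rewrite /xsection/= inE/= in_itv/= -ltr_norml.
      rewrite /disc/= => h; rewrite -sqrtr_sqr ltr_sqrt; first lra.
      have := sqr_ge0 y; lra.
    have [h|h] := ltP 0 (r ^+ 2 - x ^+ 2); last first.
      by rewrite ler0_sqrtr// ltNge normr_ge0.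
    rewrite -sqrtr_sqr ltr_sqrt// /disc/=; lra.
  rewrite lebesgue_measure_itv/= lte_fin.
  case: ifPn => [xr|xr].
    rewrite mem_set; first by rewrite -EFinB opprK mulr2n mulrDl mul1r.
    rewrite /= in_itv/= -ler_norml -(gtr0_norm r0) -ler_sqr ?nnegrE//.
    rewrite !real_normK ?num_real//; rewrite ltNge in xr.
    rewrite leNgt; apply: contraNN xr => xr; rewrite ler0_sqrtr ?oppr0//; lra.
  have -> : Num.sqrt (r ^+ 2 - x ^+ 2) = 0.
    apply/eqP; rewrite eq_le sqrtr_ge0 andbT; rewrite -leNgt in xr.
    have := sqrtr_ge0 (r ^+ 2 - x ^+ 2); lra.
  by rewrite mulr0; case: ifP.
have -> : `[(- r)%R, r]%classic = `[(r * sin (- (pi / 2)))%R, (r * sin (pi / 2))%R]%classic.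
  by rewrite sinN sin_pihalf mulrN mulr1.
have F'x (x : R) : is_derive x (1 : R) (fun x : R => r * sin x) (r * cos x).
  by apply: is_derive_eq; rewrite /GRing.scale/=; ring.
have F' : (fun x : R => r * sin x)^`()%classic = (fun x => r * cos x).
  by apply/funext => x; rewrite derive1E; exact: derive_val.
have p2 : - (pi / 2) < pi / 2 :> R by have := pi_gt0 R; lra.
have cF : continuous (fun x : R => r * sin x).
  by move=> x; apply: cvgM; [exact: cvg_cst|exact: continuous_sin].
have cF' : continuous (fun x : R => r * cos x).
  by move=> x; apply: cvgM; [exact: cvg_cst|exact: continuous_cos].
have cG : continuous (fun x : R => 2 * Num.sqrt (r ^+ 2 - x ^+ 2)).
  move=> x; apply: cvgM; first exact: cvg_cst.
  apply: continuous_comp; last exact: sqrt_continuous.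
  by apply: cvgB; [exact: cvg_cst|exact: exprn_continuous].
have sF : {in `[(- (pi / 2))%R, pi / 2] &, {homo (fun x : R => r * sin x) : x y / x < y}}.
  move=> x y xp yp xy; by rewrite ltr_pM2l// ltr_sin.
rewrite (integration_by_substitution_increasing (ltW p2) sF) ?F'; last 5 first.
- by move=> x _; exact: cF'.
- apply/cvg_ex; exists (r * cos (- (pi / 2))).
  by apply: cvg_at_right_filter; exact: cF'.
- apply/cvg_ex; exists (r * cos (pi / 2)).
  by apply: cvg_at_left_filter; exact: cF'.
- split => //; [by apply: cvg_at_right_filter; exact: cF|
                by apply: cvg_at_left_filter; exact: cF].
- exact: continuous_subspaceT.
transitivity (\int[mu]_(x in `[(- (pi / 2))%R, (pi / 2)%R])
   (2 * r ^+ 2 * cos x ^+ 2)%:E)%E.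
  apply: eq_integral => x; rewrite inE/= => xp; congr EFin; rewrite fctE/=.
  have -> : r ^+ 2 - (r * sin x) ^+ 2 = (r * cos x) ^+ 2.
    by rewrite !exprMn -[X in X - _]mulr1 -(cos2Dsin2 x); ring.
  rewrite sqrtr_sqr ger0_norm; first by ring.
  by rewrite mulr_ge0 ?(ltW r0)//; apply: cos_ge0_pihalf.
have Hx (x : R) : is_derive x (1 : R) (fun x : R => r ^+ 2 * (x + sin x * cos x))
    (2 * r ^+ 2 * cos x ^+ 2).
  apply: is_derive_eq; rewrite /GRing.scale/=.
  by rewrite mulrN -!expr2 sin2cos2; ring.
rewrite (@continuous_FTC2 _ _ (fun x : R => r ^+ 2 * (x + sin x * cos x)))//.
- rewrite -EFinB; congr EFin.
  by rewrite sinN cosN sin_pihalf cos_pihalf; lra.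
- apply: continuous_subspaceT => x; apply: cvgM; first exact: cvg_cst.
  apply: (@continuous_comp _ _ _ (@cos R) (fun y => y ^+ 2)).
    exact: continuous_cos.
  exact: exprn_continuous.
- have cH : continuous (fun x : R => r ^+ 2 * (x + sin x * cos x)).
    move=> x; apply: cvgM; first exact: cvg_cst.
    apply: cvgD; first exact: cvg_id.
    by apply: cvgM; [exact: continuous_sin|exact: continuous_cos].
  split => //; [by apply: cvg_at_right_filter; exact: cH|
                by apply: cvg_at_left_filter; exact: cH].
- by move=> x _; rewrite derive1E; exact: derive_val.
Qed.

End DiscArea.

(** * Upper bounds for the Hausdorff measure *)

Section EuclideanNorm.
Context {R : realType}.
Implicit Types x y z : R3 R.

Lemma enorm_ge0 x : 0 <= enorm x. Proof. exact: sqrtr_ge0. Qed.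

Lemma enorm_sqr x : enorm x ^+ 2 = x.1.1 ^+ 2 + x.1.2 ^+ 2 + x.2 ^+ 2.
Proof. by rewrite sqr_sqrtr// !addr_ge0 ?sqr_ge0. Qed.

Lemma enorm_le x (d : R) : 0 <= d ->
  x.1.1 ^+ 2 + x.1.2 ^+ 2 + x.2 ^+ 2 <= d ^+ 2 -> enorm x <= d.
Proof. by move=> d0 h; rewrite -ler_sqr ?nnegrE ?enorm_ge0// enorm_sqr. Qed.

Lemma enorm_triangle x y : enorm (x + y) <= enorm x + enorm y.
Proof.
have x0 := enorm_ge0 x; have y0 := enorm_ge0 y.
apply: enorm_le; first exact: addr_ge0.
have -> : (enorm x + enorm y) ^+ 2 =
   enorm x ^+ 2 + enorm y ^+ 2 + 2 * (enorm x * enorm y) by ring.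
have h : x.1.1 * y.1.1 + x.1.2 * y.1.2 + x.2 * y.2 <= enorm x * enorm y.
  apply: (le_trans (ler_norm _)).
  rewrite -ler_sqr ?nnegrE ?mulr_ge0// real_normK ?num_real// exprMn !enorm_sqr.
  set a := x.1.1; set b := x.1.2; set c := x.2.
  set a' := y.1.1; set b' := y.1.2; set c' := y.2.
  rewrite -subr_ge0.
  (* Lagrange's identity, which yields the Cauchy-Schwarz inequality. *)
  rewrite [X in 0 <= X](_ : _ = (a * b' - b * a') ^+ 2 + (a * c' - c * a') ^+ 2
     + (b * c' - c * b') ^+ 2); last by ring.
  by rewrite !addr_ge0 ?sqr_ge0.
rewrite !enorm_sqr /=; move: h; lra.
Qed.

Lemma enormN x : enorm (- x) = enorm x.
Proof. by rewrite /enorm /= !sqrrN. Qed.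

End EuclideanNorm.

Section HausdorffUpper.
Context {R : realType}.
Implicit Types (A B : set (R3 R)) (e c : R).

(* Each set of the covering comes with a bound on its diameter. *)
Definition fcover e A c := exists s : seq (set (R3 R) * R),
  [/\ forall x, A x -> exists2 F, List.In F s & F.1 x,
      forall F, List.In F s -> [/\ 0 <= F.2, F.2 <= e &
        forall p q, F.1 p -> F.1 q -> enorm (p - q) <= F.2] &
      \sum_(F <- s) pi / 4 * F.2 ^+ 2 <= c].

Lemma fcover_le e A B c c' : A `<=` B -> c <= c' -> fcover e B c -> fcover e A c'.
Proof.
move=> AB cc' [s [s1 s2 s3]]; exists s; split=> //; last exact: le_trans cc'.
by move=> x /AB/s1.
Qed.

Lemma fcover0 e : fcover e set0 0.
Proof. by exists [::]; split => //; rewrite big_nil. Qed.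

Lemma fcoverU e A B c c' : fcover e A c -> fcover e B c' ->
  fcover e (A `|` B) (c + c').
Proof.
move=> [s [s1 s2 s3]] [t [t1 t2 t3]]; exists (s ++ t); split.
- move=> x [/s1|/t1] [F Fs Fx]; exists F => //; apply/List.in_app_iff;
    by [left|right].
- by move=> F /List.in_app_iff [/s2|/t2].
- by rewrite big_cat/= lerD.
Qed.

Lemma fcover_bigcup e (I : eqType) (s : seq I) (A : I -> set (R3 R)) c :
  (forall i, i \in s -> fcover e (A i) c) ->
  fcover e [set x | exists2 i, i \in s & A i x] ((size s)%:R * c).
Proof.
elim: s => [|i s ih] sA.
  by apply: fcover_le (fcover0 e); [by move=> x [i]|rewrite mul0r].
have h1 := sA i (mem_head _ _).
have h2 : fcover e [set x | exists2 i, i \in s & A i x] ((size s)%:R * c).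
  by apply: ih => j js; apply: sA; rewrite inE js orbT.
apply: fcover_le (fcoverU h1 h2).
  move=> x [j]; rewrite inE => /predU1P[->|js] Ax; first by left.
  by right; exists j.
by rewrite /= -natr1 mulrDl mul1r addrC.
Qed.

Lemma fcover1 e A d : 0 <= d <= e ->
  (forall p q, A p -> A q -> enorm (p - q) <= d) ->
  fcover e A (pi / 4 * d ^+ 2).
Proof.
move=> /andP[d0 de] Ad; exists [:: (A, d)]; split.
- by move=> x Ax; exists (A, d) => //; left.
- by move=> F [<-|[]].
- by rewrite big_seq1.
Qed.

Lemma fcover_image e A c (f : R3 R -> R3 R) :
  (forall p q, A p -> A q -> enorm (f p - f q) <= enorm (p - q)) ->
  fcover e A c -> fcover e (f @` A) c.
Proof.
move=> f1 [s [s1 s2 s3]].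
exists [seq (f @` (F.1 `&` A), F.2) | F <- s]; split.
- move=> _ [x Ax <-]; have [F Fs Fx] := s1 _ Ax.
  exists (f @` (F.1 `&` A), F.2); last by exists x.
  exact: (List.in_map (fun F => (f @` (F.1 `&` A), F.2))).
- move=> F /List.in_map_iff[G [<- Gs]]; have [G0 Ge Gd] := s2 _ Gs.
  split=> // _ _ [p [Gp Ap] <-] [q [Gq Aq] <-].
  by rewrite (le_trans (f1 _ _ Ap Aq))//= Gd.
- by rewrite big_map.
Qed.

Lemma diam_ge0 A : (0 <= diam A)%E.
Proof. by apply: ereal_sup_ubound; left. Qed.

Lemma diam_le A (d : R) : 0 <= d ->
  (forall p q, A p -> A q -> enorm (p - q) <= d) -> (diam A <= d%:E)%E.
Proof.
move=> d0 Ad; apply: ge_ereal_sup => _ [->|[[p q] [/= Ap Aq] <-]].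
  by rewrite lee_fin.
by rewrite lee_fin; exact: Ad.
Qed.

Lemma nth_List_In (T : Type) (x0 : T) (s : seq T) k :
  (k < size s)%N -> List.In (nth x0 s k) s.
Proof.
elim: s k => [|a s ih] [|k]//=; first by left.
by rewrite ltnS => /ih; right.
Qed.

Lemma List_In_nth (T : Type) (x0 : T) (s : seq T) x : List.In x s ->
  exists2 k, (k < size s)%N & nth x0 s k = x.
Proof.
elim: s => //= a s ih [<-|/ih[k ks kx]]; first by exists 0%N.
by exists k.+1.
Qed.

(** The finite list is continued by empty sets, of diameter 0, into a sequence. *)
Lemma fcover_hausdorff2_pre e A c : 0 < e -> fcover e A c ->
  (hausdorff2_pre e A <= c%:E)%E.
Proof.
move=> e0 [s [s1 s2 s3]].
pose x0 : set (R3 R) * R := (set0, 0).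
pose F k := (nth x0 s k).1.
have F0 k : (size s <= k)%N -> diam (F k) = 0%E.
  move=> ks; rewrite /F nth_default//=; apply/eqP; rewrite eq_le diam_ge0 andbT.
  by apply: diam_le.
have Fs k : (k < size s)%N -> (diam (F k) <= (nth x0 s k).2%:E)%E.
  by move=> /(nth_List_In x0)/s2[G0 _ Gd]; exact: diam_le.
apply: (@le_trans _ _ (\sum_(0 <= k <oo) (pi / 4)%:E * diam (F k) ^+ 2)%E).
  apply: ereal_inf_lbound; exists F => //; split.
    move=> x /s1[G Gs Gx].
    have [k ks Gk] := List_In_nth x0 Gs.
    by exists k => //; rewrite /F Gk.
  move=> k; have [ks|ks] := ltnP k (size s); last by rewrite F0// lee_fin ltW.
  rewrite (le_trans (Fs _ ks))// lee_fin.
  by have [] := s2 _ (nth_List_In x0 ks).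
have p4 : 0 <= pi / 4 :> R by rewrite divr_ge0 ?pi_ge0.
rewrite (@nneseries_split _ _ 0 (size s)); last first.
  by move=> k _; rewrite mule_ge0 ?lee_fin// expe2 mule_ge0 ?diam_ge0.
rewrite eseries0 ?adde0; last first.
  by move=> k ks _; rewrite F0// expe2 !mule0.
apply: (@le_trans _ _ (\sum_(F <- s) pi / 4 * F.2 ^+ 2)%:E); last by rewrite lee_fin.
rewrite -sumEFin (big_nth x0) !big_mkord; apply: lee_sum => i _.
rewrite [leRHS]EFinM lee_wpmul2l ?lee_fin// expe2 expr2 EFinM.
by apply: lee_pmul; rewrite ?diam_ge0 ?Fs.
Qed.

Lemma fcover_hausdorff2 A c :
  (forall e c', 0 < e -> c < c' -> fcover e A c') -> (hausdorff2 A <= c%:E)%E.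
Proof.
move=> h; apply: ge_ereal_sup => _ [e /= e0 <-].
apply/lee_addgt0Pr => d d0; rewrite -EFinD.
by apply: fcover_hausdorff2_pre => //; apply: h => //; rewrite ltrDl.
Qed.


Definition square (a b t : R) : set (R3 R) :=
  [set p | [/\ a <= p.1.1 <= a + t, b <= p.1.2 <= b + t & p.2 = 0]].

(** An admissible price per unit of area, uniform in the mesh, the side and the position. The strict
    inequality [c < c'] leaves room for approximation in each step; the goal is the price 1. *)
Definition square_cost c := forall e t a b c', 0 < e -> 0 < t -> c < c' ->
  fcover e (square a b t) (c' * t ^+ 2).

Definition cell (a b t : R) (n : nat) (ij : 'I_n * 'I_n) :=
  square (a + ij.1%:R * (t / n%:R)) (b + ij.2%:R * (t / n%:R)) (t / n%:R).

Lemma grid1 (a t x : R) n : (0 < n)%N -> 0 < t -> a <= x <= a + t ->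
  exists i : 'I_n, a + i%:R * (t / n%:R) <= x <= a + i%:R * (t / n%:R) + t / n%:R.
Proof.
move=> n0 t0 /andP[ax xt].
have n0' : 0 < n%:R :> R by rewrite ltr0n.
pose h := t / n%:R; have h0 : 0 < h by rewrite divr_gt0.
have tE : t = n%:R * h by rewrite /h mulrC divfK// gt_eqF.
have [xt'|] := ltP x (a + t).
  pose k := Num.truncn ((x - a) / h).
  have /andP[k1 k2] : k%:R <= (x - a) / h < k.+1%:R.
    by apply: truncn_itv; rewrite divr_ge0 ?(ltW h0)// subr_ge0.
  rewrite ler_pdivlMr// in k1; rewrite ltr_pdivrMr// -natr1 in k2.
  have kn : (k < n)%N.
    rewrite -(ltr_nat R) -(ltr_pM2r h0) -tE; lra.
  exists (Ordinal kn) => /=; rewrite -/h; lra.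
(* At the right end point truncation would give the index [n], so the last cell is used instead. *)
move=> xat; have xE : x = a + t by lra.
case: n n0 n0' @h h0 tE => // n _ n0' h h0 tE.
exists ord_max => /=; rewrite -/h; move: tE; rewrite -natr1; lra.
Qed.

Lemma square_grid a b t n : (0 < n)%N -> 0 < t ->
  square a b t `<=` [set p | exists2 ij, ij \in enum {: 'I_n * 'I_n} &
    @cell a b t n ij p].
Proof.
move=> n0 t0 p [p1 p2 p3]; have [i ip] := grid1 n0 t0 p1.
have [j jp] := grid1 n0 t0 p2.
by exists (i, j); rewrite ?mem_enum.
Qed.

Lemma square_diam a b t p q : 0 <= t -> square a b t p -> square a b t q ->
  enorm (p - q) <= Num.sqrt 2 * t.
Proof.
move=> t0 [/andP[p1 p1'] /andP[p2 p2'] p3] [/andP[q1 q1'] /andP[q2 q2'] q3].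
apply: enorm_le; first by rewrite mulr_ge0.
rewrite exprMn sqr_sqrtr// /= p3 q3 subrr expr0n/= addr0.
have sqr_le (x : R) : -t <= x <= t -> x ^+ 2 <= t ^+ 2.
  by rewrite -ler_norml => h; rewrite -(real_normK (num_real x)) ler_sqr ?nnegrE.
have h1 : (p.1.1 - q.1.1) ^+ 2 <= t ^+ 2 by apply: sqr_le; lra.
have h2 : (p.1.2 - q.1.2) ^+ 2 <= t ^+ 2 by apply: sqr_le; lra.
lra.
Qed.

Lemma fcover_square_grid e a b t n c : (0 < n)%N -> 0 < t ->
  (forall a' b', fcover e (square a' b' (t / n%:R)) (c * (t / n%:R) ^+ 2)) ->
  fcover e (square a b t) (c * t ^+ 2).
Proof.
move=> n0 t0 h.
apply: (fcover_le (@square_grid a b t n n0 t0)).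
  2: by apply: fcover_bigcup => i _; exact: h.
rewrite -cardE card_prod card_ord natrM le_eqVlt; apply/orP; left; apply/eqP.
by field; rewrite pnatr_eq0 -lt0n.
Qed.

(** The cost scales like the area, so subdividing a square is free and only squares no larger than
    the mesh matter. *)
Lemma square_cost_small c :
  (forall e t a b c', 0 < e -> 0 < t <= e -> c < c' ->
    fcover e (square a b t) (c' * t ^+ 2)) -> square_cost c.
Proof.
move=> h e t a b c' e0 t0 cc'.
pose n := (Num.truncn (t / e)).+1.
apply: (@fcover_square_grid e a b t n) => // a' b'.
apply: h => //; rewrite divr_gt0 ?ltr0n//= ler_pdivrMr ?ltr0n//.
rewrite mulrC -ler_pdivrMr//; apply: ltW.
by have /andP[] := truncn_itv (divr_ge0 (ltW t0) (ltW e0)).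
Qed.

(** A square of side [s] has diameter [sqrt 2 * s] and counts for [pi / 4 * 2 * s ^ 2]. Halving the
    side first keeps this diameter below [e], since [sqrt 2 <= 2]. *)
Lemma square_cost_base : square_cost (pi / 2).
Proof.
apply: square_cost_small => e t a b c' e0 /andP[t0 te] cc'.
apply: (@fcover_square_grid e a b t 2) => // a' b'.
have t20 : 0 <= t / 2%:R by rewrite divr_ge0 ?ltW.
have s2 : Num.sqrt 2 <= 2 :> R.
  have : 0 <= Num.sqrt 2 :> R by [].
  have : Num.sqrt 2 ^+ 2 = 2 :> R by rewrite sqr_sqrtr.
  nra.
have de : 0 <= Num.sqrt 2 * (t / 2%:R) <= e by rewrite mulr_ge0//=; nra.
apply: (fcover_le (@subset_refl _ _) _ (fcover1 de (fun p q => square_diam t20))).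
rewrite exprMn sqr_sqrtr// mulrA ler_wpM2r ?sqr_ge0//; lra.
Qed.

Lemma measure_cover_le d (T : measurableType d) (m : {measure set T -> \bar R})
    (I : eqType) (s : seq I) (A : I -> set T) (c : R) (D : set T) :
  (forall i, i \in s -> measurable (A i) /\ (m (A i) <= c%:E)%E) ->
  measurable D -> D `<=` [set x | exists2 i, i \in s & A i x] ->
  (m D <= ((size s)%:R * c)%:E)%E.
Proof.
elim: s D => [|i s ih] D sA mD DA.
  rewrite mul0r (_ : D = set0) ?measure0//.
  by apply/seteqP; split => // x /DA[].
have [mA mAc] := sA i (mem_head _ _).
rewrite (measureDI m mD mA) /= -natr1 mulrDl mul1r EFinD leeD//; last first.
  by apply: le_trans mAc; apply: le_measure; rewrite ?inE//; exact: measurableI.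
apply: ih.
- by move=> j js; apply: sA; rewrite inE js orbT.
- exact: measurableD.
- move=> x [/DA[j]]; rewrite inE => /predU1P[->//|js] Ax _; by exists j.
Qed.

Lemma leb2_itv (a b c d : R) : a <= b -> c <= d ->
  leb2 (`[a, b]%classic `*` `[c, d]%classic : set (mR2 R)) =
  ((b - a) * (d - c))%:E.
Proof.
move=> ab cd; rewrite [LHS]product_measure1E//= !lebesgue_measure_itv/= !lte_fin.
move: ab cd; rewrite !le_eqVlt => /predU1P[->|ab] /predU1P[->|cd];
  by rewrite ?ltxx ?subrr ?mulr0 ?mul0r ?mule0 ?mul0e// ab cd -!EFinB -EFinM.
Qed.

(** Cut the square into [n * n] cells and keep those that meet [A]. A point of [D] is farther than a
    cell side from [A] in some coordinate, so the rejected cells cover [D]; the kept ones thus have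
    total area at most [beta]. *)
Lemma fcover_complement c A a b t n (D : set (R * R)) beta e c' :
  square_cost c -> 0 <= c -> (0 < n)%N -> 0 < t -> 0 < e -> c < c' ->
  A `<=` square a b t ->
  measurable (D : set (mR2 R)) ->
  D `<=` `[a, a + t]%classic `*` `[b, b + t]%classic ->
  ((t ^+ 2 - beta)%:E <= leb2 D)%E ->
  (forall p q, A p -> D q ->
    t / n%:R < `|p.1.1 - q.1| \/ t / n%:R < `|p.1.2 - q.2|) ->
  fcover e A (c' * beta).
Proof.
move=> Tc c0 n0 t0 e0 cc' At mD Dt leD AD.
have nR : 0 < n%:R :> R by rewrite ltr0n.
pose h := t / n%:R; have h0 : 0 < h by rewrite divr_gt0.
pose P (ij : 'I_n * 'I_n) := `[< exists2 p, A p & @cell a b t n ij p >].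
pose s := [seq ij <- enum {: 'I_n * 'I_n} | P ij].
pose s' := [seq ij <- enum {: 'I_n * 'I_n} | ~~ P ij].
have ss' : (size s)%:R + (size s')%:R = n%:R ^+ 2 :> R.
  rewrite -natrD !size_filter count_predC -cardE card_prod card_ord natrM expr2//.
pose c2 (ij : 'I_n * 'I_n) : set (mR2 R) :=
  `[a + ij.1%:R * h, a + ij.1%:R * h + h]%classic `*`
  `[b + ij.2%:R * h, b + ij.2%:R * h + h]%classic.
have : (leb2 D <= ((size s')%:R * h ^+ 2)%:E)%E.
  apply: (@measure_cover_le _ _ _ _ s' c2) => //.
    move=> ij _; split; first exact: measurableX.
    have E : leb2 (c2 ij) = (h ^+ 2)%:E.
      rewrite leb2_itv ?lerDl ?(ltW h0)//; congr EFin; ring.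
    by rewrite le_eqVlt; apply/orP; left; apply/eqP; exact: E.
  move=> [x y] Dxy; have [/= xa yb] := Dt _ Dxy; rewrite !in_itv/= in xa yb.
  have [i ix] := grid1 n0 t0 xa; have [j jy] := grid1 n0 t0 yb.
  exists (i, j); last by split => /=; rewrite in_itv.
  rewrite mem_filter mem_enum andbT; apply/asboolPn => -[p Ap [/= p1 p2 _]].
  rewrite -/h in ix jy p1 p2.
  have [] := AD _ _ Ap Dxy; rewrite -/h ltNge /= ler_norml => /negP; apply; lra.
move=> /(le_trans leD); rewrite lee_fin => hs'.
have tE : t ^+ 2 = n%:R ^+ 2 * h ^+ 2.
  by rewrite /h; field; rewrite gt_eqF.
have hs : (size s)%:R * h ^+ 2 <= beta.
  by move: hs'; rewrite tE -ss' mulrDl; lra.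
apply: (@fcover_le _ _ [set p | exists2 ij, ij \in s & @cell a b t n ij p]
   ((size s)%:R * (c' * h ^+ 2))).
- move=> p Ap; have [ij _ ijp] := square_grid n0 t0 (At p Ap).
  by exists ij => //; rewrite mem_filter mem_enum andbT; apply/asboolP; exists p.
- rewrite mulrCA ler_wpM2l//; lra.
- apply: fcover_bigcup => ij _; exact: Tc.
Qed.

(** A displacement of at most [h] in each coordinate has length at most [sqrt 2 * h], which is less
    than [2 * h]. *)
Lemma disc_thicken (r h x y x' y' : R) : 0 <= r -> 0 < h ->
  x ^+ 2 + y ^+ 2 <= r ^+ 2 -> `|x' - x| <= h -> `|y' - y| <= h ->
  x' ^+ 2 + y' ^+ 2 < (r + 2 * h) ^+ 2.
Proof.
move=> r0 h0 xyr xh yh.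
pose p : R3 R := ((x, y), 0); pose d : R3 R := ((x' - x, y' - y), 0).
have pr : enorm p <= r by apply: enorm_le => //; rewrite /= expr0n addr0.
have dh : enorm d < 2 * h.
  have h20 : 0 <= 2 * h by rewrite mulr_ge0// ltW.
  rewrite -ltr_sqr ?nnegrE ?enorm_ge0// enorm_sqr.
  have sq (z : R) : `|z| <= h -> z ^+ 2 <= h ^+ 2.
    by move=> zh; rewrite -(real_normK (num_real z)) ler_sqr ?nnegrE// ltW.
  have := sq _ xh; have := sq _ yh; have : 0 < h ^+ 2 by rewrite exprn_gt0.
  rewrite /= expr0n/=; lra.
have -> : x' ^+ 2 + y' ^+ 2 = enorm (p + d) ^+ 2.
  by rewrite enorm_sqr/=; ring.
have pd : enorm (p + d) < r + 2 * h by have := enorm_triangle p d; lra.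
by rewrite ltr_sqr// ?nnegrE ?enorm_ge0// (le_trans _ (ltW pd))// enorm_ge0.
Qed.

(* A disc of diameter [t <= e] inscribed in a square counts for its area
   [pi / 4 * t ^+ 2]; the rest of the square has area [(1 - pi / 4) * t ^+ 2] and
   is covered at the former cost. *)
Lemma square_cost_step c : 0 <= c -> square_cost c ->
  square_cost (pi / 4 + (1 - pi / 4) * c).
Proof.
move=> c0 Tc; apply: square_cost_small => e t a b c' e0 /andP[t0 te] cc'.
suff : fcover e (square (- (t / 2)) (- (t / 2)) t) (c' * t ^+ 2).
  pose v : R3 R := ((a + t / 2, b + t / 2), 0).
  move=> /(@fcover_image _ _ _ (+%R^~ v)) h.
  apply: fcover_le (h _) => //; last first.
    by move=> p q _ _; rewrite opprD addrACA subrr addr0.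
  move=> p [p1 p2 p3]; exists (p - v); last by rewrite subrK.
  by split => /=; rewrite ?p3 ?subr0//; lra.
pose g := c' - (pi / 4 + (1 - pi / 4) * c).
have g0 : 0 < g by rewrite subr_gt0.
(* Shrinking the disc by [2 * h] enlarges the area left over by at most [k = 8 / n] per unit. The
   condition [16 * c <= g * n] makes [c * k <= g / 2], and [n >= 8] gives [k <= 1] and a nonnegative
   radius. *)
pose n := ((Num.truncn (16 * c / g)).+1 + 8)%N.
have nR : 0 < n%:R :> R by rewrite ltr0n /n addnS.
have gc0 : 0 <= 16 * c / g by rewrite divr_ge0 ?mulr_ge0 ?(ltW g0).
have n8 : 8 <= n%:R :> R by rewrite ler_nat /n leq_addl.
have nc : 16 * c <= g * n%:R.
  have /andP[_ /ltW h] := truncn_itv gc0.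
  rewrite [g * _]mulrC -ler_pdivrMr// (le_trans h)// ler_nat /n leq_addr//.
pose h := t / n%:R; have h0 : 0 < h by rewrite divr_gt0.
have tE : t = n%:R * h by rewrite /h mulrC divfK// gt_eqF.
have r0 : 0 <= t / 2 - 2 * h by rewrite tE; nra.
have t20 : 0 <= t / 2 by rewrite divr_ge0 ?(ltW t0).
pose beta := t ^+ 2 * (1 - pi * (2^-1 - 2 / n%:R) ^+ 2).
have hA : fcover e (square (- (t / 2)) (- (t / 2)) t `&`
    [set p | (t / 2) ^+ 2 < p.1.1 ^+ 2 + p.1.2 ^+ 2]) ((c + g / 4) * beta).
  apply: (@fcover_complement c _ (- (t / 2)) (- (t / 2)) t n
    (disc (t / 2 - 2 * h))) => //.
  - by rewrite ltrDl divr_gt0.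
  - exact: measurable_disc.
  - move=> [x y]; rewrite /disc/= !in_itv/= => xy.
    have bnd (z w : R) : z ^+ 2 + w ^+ 2 < (t / 2 - 2 * h) ^+ 2 ->
        - (t / 2) <= z <= - (t / 2) + t.
      move=> zw; have : `|z| <= t / 2.
        rewrite -ler_sqr ?nnegrE// real_normK ?num_real//.
        have := sqr_ge0 w; have : (t / 2 - 2 * h) ^+ 2 <= (t / 2) ^+ 2.
          by rewrite ler_sqr ?nnegrE//; lra.
        lra.
      rewrite ler_norml; lra.
    by split; [exact: bnd xy|apply: (bnd _ x); rewrite addrC].
  - rewrite leb2_disc// lee_fin /beta /h le_eqVlt; apply/orP; left; apply/eqP.
    by field; rewrite gt_eqF.
  - move=> [[x y] z] [x' y'] [_ /= tp] q; rewrite -/h.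
    have [|xh] := ltP h `|x - x'|; first by left.
    have [|yh] := ltP h `|y - y'|; first by right.
    have := disc_thicken r0 h0 (ltW q) xh yh.
    rewrite subrK => ?; exfalso; lra.
have hB : fcover e [set p | p.1.1 ^+ 2 + p.1.2 ^+ 2 <= (t / 2) ^+ 2 /\ p.2 = 0]
    (pi / 4 * t ^+ 2).
  apply: fcover1; first by rewrite (ltW t0).
  have pt (p : R3 R) : p.1.1 ^+ 2 + p.1.2 ^+ 2 <= (t / 2) ^+ 2 /\ p.2 = 0 ->
      enorm p <= t / 2.
    by move=> [pt p0]; apply: enorm_le => //; rewrite p0 expr0n addr0.
  move=> p q /pt pt' /pt qt; have := enorm_triangle p (- q).
  rewrite enormN; lra.
apply: fcover_le (fcoverU hB hA).
  move=> p Sp; case: (leP (p.1.1 ^+ 2 + p.1.2 ^+ 2) ((t / 2) ^+ 2)) => pt.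
    by left; split => //; case: Sp.
  by right.
have -> : (c + g / 4) * beta =
  (c + g / 4) * (1 - pi * (2^-1 - 2 / n%:R) ^+ 2) * t ^+ 2 by rewrite /beta; ring.
rewrite -mulrDl ler_wpM2r ?sqr_ge0//.
pose k : R := 8 / n%:R.
have k0 : 0 <= k by rewrite divr_ge0 ?(ltW nR).
have k1 : k <= 1 by rewrite ler_pdivrMr// mul1r.
have ck : c * k <= g / 2.
  by rewrite /k mulrA ler_pdivrMr//; lra.
have pi4 : pi <= 4 :> R by have := @pihalf_lt2 R; lra.
have pi0 := pi_ge0 R.
have kb : 1 - pi * (2^-1 - 2 / n%:R) ^+ 2 <= 1 - pi / 4 + k.
  rewrite (_ : 2 / n%:R = k / 4); last by rewrite /k; field; rewrite gt_eqF.
  by nra.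
have cg : 0 <= c + g / 4 by lra.
have := ler_wpM2l cg kb.
have : (c + g / 4) * (1 - pi / 4 + k) <= (1 - pi / 4) * c + g by nra.
rewrite /g; lra.
Qed.

(** The map [c -> pi / 4 + (1 - pi / 4) * c] has fixed point 1 and contracts the excess [c - 1] by
    the factor [1 - pi / 4]. As only [c' > 1] has to be reached, finitely many iterations from
    [pi / 2] suffice. *)
Lemma square_cost1 : square_cost 1.
Proof.
have pi4 : pi / 4 < 1 :> R by have := @pihalf_lt2 R; lra.
have pi2 := pi_ge2 R.
pose q : R := 1 - pi / 4.
have step k : square_cost (1 + (pi / 2 - 1) * q ^+ k).
  elim: k => [|k ih]; first by rewrite mulr1 addrC subrK; exact: square_cost_base.
  have -> : 1 + (pi / 2 - 1) * q ^+ k.+1 =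
    pi / 4 + (1 - pi / 4) * (1 + (pi / 2 - 1) * q ^+ k) by rewrite exprS /q; ring.
  apply: square_cost_step => //; rewrite addr_ge0// mulr_ge0//; first lra.
  by rewrite exprn_ge0// /q; lra.
move=> e t a b c' e0 t0 c1.
have [k /= qk] : exists k, q ^+ k < c' - 1.
  have /cvgrPdist_lt/(_ (c' - 1)) : q ^+ n @[n --> \oo] --> (0 : R).
    by apply: cvg_expr; rewrite ger0_norm /q; lra.
  rewrite subr_gt0 => /(_ c1) [k _ /(_ k)/= kq]; exists k.
  by have := kq (leqnn k); rewrite sub0r normrN; apply: le_lt_trans; exact: ler_norm.
apply: step => //; have := @pihalf_lt2 R.
have : 0 <= q ^+ k by rewrite exprn_ge0// /q; lra.
nra.
Qed.

Definition fcost A c := forall e c', 0 < e -> c < c' -> fcover e A c'.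

Lemma fcost_hausdorff2 A c : fcost A c -> (hausdorff2 A <= c%:E)%E.
Proof. by move=> h; apply: fcover_hausdorff2 => e c'; exact: h. Qed.

Lemma fcost_le A B c c' : A `<=` B -> c <= c' -> fcost B c -> fcost A c'.
Proof.
move=> AB cc' h e d e0 c'd; apply: fcover_le (h e d e0 _) => //.
exact: le_lt_trans cc' c'd.
Qed.

Lemma fcostU A B c c' : fcost A c -> fcost B c' -> fcost (A `|` B) (c + c').
Proof.
move=> hA hB e d e0 cd; pose g := (d - (c + c')) / 2.
have g0 : 0 < g by rewrite divr_gt0// subr_gt0.
have e1 : c < c + g by rewrite ltrDl.
have e2 : c' < c' + g by rewrite ltrDl.
apply: fcover_le (fcoverU (hA e _ e0 e1) (hB e _ e0 e2)) => //.
by rewrite /g; lra.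
Qed.

Lemma fcost_image A c (f : R3 R -> R3 R) :
  (forall p q, A p -> A q -> enorm (f p - f q) <= enorm (p - q)) ->
  fcost A c -> fcost (f @` A) c.
Proof. by move=> f1 h e c' e0 cc'; apply: fcover_image => //; exact: h. Qed.

Lemma fcost_rectangle (a b : R) : 0 < a -> 0 < b ->
  fcost [set p | [/\ 0 <= p.1.1 <= a, 0 <= p.1.2 <= b & p.2 = 0]] (a * b).
Proof.
move=> a0 b0 e c' e0 abc.
pose g := c' - a * b; have g0 : 0 < g by rewrite subr_gt0.
have ag : 0 <= 2 * a ^+ 2 / g.
  by apply: divr_ge0; [rewrite mulr_ge0// sqr_ge0|exact: ltW].
(* Squares of side [s = a / m] fit exactly along the first side and overshoot the second by at most
   [s]; this [m] makes the excess area [a * s] at most [g / 2]. *)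
pose m := (Num.truncn (2 * a ^+ 2 / g)).+1.
have mR : 0 < m%:R :> R by rewrite ltr0n.
pose s := a / m%:R; have s0 : 0 < s by rewrite divr_gt0.
have aE : a = m%:R * s by rewrite /s mulrC divfK// gt_eqF.
have as_ : a * s <= g / 2.
  rewrite /s mulrA ler_pdivrMr// -ler_pdivrMl ?divr_gt0//.
  have /andP[_ /ltW] := truncn_itv ag; rewrite -/m; apply: le_trans.
  by rewrite le_eqVlt; apply/orP; left; apply/eqP; field; rewrite gt_eqF.
have bs : 0 <= b / s by rewrite divr_ge0 ?ltW.
pose l := (Num.truncn (b / s)).+1.
have /andP[l1 l2] := truncn_itv bs; rewrite -/l in l2.
have lR : 0 < l%:R :> R by rewrite ltr0n.
have ls : l%:R * s <= b + s.
  have : l%:R <= b / s + 1 by rewrite /l -natr1 lerD2r.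
  by rewrite -(ler_pM2r s0) mulrDl divfK ?gt_eqF// mul1r.
have lb : b <= l%:R * s by rewrite -ler_pdivrMr// ltW.
pose c (ij : 'I_m * 'I_l) := square (ij.1%:R * s) (ij.2%:R * s) s.
pose d := c' / (m%:R * s * (l%:R * s)).
have ml0 : 0 < m%:R * s * (l%:R * s) by apply: mulr_gt0; exact: mulr_gt0.
have d1 : 1 < d.
  rewrite /d ltr_pdivlMr// mul1r -aE; have : a * (l%:R * s) <= a * (b + s).
    by rewrite ler_wpM2l// ltW.
  rewrite /g in g0 as_ *; lra.
apply: (@fcover_le _ _ [set p | exists2 ij, ij \in enum {: 'I_m * 'I_l} & c ij p]
   ((size (enum {: 'I_m * 'I_l}))%:R * (d * s ^+ 2))).
- move=> p [p1 p2 p3].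
  have p1' : 0 <= p.1.1 <= 0 + m%:R * s by rewrite add0r -aE.
  have p2' : 0 <= p.1.2 <= 0 + l%:R * s.
    by rewrite add0r; case/andP : p2 => -> /= /le_trans; exact.
  have [i] := @grid1 0 (m%:R * s) p.1.1 m isT (mulr_gt0 mR s0) p1'.
  have [j] := @grid1 0 (l%:R * s) p.1.2 l isT (mulr_gt0 lR s0) p2'.
  rewrite !add0r [l%:R * s]mulrC [m%:R * s]mulrC !mulfK ?gt_eqF// => jp ip.
  by exists (i, j); rewrite ?mem_enum.
- rewrite -cardE card_prod !card_ord natrM /d le_eqVlt; apply/orP; left; apply/eqP.
  by field; rewrite !gt_eqF.
- by apply: fcover_bigcup => ij _; exact: square_cost1.
Qed.

(** Exhaustion of the disc by small squares: inside a bounding square, the excluded set [D] is the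
    outside of the disc of radius [r + 2 * h]. With [h <= d <= 1 / 2], the added area
    [pi * (4 * r * h + 4 * h ^ 2)] is at most [pi * d * (4 * r + 2) <= g / 2]. *)
Lemma fcost_disc r : 0 < r ->
  fcost [set p | p.1.1 ^+ 2 + p.1.2 ^+ 2 <= r ^+ 2 /\ p.2 = 0] (pi * r ^+ 2).
Proof.
move=> r0 e c' e0 rc'.
have pi0 := pi_gt0 R.
pose g := c' - pi * r ^+ 2; have g0 : 0 < g by rewrite subr_gt0.
pose d := Num.min (2^-1) (g / (2 * pi * (4 * r + 2))).
have r42 : 0 < 4 * r + 2 by rewrite addr_gt0// mulr_gt0.
have d0 : 0 < d.
  by rewrite lt_min invr_gt0 ltr0n/= divr_gt0// !mulr_gt0.
have d2 : d <= 2^-1 by rewrite ge_min lexx.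
have dg : pi * d * (4 * r + 2) <= g / 2.
  have : d <= g / (2 * pi * (4 * r + 2)) by rewrite ge_min lexx orbT.
  rewrite ler_pdivlMr ?mulr_gt0//; lra.
pose t := 2 * (r + 1); have t0 : 0 < t by rewrite mulr_gt0// addr_gt0.
pose n := (Num.truncn (t / d)).+1.
have nR : 0 < n%:R :> R by rewrite ltr0n.
pose h := t / n%:R; have h0 : 0 < h by rewrite divr_gt0.
have hd : h <= d.
  rewrite ler_pdivrMr// mulrC -ler_pdivrMr//; apply: ltW.
  by have /andP[] := truncn_itv (divr_ge0 (ltW t0) (ltW d0)).
pose beta := pi * (r + 2 * h) ^+ 2.
have beta0 : 0 < beta by apply: mulr_gt0 => //; apply: exprn_gt0; lra.
have betac : beta < c'.
  have : beta <= pi * r ^+ 2 + pi * d * (4 * r + 2).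
    rewrite /beta -mulrA -mulrDr ler_wpM2l ?(ltW pi0)//; nra.
  rewrite /g in g0 dg *; lra.
have rh0 : 0 <= r + 2 * h by lra.
pose I := `[(- (r + 1))%R, (- (r + 1) + t)%R]%classic.
have mI : measurable (I `*` I : set (mR2 R)).
  by apply: measurableX; exact: measurable_itv.
have dI : disc (r + 2 * h) `<=` I `*` I.
  have bnd (z w : R) : z ^+ 2 + w ^+ 2 < (r + 2 * h) ^+ 2 ->
      - (r + 1) <= z <= - (r + 1) + t.
    move=> zw; have : `|z| <= r + 2 * h.
      rewrite -ler_sqr ?nnegrE// real_normK ?num_real//.
      have := sqr_ge0 w; lra.
    rewrite ler_norml /t; lra.
  move=> [x y] xy; split; rewrite /I/= in_itv/=; first exact: bnd xy.
  by apply: (bnd _ x); rewrite addrC.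
have cE : c' = c' / beta * beta by rewrite divfK// gt_eqF.
rewrite cE; apply: (@fcover_complement 1 _ (- (r + 1)) (- (r + 1)) t n
  ((I `*` I) `\` disc (r + 2 * h)) _ _ _ square_cost1) => //.
- by rewrite ltr_pdivlMr// mul1r.
- move=> p [pr p0].
  have bnd (z w : R) : z ^+ 2 + w ^+ 2 <= r ^+ 2 ->
      - (r + 1) <= z <= - (r + 1) + t.
    move=> zw; have : `|z| <= r.
      rewrite -ler_sqr ?nnegrE ?(ltW r0)// real_normK ?num_real//.
      have := sqr_ge0 w; lra.
    rewrite ler_norml /t; lra.
  by split => //; [exact: bnd pr|apply: (bnd _ p.1.1); rewrite addrC].
- by apply: measurableD => //; exact: measurable_disc.
- have lI : leb2 (I `*` I) = (t ^+ 2)%:E.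
    rewrite leb2_itv; first by congr EFin; ring.
      by rewrite lerDl ltW.
    by rewrite lerDl ltW.
  rewrite measureD//=; last 2 first.
  + exact: measurable_disc.
  + by rewrite [ltLHS]lI ltry.
  rewrite [X in (_ <= X - _)%E]lI (setIidr dI) [X in (_ <= _ - X)%E]leb2_disc//.
- move=> [[x y] z] [x' y'] [/= xyr _] [_ q]; rewrite -/h.
  have [|xh] := ltP h `|x - x'|; first by left.
  have [|yh] := ltP h `|y - y'|; first by right.
  exfalso; apply: q; apply: (disc_thicken (ltW r0) h0 xyr); rewrite distrC//.
Qed.

Lemma abs_sin_le (x : R) : `|sin x| <= `|x|.
Proof.
wlog x0 : x / 0 < x.
  move=> h; have [x0|x0|->] := ltgtP x 0; last by rewrite sin0.
    by rewrite -(normrN x) -(normrN (sin x)) -sinN; apply: h; rewrite oppr_gt0.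
  exact: h.
have ds (y : R) : y \in `]0, x[ -> is_derive y 1 (@sin R) (cos y).
  by move=> _; exact: is_derive_sin.
have cs : {within `[0, x], continuous (@sin R)}.
  by apply: continuous_subspaceT => y; exact: continuous_sin.
have [c _] := MVT x0 ds cs.
rewrite sin0 !subr0 => ->; rewrite normrM ler_piMl// ler_norml.
by rewrite cos_geN1 cos_le1.
Qed.

(* Rolling the flat rectangle onto the cylinder is 1-Lipschitz. *)
Lemma fcost_lateral r h : 0 < r -> 0 < h ->
  fcost [set p | p.1.1 ^+ 2 + p.1.2 ^+ 2 = r ^+ 2 /\ `|p.2| <= h]
    (2 * pi * r * (2 * h)).
Proof.
move=> r0 h0.
have pr0 : 0 < 2 * pi * r by rewrite !mulr_gt0// pi_gt0.
have h20 : 0 < 2 * h by rewrite mulr_gt0.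
pose f (p : R3 R) : R3 R :=
  ((r * cos (p.1.1 / r), r * sin (p.1.1 / r)), p.1.2 - h).
have fl p q : enorm (f p - f q) <= enorm (p - q).
  apply: enorm_le; first exact: enorm_ge0.
  rewrite enorm_sqr /f/=.
  set a := p.1.1 / r; set b := q.1.1 / r; pose y := (a - b) / 2.
  have -> : p.1.1 - q.1.1 = r * (2 * y).
    by rewrite /y /a /b; field; rewrite gt_eqF.
  (* A chord of angle [2 * y] has length [2 * r * |sin y|], to be compared with the arc
     [2 * r * |y|]. *)
  have E : (r * cos a - r * cos b) ^+ 2 + (r * sin a - r * sin b) ^+ 2 =
      r ^+ 2 * (4 * sin y ^+ 2).
    have c2 : cos (a - b) = 1 - 2 * sin y ^+ 2.
      have -> : a - b = y + y by rewrite /y; field.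
      by rewrite cosD -!expr2 cos2sin2; ring.
    rewrite cosB in c2.
    transitivity (r ^+ 2 * ((cos a ^+ 2 + sin a ^+ 2) +
       (cos b ^+ 2 + sin b ^+ 2) - 2 * (cos a * cos b + sin a * sin b))).
      by ring.
    by rewrite c2 !cos2Dsin2; ring.
  have s2 : sin y ^+ 2 <= y ^+ 2.
    by rewrite -(real_normK (num_real (sin y))) -(real_normK (num_real y))
      ler_sqr ?nnegrE// abs_sin_le.
  have : r ^+ 2 * (4 * sin y ^+ 2) <= r ^+ 2 * (4 * y ^+ 2).
    by rewrite ler_wpM2l ?sqr_ge0// ler_wpM2l.
  have := sqr_ge0 (p.2 - q.2).
  have -> : p.1.2 - h - (q.1.2 - h) = p.1.2 - q.1.2 by ring.
  have -> : (r * (2 * y)) ^+ 2 = r ^+ 2 * (4 * y ^+ 2) by ring.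
  rewrite E; have := sqr_ge0 (p.1.2 - q.1.2); lra.
apply: fcost_le (fcost_image (fun p q _ _ => fl p q) (fcost_rectangle pr0 h20)) => //.
move=> [[x y] z] [/= xyr zh].
have xr : -1 <= x / r <= 1.
  rewrite -ler_norml normrM normfV (gtr0_norm r0) ler_pdivrMr// mul1r.
  rewrite -ler_sqr ?nnegrE ?(ltW r0)// real_normK ?num_real//.
  have := sqr_ge0 y; lra.
have [/andP[a0 api] ca] := acos_def xr.
have rs : r * sin (acos (x / r)) = `|y|.
  have yE : y ^+ 2 = r ^+ 2 * (1 - (x / r) ^+ 2).
    have -> : y ^+ 2 = r ^+ 2 - x ^+ 2 by lra.
    by field; rewrite gt_eqF.
  by rewrite sin_acos// -[`|y|]sqrtr_sqr yE sqrtrM ?sqr_ge0// sqrtr_sqr gtr0_norm.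
have rc : r * cos (acos (x / r)) = x by rewrite ca mulrC divfK// gt_eqF.
have pi0 := pi_ge0 R; move: zh; rewrite ler_norml => zh.
have z2 : 0 <= z + h <= 2 * h by lra.
have [y0|y0] := leP 0 y.
  exists ((r * acos (x / r), z + h), 0); first split => //=.
    rewrite mulr_ge0 ?(ltW r0)//= [_ * r]mulrC ler_wpM2l ?(ltW r0)//; lra.
  by rewrite /f/= addrK [r * acos _]mulrC mulfK ?gt_eqF// rc rs ger0_norm.
exists ((r * (2 * pi - acos (x / r)), z + h), 0); first split => //=.
  rewrite [2 * pi * r]mulrC ler_wpM2l ?(ltW r0)// ?mulr_ge0 ?(ltW r0)//; lra.
rewrite /f/= addrK [r * (_ - acos _)]mulrC mulfK ?gt_eqF//.
have -> : 2 * pi - acos (x / r) = - acos (x / r) + pi *+ 2 by rewrite mulr2n; ring.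
by rewrite cosD2pi sinD2pi cosN sinN mulrN rc rs ltr0_norm// opprK.
Qed.

End HausdorffUpper.

(** * Isodiametric inequality and lower bound *)

Section Isodiametric.
Context {R : realType}.
Notation mu := (@lebesgue_measure R).

(** Both [sup S - inf T] and [sup T - inf S] are at most [s], and their sum is the sum of the
    lengths of the intervals that enclose [S] and [T]. *)
Lemma lebesgue_two_sets (S T : set (measurableTypeR R)) (s : R) :
  measurable S -> measurable T -> S !=set0 -> T !=set0 ->
  (forall x y, S x -> T y -> `|x - y| <= s) -> (mu S + mu T <= (2 * s)%:E)%E.
Proof.
move=> mS mT [x0 Sx0] [y0 Ty0] ST.
have hT : has_ubound T /\ has_lbound T.
  split; [exists (x0 + s)|exists (x0 - s)] => y /(ST _ _ Sx0); 
    rewrite ler_norml; lra.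
have hS : has_ubound S /\ has_lbound S.
  split; [exists (y0 + s)|exists (y0 - s)] => x /(fun h => ST _ _ h Ty0);
    rewrite ler_norml; lra.
have sub (A : set (measurableTypeR R)) : measurable A -> A !=set0 ->
    has_ubound A -> has_lbound A ->
    (mu A <= (sup A - inf A)%:E)%E.
  move=> mA [a Aa] uA lA.
  have ia : inf A <= sup A by apply: le_trans (inf_lbound lA Aa) (ub_le_sup uA Aa).
  have -> : (sup A - inf A)%:E = mu `[inf A, sup A]%classic.
    rewrite lebesgue_measure_itv/= lte_fin; case: ltP => // h.
    by congr EFin; lra.
  apply: le_measure; rewrite ?inE//.
  by move=> x Ax; rewrite /= in_itv/= inf_lbound// ub_le_sup.
have h1 : sup S - inf T <= s.
  rewrite lerBlDr; apply: sup_le_ub; first by exists x0.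
  move=> x Sx; rewrite -lerBlDl; apply: lb_le_inf; first by exists y0.
  by move=> y Ty; have := ST _ _ Sx Ty; rewrite ler_norml; lra.
have h2 : sup T - inf S <= s.
  rewrite lerBlDr; apply: sup_le_ub; first by exists y0.
  move=> y Ty; rewrite -lerBlDl; apply: lb_le_inf; first by exists x0.
  by move=> x Sx; have := ST _ _ Sx Ty; rewrite ler_norml; lra.
have := leeD (sub _ mS (ex_intro _ x0 Sx0) hS.1 hS.2)
             (sub _ mT (ex_intro _ y0 Ty0) hT.1 hT.2).
move=> /le_trans; apply; rewrite -EFinD lee_fin; lra.
Qed.

Lemma lebesgue_diam (S : set (measurableTypeR R)) (s : R) : 0 <= s ->
  measurable S -> (forall x y, S x -> S y -> `|x - y| <= s) ->
  (mu S <= s%:E)%E.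
Proof.
move=> s0 mS Ss; have [->|S0] := eqVneq S set0; first by rewrite measure0 lee_fin.
move/set0P : S0 => S0; have := lebesgue_two_sets mS mS S0 S0 Ss.
by case: (mu S) => [r| |]; rewrite ?leNye ?leye_eq// -EFinD !lee_fin; lra.
Qed.

Lemma leb2_ysection (A : set (mR2 R)) : measurable A ->
  leb2 A = (\int[mu]_y mu (ysection A y))%E.
Proof.
move=> mA; have := @indic_fubini_tonelli _ _ _ _ R mu mu A mA.
rewrite indic_fubini_tonelli_FE// indic_fubini_tonelli_GE//.
Qed.

(* Steiner symmetrization in the second variable: the sections of the
   symmetrized set in the first variable are no longer than those of the disc. *)
Lemma isodiametric (G : set (mR2 R)) (d : R) : 0 <= d -> measurable G ->
  (forall p q, G p -> G q -> (p.1 - q.1) ^+ 2 + (p.2 - q.2) ^+ 2 <= d ^+ 2) ->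
  (leb2 G <= (pi / 4 * d ^+ 2)%:E)%E.
Proof.
move=> d0 mG Gd.
pose m x := mu (xsection G x).
have mm : measurable_fun setT m by exact: measurable_fun_xsection.
have m0 x : (0 <= m x)%E by [].
(* Points of [G] over [x1] and [x2] are at distance at most [d], so their heights differ by at most
   [sqrt (d ^ 2 - (x1 - x2) ^ 2)]. *)
have key x1 x2 : (0 < m x1)%E -> (0 < m x2)%E ->
    (x1 - x2) ^+ 2 <= d ^+ 2 /\
    (m x1 + m x2 <= (2 * Num.sqrt (d ^+ 2 - (x1 - x2) ^+ 2))%:E)%E.
  have ne x : (0 < m x)%E -> xsection G x !=set0.
    by move=> mx; apply/set0P; apply: contraTneq mx => E; rewrite /m E measure0 ltxx.
  move=> /ne S1 /ne S2; split.
    case: S1 => y1; case: S2 => y2; rewrite /xsection/= !inE => G2 G1.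
    by have := Gd _ _ G1 G2; have /= := sqr_ge0 (y1 - y2); lra.
  apply: lebesgue_two_sets => //; try exact: measurable_xsection.
  move=> y1 y2; rewrite /xsection/= !inE => G1 G2.
  rewrite -sqrtr_sqr ler_wsqrtr//; have /= := Gd _ _ G1 G2; lra.
have mfin x : m x \is a fin_num.
  rewrite ge0_fin_numE//; have := m0 x.
  rewrite le_eqVlt => /orP[/eqP<-//|mx].
  by have [_] := key x x mx mx; case: (m x) mx => [r| |]; rewrite ?ltry// leye_eq.
(* The symmetrized set: each vertical section is replaced by the centred open interval of the same
   length. *)
pose Gs : set (mR2 R) := [set p | ((2 * `|p.2|)%:E < m p.1)%E].
have mGs : measurable Gs.
  have mg : measurable_fun [set: mR2 R] (fun p => fine (m p.1) - 2 * `|p.2|).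
    apply: measurable_funB.
      apply: measurableT_comp => //; exact: measurableT_comp.
    apply: measurable_funM => //; exact: measurableT_comp.
  rewrite (_ : Gs = (fun p => fine (m p.1) - 2 * `|p.2|) @^-1` `]0, +oo[%classic).
    by rewrite -[X in measurable X]setTI; apply: mg => //; exact: measurable_itv.
  apply/seteqP; split => p; rewrite /Gs/= in_itv/= andbT subr_gt0;
    by rewrite -(fineK (mfin p.1)) lte_fin.
have -> : leb2 G = leb2 Gs.
  apply: eq_integral => x _ /=; rewrite -/(m x).
  rewrite (_ : xsection Gs x = `](- (fine (m x) / 2)), (fine (m x) / 2)[%classic).
    rewrite lebesgue_measure_itv/= lte_fin.
    have := m0 x; rewrite -(fineK (mfin x)) lee_fin => mx0.
    case: ltP => h; [rewrite -EFinB|]; congr EFin; lra.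
  apply/seteqP; split => y; rewrite /xsection/= inE/= /Gs/= -[m x]fineK// lte_fin
    in_itv/= -ltr_norml; lra.
rewrite leb2_ysection//.
have -> : pi / 4 * d ^+ 2 = pi * (d / 2) ^+ 2 by field.
rewrite -leb2_disc; last by rewrite divr_ge0.
rewrite leb2_ysection; last exact: measurable_disc.
apply: ge0_le_integral => //.
- exact: measurable_fun_ysection.
- apply: measurable_fun_ysection; exact: measurable_disc.
move=> y _.
have -> : ysection (disc (d / 2)) y =
    `](- Num.sqrt ((d / 2) ^+ 2 - y ^+ 2)), Num.sqrt ((d / 2) ^+ 2 - y ^+ 2)[%classic.
  apply/seteqP; split => x; rewrite /ysection/= inE/= in_itv/= -ltr_norml.
    rewrite /disc/= => h; rewrite -sqrtr_sqr ltr_sqrt; first lra.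
    have := sqr_ge0 x; lra.
  have [h|h] := ltP 0 ((d / 2) ^+ 2 - y ^+ 2); last first.
    by rewrite ler0_sqrtr// ltNge normr_ge0.
  rewrite -sqrtr_sqr ltr_sqrt// /disc/=; lra.
set s := Num.sqrt _; have s0 : 0 <= s by exact: sqrtr_ge0.
have -> : mu `](- s), s[%classic = (2 * s)%:E.
  by rewrite lebesgue_measure_itv/= lte_fin; case: ltP => h; [rewrite -EFinB|];
    congr EFin; lra.
apply: lebesgue_diam; [lra|exact: measurable_ysection|].
move=> x1 x2; rewrite /ysection/= !inE /Gs/= => h1 h2.
have y0 : (0 <= (2 * `|y|)%:E)%E by rewrite lee_fin mulr_ge0.
have [k1 k2] := key x1 x2 (le_lt_trans y0 h1) (le_lt_trans y0 h2).
(* If [x1] and [x2] lie in the section at height [y], then [4 * |y| < m x1 + m x2], so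
   [(x1 - x2) ^ 2 + 4 * y ^ 2 <= d ^ 2]: the section is no longer than the chord of the disc of
   diameter [d]. *)
have : 2 * `|y| < Num.sqrt (d ^+ 2 - (x1 - x2) ^+ 2).
  have := lt_le_trans (lteD h1 h2) k2; rewrite -EFinD lte_fin; lra.
rewrite -(@ltr_sqr _ (2 * `|y|)) ?nnegrE ?sqrtr_ge0 ?mulr_ge0// sqr_sqrtr ?subr_ge0//.
rewrite exprMn real_normK ?num_real// => h.
rewrite -ler_sqr ?nnegrE//; last lra.
have := sqr_ge0 (x1 - x2); move: h.
rewrite real_normK ?num_real// exprMn /s; set w : R := (x1 - x2) ^+ 2 => h w0.
have d4 : (d / 2) ^+ 2 = d ^+ 2 / 4 by field.
by rewrite d4 sqr_sqrtr; lra.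
Qed.

(** The condition is closed in each variable separately, so it passes to the closure one variable at
    a time. Closures turn arbitrary covering sets into measurable ones at no cost. *)
Lemma closure_diam (G : set (R * R)) (d : R) :
  (forall p q, G p -> G q -> (p.1 - q.1) ^+ 2 + (p.2 - q.2) ^+ 2 <= d ^+ 2) ->
  forall p q, closure G p -> closure G q ->
    (p.1 - q.1) ^+ 2 + (p.2 - q.2) ^+ 2 <= d ^+ 2.
Proof.
move=> Gd.
have cl (q : R * R) :
    closed [set p : R * R | (p.1 - q.1) ^+ 2 + (p.2 - q.2) ^+ 2 <= d ^+ 2].
  rewrite (_ : mkset _ = (fun p : R * R =>
    (p.1 - q.1) * (p.1 - q.1) + (p.2 - q.2) * (p.2 - q.2)) @^-1` [set x | x <= d ^+ 2])//.
  apply: closed_comp; last exact: closed_le.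
  by move=> p _; apply: cvgD; apply: cvgM; apply: cvgB;
    (exact: cvg_cst || exact: cvg_fst || exact: cvg_snd).
have sub A (B : set (R * R)) : closed B -> A `<=` B -> closure A `<=` B.
  by move=> /closure_id {2}-> AB; exact: closureS.
have step q : G q -> forall p, closure G p ->
    (p.1 - q.1) ^+ 2 + (p.2 - q.2) ^+ 2 <= d ^+ 2.
  by move=> Gq; exact: (sub G _ (cl q) (fun p Gp => Gd p q Gp Gq)).
have sym (p q : R * R) : (p.1 - q.1) ^+ 2 + (p.2 - q.2) ^+ 2 =
    (q.1 - p.1) ^+ 2 + (q.2 - p.2) ^+ 2 by ring.
move=> p q Gp Gq; rewrite sym; apply: (sub G _ (cl p) _ q Gq) => y Gy /=.
by rewrite sym; exact: step.
Qed.

(** Each covering set is cut by the plane [y = 0] and closed; the isodiametric inequality bounds the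
    area of the trace by the term of the covering sum. The bound holds at every mesh, so mesh 1 is
    enough. *)
Lemma hausdorff2_slit (S : set (mR2 R)) (A : set (R3 R)) : measurable S ->
  (forall x z, S (x, z) -> A ((x, 0), z)) -> (leb2 S <= hausdorff2 A)%E.
Proof.
move=> mS SA; apply: (@le_trans _ _ (hausdorff2_pre 1 A)); last first.
  by apply: ereal_sup_ubound; exists 1 => /=.
apply: le_ereal_inf_tmp => _ [F [AF Fd] <-].
pose G0 k : set (R * R) := [set q | F k ((q.1, 0), q.2)].
pose G k : set (mR2 R) := closure (G0 k).
have mG k : measurable (G k).
  by apply: closed_measurable2; exact: closed_closure.
apply: (@le_trans _ _ (leb2 (\bigcup_k G k))).
  apply: le_measure; rewrite ?inE//; first exact: bigcupT_measurable.
  move=> [x z] /SA/AF[k _ Fk]; exists k => //; exact: subset_closure.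
have mU : measurable (\bigcup_k G k) by exact: bigcupT_measurable.
have B : (leb2 (\bigcup_k G k) <= \sum_(0 <= k <oo) leb2 (G k))%E.
  exact: (generalized_Boole_inequality (@leb2 R) mG mU).
apply: le_trans B _.
apply: lee_nneseries => [k _ //|k _].
have dk0 := diam_ge0 (F k); have dk1 := Fd k.
have dfin : diam (F k) \is a fin_num.
  by rewrite ge0_fin_numE// (le_lt_trans dk1)// ltry.
rewrite -(fineK dfin) -EFin_expe -EFinM; apply: isodiametric => //.
  exact: fine_ge0.
apply: closure_diam => p q Gp Gq.
have : enorm ((((p.1, 0), p.2) : R3 R) - ((q.1, 0), q.2)) <= fine (diam (F k)).
  rewrite -lee_fin fineK//; apply: ereal_sup_ubound; right.
  by exists (((p.1, 0), p.2), ((q.1, 0), q.2)).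
rewrite -ler_sqr ?nnegrE ?enorm_ge0 ?fine_ge0// enorm_sqr /= subrr expr0n/=.
by rewrite addr0.
Qed.

End Isodiametric.

(** * Approximate limits *)

Section MeanLimit.
Context {R : realType}.
Implicit Types (O : set (R3 R)) (u g : R3 R -> R) (x c : R3 R).
Notation mu := (@lebesgue_measure R).

Definition cube x (k : R) : set (R3 R) :=
  [set y | [/\ `|y.1.1 - x.1.1| < k, `|y.1.2 - x.1.2| < k & `|y.2 - x.2| < k]].

Lemma leb3_cube x k : 0 < k -> measurable (cube x k : set (mR3 R)) /\
  leb3 (cube x k) = ((2 * k) ^+ 3)%:E.
Proof.
move=> k0; pose I (a : R) := `](a - k), (a + k)[%classic.
have lI a : mu (I a) = (2 * k)%:E.
  rewrite lebesgue_measure_itv/= lte_fin ifT; last lra.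
  by rewrite -EFinB; congr EFin; lra.
have IE (a y : R) : (I a y) = (`|y - a| < k).
  by apply/propext; rewrite /I/= in_itv/= ltr_norml; split=> ?; lra.
have -> : cube x k = (I x.1.1 `*` I x.1.2) `*` I x.2.
  apply/seteqP; split => y.
    by move=> [y1 y2 y3]; split; [split|]; rewrite IE.
  by move=> [[y1 y2] y3]; split; rewrite -IE.
have mI a : measurable (I a : set (measurableTypeR R)) by exact: measurable_itv.
have m2 : measurable (I x.1.1 `*` I x.1.2 : set (mR2 R)) by exact: measurableX.
split; first exact: measurableX.
rewrite [LHS](@product_measure1E _ _ _ _ R (@leb2 R) mu)//.
rewrite [X in (X * _)%E](@product_measure1E _ _ _ _ R mu mu)//.
by rewrite [X in (X * _ * _)%E]lI [X in (_ * X * _)%E]lI [X in (_ * X)%E]lI -!EFinM;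
  congr EFin; ring.
Qed.

Lemma continuous_enorm_sub x : continuous (fun y : R3 R => enorm (y - x)).
Proof.
move=> y; rewrite /enorm.
apply: (@continuous_comp _ _ _ (fun y : R3 R => (y - x).1.1 ^+ 2 +
  (y - x).1.2 ^+ 2 + (y - x).2 ^+ 2) (@Num.sqrt R)); last exact: sqrt_continuous.
have c1 : (fun y : R3 R => y.1.1) @ y --> y.1.1.
  by apply: (@cvg_comp _ _ _ fst fst); exact: cvg_fst.
have c2 : (fun y : R3 R => y.1.2) @ y --> y.1.2.
  by apply: (@cvg_comp _ _ _ fst snd); [exact: cvg_fst|exact: cvg_snd].
have c3 : (fun y : R3 R => y.2) @ y --> y.2 by exact: cvg_snd.
by apply: cvgD; [apply: cvgD|]; apply: cvgM; apply: cvgB => //; exact: cvg_cst.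
Qed.

Lemma open_eball x r : open (eball x r).
Proof.
rewrite (_ : eball x r = (fun y => enorm (y - x)) @^-1` [set z | z < r])//.
apply: open_comp; last exact: open_lt.
by move=> y _; exact: continuous_enorm_sub.
Qed.

Lemma enorm_coord x : [/\ `|x.1.1| <= enorm x, `|x.1.2| <= enorm x & `|x.2| <= enorm x].
Proof.
have e0 := enorm_ge0 x; have e2 := enorm_sqr x.
have h1 := sqr_ge0 x.1.1; have h2 := sqr_ge0 x.1.2; have h3 := sqr_ge0 x.2.
by split; rewrite -ler_sqr ?nnegrE// real_normK ?num_real// e2; lra.
Qed.

Lemma eball_cube x r : eball x r `<=` cube x r.
Proof.
move=> y; rewrite /eball/= => yr; have [h1 h2 h3] := enorm_coord (y - x).
by split; apply: le_lt_trans yr.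
Qed.

(** The half-diagonal is [sqrt 3 * k], and [sqrt 3 < 2]. *)
Lemma cube_eball x k r : 0 < k -> 2 * k <= r -> cube x k `<=` eball x r.
Proof.
move=> k0 kr y [h1 h2 h3]; rewrite /eball/=; apply: lt_le_trans kr.
rewrite -ltr_sqr ?nnegrE ?enorm_ge0 ?mulr_ge0 ?(ltW k0)// enorm_sqr/=.
have sq (z : R) : `|z| < k -> z ^+ 2 < k ^+ 2.
  by move=> zk; rewrite -(real_normK (num_real z)) ltr_sqr ?nnegrE// ltW.
have := sq _ h1; have := sq _ h2; have := sq _ h3.
have : 0 < k ^+ 2 by rewrite exprn_gt0.
lra.
Qed.

Lemma eball_nbhs x (U : set (R3 R)) : nbhs x U ->
  exists2 d : R, 0 < d & eball x d `<=` U.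
Proof.
move=> [[V W] [/= [[V1 V2] [/= V1x V2x] V12] Wx] VWU].
have /nbhs_ballP[d1 /= d10 h1] := V1x.
have /nbhs_ballP[d2 /= d20 h2] := V2x.
have /nbhs_ballP[d3 /= d30 h3] := Wx.
exists (Num.min d1 (Num.min d2 d3)); first by rewrite !lt_min d10 d20.
move=> y /eball_cube[]; rewrite !lt_min => /and3P[y1 _ _] /and3P[_ y2 _] /and3P[_ _ y3].
apply: VWU; split => /=.
  by apply: V12; split => /=; [apply: h1|apply: h2]; rewrite /ball/= distrC.
by apply: h3; rewrite /ball/= distrC.
Qed.

Lemma leb3_ball_fin O x r : open O -> 0 < r ->
  measurable (O `&` eball x r : set (mR3 R)) /\
  (leb3 (O `&` eball x r) <= (8 * r ^+ 3)%:E)%E.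
Proof.
move=> oO r0.
have mOB : measurable (O `&` eball x r : set (mR3 R)).
  by apply: open_measurable3; apply: openI => //; exact: open_eball.
split => //; have [mc lc] := leb3_cube x r0.
have -> : (8 * r ^+ 3)%:E = leb3 (cube x r) by rewrite lc; congr EFin; ring.
apply: le_measure; rewrite ?inE//.
by move=> y [_ /eball_cube].
Qed.

Lemma measurable_dev u (a : R) : measurable_fun [set: mR3 R] u ->
  measurable_fun [set: mR3 R] (fun y => `|u y - a|%:E).
Proof.
move=> mu_; apply/measurable_EFinP; apply: measurableT_comp => //.
exact: measurable_funB.
Qed.

Lemma mean_dev_ge0 O u x a r : (0 <= mean_dev O u x a r)%E.
Proof.
by rewrite /mean_dev mule_ge0 ?inve_ge0 ?integral_ge0// => y _; rewrite lee_fin.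
Qed.

Lemma ecvg0P (T : Type) (F : set_system T) {FF : Filter F} (f : T -> \bar R) :
  (forall r, 0 <= f r)%E ->
  f @ F --> 0%E <-> forall e, 0 < e -> \forall r \near F, (f r <= e%:E)%E.
Proof.
move=> f0; split=> [/fine_cvgP[ffin /cvgrPdist_le fc] e e0|fe].
  have := fc e e0; apply: filterS2 ffin => r fr.
  rewrite sub0r normrN ger0_norm ?fine_ge0// => h.
  by rewrite -(fineK fr) lee_fin.
apply/fine_cvgP; split.
  apply: filterS (fe 1 ltr01) => r fr.
  by rewrite ge0_fin_numE// (le_lt_trans fr)// ltry.
apply/cvgrPdist_le => e e0; apply: filterS (fe e e0) => r fr /=.
rewrite sub0r normrN ger0_norm ?fine_ge0// -lee_fin fineK//.
by rewrite ge0_fin_numE// (le_lt_trans fr)// ltry.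
Qed.

Lemma mean_dev_le O u x (a e r : R) : open O -> 0 < r -> 0 <= e ->
  measurable_fun [set: mR3 R] u ->
  (forall y, O y -> eball x r y -> `|u y - a| <= e) -> (mean_dev O u x a r <= e%:E)%E.
Proof.
move=> oO r0 e0 mu_ ue; have [mB lB] := leb3_ball_fin x oO r0.
have I : (\int[@leb3 R]_(y in O `&` eball x r) `|u y - a|%:E <=
    e%:E * leb3 (O `&` eball x r))%E.
  rewrite -integral_cst//; apply: ge0_le_integral => //.
  - by apply: measurable_funTS; exact: measurable_dev.
  - by move=> y [Oy By]; rewrite lee_fin ue.
have l0 : (0%:E <= leb3 (O `&` eball x r))%E := measure_ge0 (@leb3 R) _.
rewrite /mean_dev; move: l0 lB I.
move: (leb3 (O `&` _)) => [m| |]//; rewrite lee_fin => m0 _ I.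
(* On a null intersection the integral is 0, and so is its product with the inverse, whatever the
   latter is. *)
have [m0'|m0'] := eqVneq m 0.
  rewrite [X in (_ * X)%E](_ : _ = 0%E) ?mule0//.
  apply/eqP; rewrite eq_le integral_ge0// andbT.
  by rewrite (le_trans I)// m0' mule0.
rewrite inver (negbTE m0') muleC lee_pdivrMr// lt_neqAle eq_sym m0' m0//.
Qed.

(** The set [C] is a fixed fraction of the ball: it has measure at least [m * r ^ 3], while the ball
    lies in a cube of volume [8 * r ^ 3]. *)
Lemma mean_dev_ge O u x (a e m r : R) (C : set (mR3 R)) : open O -> 0 < r -> 0 <= e ->
  0 <= m -> measurable_fun [set: mR3 R] u -> measurable C ->
  C `<=` O `&` eball x r -> ((m * r ^+ 3)%:E <= leb3 C)%E ->
  (forall y, C y -> e <= `|u y - a|) ->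
  ((e * m / 8)%:E <= mean_dev O u x a r)%E.
Proof.
move=> oO r0 e0 m0 mu_ mC CO Cr Ce; have [mB lB] := leb3_ball_fin x oO r0.
have I : ((e * (m * r ^+ 3))%:E <=
    \int[@leb3 R]_(y in O `&` eball x r) `|u y - a|%:E)%E.
  apply: (@le_trans _ _ (\int[@leb3 R]_(y in C) `|u y - a|%:E)%E).
    rewrite EFinM; apply: (@le_trans _ _ (e%:E * leb3 C)%E).
      by rewrite lee_wpmul2l// lee_fin.
    rewrite -integral_cst//; apply: ge0_le_integral => //.
    - by apply: measurable_funTS; exact: measurable_dev.
  apply: ge0_subset_integral => //.
  by apply: measurable_funTS; exact: measurable_dev.
have r30 : 0 < r ^+ 3 by rewrite exprn_gt0.
rewrite /mean_dev; have [B0|B0] := eqVneq (leb3 (O `&` eball x r)) 0%E.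
  have C0 : (leb3 C <= 0)%E by rewrite -B0; apply: le_measure; rewrite ?inE.
  have m00 : m = 0.
    apply/eqP; rewrite eq_le m0 andbT -(pmulr_lle0 _ r30) -lee_fin.
    exact: le_trans C0.
  by rewrite m00 mulr0 mul0r mule_ge0 ?inve_ge0 ?integral_ge0.
have l0 : (0%:E <= leb3 (O `&` eball x r))%E := measure_ge0 (@leb3 R) _.
move: l0 lB B0; move: (leb3 (O `&` _)) => [b| |]//; rewrite !lee_fin => b0 b8 bn.
have {}b0 : 0 < b by rewrite lt_neqAle b0 eq_sym andbT; apply: contraNneq bn => ->.
rewrite inver gt_eqF// muleC lee_pdivlMr//; apply: le_trans I.
rewrite -EFinM lee_fin; have em : 0 <= e * m by rewrite mulr_ge0.
by have := ler_wpM2l em b8; lra.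
Qed.

Lemma has_mean_limit_continuous O u x : open O -> O x ->
  measurable_fun [set: mR3 R] u -> {for x, continuous u} ->
  has_mean_limit O u x (u x).
Proof.
move=> oO Ox mu_ cu; apply/ecvg0P => [r|e e0]; first exact: mean_dev_ge0.
have [d d0 dU] : exists2 d : R, 0 < d & eball x d `<=` [set y | `|u y - u x| <= e].
  apply: eball_nbhs; have /cvgrPdist_le/(_ e e0) := cu.
  by apply: filterS => y; rewrite distrC.
near=> r; apply: mean_dev_le => //; first exact: ltW.
move=> y _ yr; apply: dU; apply: lt_le_trans yr _; near: r.
exact: nbhs_right_le.
Unshelve. all: by end_near. Qed.

(** The centre is within [r / 2] of [p], and the cube lies in a ball of radius [r / 2] about that
    centre. *)
Lemma cone_eball p (c : R3 R) (k r : R) : 0 < k <= 4^-1 -> enorm c <= 2^-1 -> 0 < r ->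
  cube (p + ((r * c.1.1, r * c.1.2), r * c.2)) (k * r) `<=` eball p r.
Proof.
move=> /andP[k0 k4] c2 r0; have kr : 0 < k * r by rewrite mulr_gt0.
set w : R3 R := ((r * c.1.1, r * c.1.2), r * c.2).
have wr : enorm w <= r / 2.
  apply: enorm_le; first by rewrite divr_ge0// ltW.
  rewrite /= !exprMn -!mulrDr -enorm_sqr ler_pM2l ?exprn_gt0//.
  by rewrite ler_sqr ?nnegrE ?enorm_ge0.
move=> y /(@cube_eball _ _ (r / 2) kr) => /(_ _)/wrap[|yv]; first nra.
rewrite /eball/= in yv *.
have := enorm_triangle (y - (p + w)) w; rewrite opprD addrA subrK => h.
by rewrite opprD addrA in yv; lra.
Qed.

(* [u] is only known to agree with [g] on a family of cubes of size
   comparable with their distance to [x]. *)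
Lemma mean_limit_cone O u g x c k a : open O -> O x ->
  measurable_fun [set: mR3 R] u -> {for x, continuous g} ->
  0 < k <= 4^-1 -> enorm c <= 2^-1 ->
  (\forall r \near 0^'+, forall y,
    cube (x + ((r * c.1.1, r * c.1.2), r * c.2)) (k * r) y -> u y = g y) ->
  has_mean_limit O u x a -> a = g x.
Proof.
move=> oO Ox mu_ cg /andP[k0 k4] c2 ug /ecvg0P lim; apply/eqP/negPn/negP => ag.
(* If [a] differs from [g x], then near [x] the function [g] stays [e] away from [a], so the cubes
   alone keep the mean deviation above [e * m / 8]; the limit is contradicted at half that level. *)
pose e := `|a - g x| / 2.
have e0 : 0 < e by rewrite divr_gt0// normr_gt0 subr_eq0.
have [d d0 dU] : exists2 d : R, 0 < d &
    eball x d `<=` [set y | `|g y - g x| <= e] `&` O.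
  apply: eball_nbhs; have /cvgrPdist_le/(_ e e0) h := cg.
  apply: filterI; last exact: open_nbhs_nbhs.
  by apply: filterS h => y; rewrite distrC.
pose m := (2 * k) ^+ 3; have m0 : 0 < m by rewrite exprn_gt0// mulr_gt0.
have t0 : 0 < e * m / 16 by rewrite divr_gt0// mulr_gt0.
have {}lim := lim (mean_dev_ge0 O u x a) _ t0.
suff : \forall r \near (0:R)^'+, False by case/filter_ex.
near=> r.
have r0 : 0 < r by [].
have ur : forall y, cube (x + ((r * c.1.1, r * c.1.2), r * c.2)) (k * r) y ->
    u y = g y by near: r.
have kr : 0 < k * r by rewrite mulr_gt0.
pose v : R3 R := ((r * c.1.1, r * c.1.2), r * c.2).
have [mC lC] := leb3_cube (x + v) kr.
have k04 : 0 < k <= 4^-1 by rewrite k0.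
have Cx : cube (x + v) (k * r) `<=` eball x r by exact: cone_eball.
have rd : r <= d by near: r; exact: nbhs_right_le.
have CdU : cube (x + v) (k * r) `<=` [set y | `|g y - g x| <= e] `&` O.
  by move=> y /Cx yr; apply: dU; exact: lt_le_trans rd.
have : ((e * m / 8)%:E <= mean_dev O u x a r)%E.
  apply: (mean_dev_ge oO r0 (ltW e0) (ltW m0) mu_ mC).
  - by move=> y Cy; split; [case: (CdU _ Cy)|exact: Cx].
  - by rewrite lC lee_fin le_eqVlt; apply/orP; left; apply/eqP; rewrite /m; ring.
  - move=> y Cy; have [/= h _] := CdU _ Cy.
    rewrite (ur _ Cy).
    have : `|a - g x| <= `|g y - a| + `|g y - g x|.
      by rewrite -[`|g y - a|]normrN opprB (le_trans _ (ler_normD _ _))// addrA subrK.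
    rewrite /e in h *; lra.
apply/negP; rewrite -ltNge; apply: (@le_lt_trans _ _ (e * m / 16)%:E).
  by near: r.
rewrite lte_fin; lra.
Unshelve. all: by end_near. Qed.

End MeanLimit.

(** * The crack-tip function *)

Section CrackTip.
Context {R : realType}.
Variable delta : R.
Implicit Types (x y z t : R) (p : R3 R) (q : R * R).

Lemma measurable_inv : measurable_fun setT (@GRing.inv R).
Proof.
have -> : setT = [set x : R | x != 0] `|` [set 0].
  apply/seteqP; split => // x _ /=; have [->|x0] := eqVneq x 0; first by right.
  by left.
have oU : open [set x : R | x != 0].
  rewrite (_ : mkset _ = ~` [set 0]); last first.
    by apply/seteqP; split => x /=; [move/eqP|move=> h; apply/eqP].
  by apply: closed_openC; exact: closed_eq.
apply/measurable_funU => //; first exact: open_measurable.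
split; last exact: measurable_fun_set1.
apply: open_continuous_measurable_fun => // x; rewrite inE /= => x0.
exact: inv_continuous.
Qed.

Definition prad x y := Num.sqrt (x ^+ 2 + y ^+ 2).
(* [wup] is [sqrt (2 r / pi) * |sin (theta / 2)|], by the half-angle formula. *)
Definition wup x y := Num.sqrt ((prad x y - x) / pi).
(** The two branches of [u_delta], each extended continuously to the whole space; they give its
    one-sided values on the slit. *)
Definition uup p := wup p.1.1 p.1.2 + delta * p.2.
Definition ulo p := - wup p.1.1 p.1.2 + delta * p.2.

Lemma prad_ge0 x y : 0 <= prad x y. Proof. exact: sqrtr_ge0. Qed.

Lemma prad_sqr x y : prad x y ^+ 2 = x ^+ 2 + y ^+ 2.
Proof. by rewrite sqr_sqrtr// addr_ge0 ?sqr_ge0. Qed.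

Lemma prad_abs x y : `|x| <= prad x y.
Proof. by rewrite -sqrtr_sqr ler_wsqrtr// lerDl sqr_ge0. Qed.

Lemma prad_gt0 x y : (x != 0) || (y != 0) -> 0 < prad x y.
Proof.
move=> h; rewrite lt_neqAle prad_ge0 andbT eq_sym -sqrf_eq0 prad_sqr.
by rewrite paddr_eq0 ?sqr_ge0// !sqrf_eq0 negb_and.
Qed.

Lemma prad_subr_ge0 x y : 0 <= (prad x y - x) / pi.
Proof.
by rewrite divr_ge0 ?pi_ge0// subr_ge0 (le_trans (ler_norm _) (prad_abs _ _)).
Qed.

Lemma wup_sqr x y : wup x y ^+ 2 = (prad x y - x) / pi.
Proof. by rewrite sqr_sqrtr// prad_subr_ge0. Qed.

Lemma u_deltaE p : u_delta delta p = if 0 <= p.1.2 then uup p else ulo p.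
Proof.
case: p => [[x y] z]; rewrite /u_delta /uup /ulo /= -/(prad x y).
suff -> : Num.sqrt (2 * prad x y / pi) * sin (polar_angle x y / 2) =
    if 0 <= y then wup x y else - wup x y by case: ifP.
have [r0|] := eqVneq (prad x y) 0.
  have /eqP := prad_sqr x y; rewrite r0 expr0n eq_sym paddr_eq0 ?sqr_ge0// !sqrf_eq0.
  move=> /andP[/eqP -> /eqP ->]; rewrite /wup /prad expr0n addr0 sqrtr0.
  by rewrite mulr0 mul0r sqrtr0 mul0r subrr mul0r sqrtr0 lexx.
rewrite neq_lt ltNge prad_ge0 /= => r0.
rewrite /polar_angle -/(prad x y); set t := acos _.
have xr : -1 <= x / prad x y <= 1.
  rewrite -ler_norml normrM normfV (gtr0_norm r0) ler_pdivrMr// mul1r.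
  exact: prad_abs.
have [/andP[t0 tpi] ct] := acos_def xr; rewrite -/t in t0 tpi ct.
have st0 : 0 <= sin (t / 2).
  by rewrite sin_ge0_pi// divr_ge0//=; have := pi_ge0 R; lra.
have s2 : sin (t / 2) ^+ 2 = (1 - x / prad x y) / 2.
  rewrite -ct [in RHS](_ : t = t / 2 + t / 2); last by field.
  by rewrite cosD -!expr2 cos2sin2; field.
have E : Num.sqrt (2 * prad x y / pi) * sin (t / 2) = wup x y.
  rewrite -[sin _](ger0_norm st0) -sqrtr_sqr s2 -sqrtrM; last first.
    by rewrite divr_ge0 ?mulr_ge0 ?pi_ge0 ?prad_ge0.
  congr Num.sqrt; have := pi_gt0 R; move: (@pi R) => P P0.
  by field; rewrite !gt_eqF.
case: ifPn => _ //.
by rewrite -E mulNr sinN mulrN.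
Qed.

(* The gradient of [u_delta] off the half-plane [y = 0, x <= 0]. *)
Definition crack_grad p (i : nat) : R :=
  let r := prad p.1.1 p.1.2 in
  if i is 0 then - (u_delta delta p - delta * p.2) / (2 * r) else
  if i is 1 then Num.sqrt ((r + p.1.1) / pi) / (2 * r) else delta.

Lemma crack_grad_sqr p : \sum_(i < 3) crack_grad p i ^+ 2 =
  (2 * pi)^-1 * (prad p.1.1 p.1.2)^-1 + delta ^+ 2.
Proof.
rewrite !big_ord_recl big_ord0 addr0 addrA /=; congr (_ + _).
case: p => [[x y] z] /=.
(* On the axis, division by 0 makes both singular terms equal to 0. *)
have [r0|] := eqVneq (prad x y) 0.
  by rewrite r0 !mulr0 !invr0 !mulr0 expr0n addr0.
rewrite neq_lt ltNge prad_ge0 /= => r0.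
have E : (u_delta delta ((x, y), z) - delta * z) ^+ 2 = (prad x y - x) / pi.
  rewrite u_deltaE /uup /ulo /= -wup_sqr; case: ifP => _; first by rewrite addrK.
  by rewrite addrK sqrrN.
have E2 : Num.sqrt ((prad x y + x) / pi) ^+ 2 = (prad x y + x) / pi.
  rewrite sqr_sqrtr// divr_ge0 ?pi_ge0//.
  have := prad_abs x y; rewrite ler_norml; lra.
rewrite !exprMn sqrrN E E2 -mulrDl; have := pi_gt0 R; move: (@pi R) => P P0.
by field; rewrite !gt_eqF.
Qed.

Lemma continuous_coord1 : continuous (fun p : R3 R => p.1.1).
Proof. by move=> p; apply: (@cvg_comp _ _ _ fst fst); exact: cvg_fst. Qed.

Lemma continuous_coord2 : continuous (fun p : R3 R => p.1.2).
Proof.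
by move=> p; apply: (@cvg_comp _ _ _ fst snd); [exact: cvg_fst|exact: cvg_snd].
Qed.

Lemma continuous_coord3 : continuous (fun p : R3 R => p.2).
Proof. by move=> p; exact: cvg_snd. Qed.

Lemma continuous_sqrt_comp (T : topologicalType) (f : T -> R) :
  continuous f -> continuous (fun a => Num.sqrt (f a)).
Proof.
move=> cf x; apply: (@continuous_comp _ _ _ f (@Num.sqrt R)); first exact: cf.
exact: sqrt_continuous.
Qed.

Lemma continuous_prad_comp (T : topologicalType) (f g : T -> R) :
  continuous f -> continuous g -> continuous (fun a => prad (f a) (g a)).
Proof.
move=> cf cg; apply: continuous_sqrt_comp => x.
by apply: cvgD; [apply: (@cvgM _ _ _ _ f f)|apply: (@cvgM _ _ _ _ g g)];
  (exact: cf || exact: cg).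
Qed.

Lemma continuous_wup_comp (T : topologicalType) (f g : T -> R) :
  continuous f -> continuous g -> continuous (fun a => wup (f a) (g a)).
Proof.
move=> cf cg; apply: continuous_sqrt_comp => x; apply: cvgM; last exact: cvg_cst.
by apply: cvgB; [exact: continuous_prad_comp|exact: cf].
Qed.

Lemma continuous_uup : continuous uup.
Proof.
move=> p; apply: cvgD.
  exact: (continuous_wup_comp continuous_coord1 continuous_coord2).
by apply: cvgM; [exact: cvg_cst|exact: continuous_coord3].
Qed.

Lemma continuous_ulo : continuous ulo.
Proof.
move=> p; apply: cvgD.
  apply: cvgN.
  exact: (continuous_wup_comp continuous_coord1 continuous_coord2).
by apply: cvgM; [exact: cvg_cst|exact: continuous_coord3].
Qed.

Lemma measurable_coord2_ge0 :
  measurable ([set p : R3 R | 0 <= p.1.2] : set (mR3 R)).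
Proof.
apply: closed_measurable3.
rewrite (_ : mkset _ = (fun p : R3 R => p.1.2) @^-1` [set x | 0 <= x])//.
by apply: closed_comp; [move=> p _; exact: continuous_coord2|exact: closed_ge].
Qed.

Lemma measurable_u_delta : measurable_fun [set: mR3 R] (u_delta delta : mR3 R -> R).
Proof.
rewrite (_ : u_delta delta = fun p => if 0 <= p.1.2 then uup p else ulo p); last first.
  by apply/funext => p; rewrite u_deltaE.
apply: measurable_fun_ifT.
- apply: (measurable_fun_bool true); rewrite setTI.
  exact: measurable_coord2_ge0.
- by apply: continuous_measurable3; exact: continuous_uup.
- by apply: continuous_measurable3; exact: continuous_ulo.
Qed.

Lemma measurable_crack_grad i :
  measurable_fun [set: mR3 R] (fun p : mR3 R => crack_grad p i).
Proof.
have mr : measurable_fun [set: mR3 R] (fun p : mR3 R => (2 * prad p.1.1 p.1.2)^-1).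
  apply: measurableT_comp; first exact: measurable_inv.
  apply: continuous_measurable3 => p; apply: cvgM; first exact: cvg_cst.
  exact: (continuous_prad_comp continuous_coord1 continuous_coord2).
case: i => [|[|i]] /=.
- apply: measurable_funM => //; apply: measurableT_comp => //.
  apply: measurable_funB; first exact: measurable_u_delta.
  apply: continuous_measurable3 => p.
  by apply: cvgM; [exact: cvg_cst|exact: continuous_coord3].
- apply: measurable_funM => //; apply: continuous_measurable3.
  apply: continuous_sqrt_comp => p; apply: cvgM; last exact: cvg_cst.
  apply: cvgD; last exact: continuous_coord1.
  exact: (continuous_prad_comp continuous_coord1 continuous_coord2).
- exact: measurable_cst.
Qed.

End CrackTip.

(** * Gradient energy of the crack-tip function on cylinders *)

Section CylinderEnergy.
Context {R : realType}.
Notation mu := (@lebesgue_measure R).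


Lemma measurable_inv_prad :
  measurable_fun [set: mR2 R] (fun q : mR2 R => (prad q.1 q.2)^-1).
Proof.
apply: measurableT_comp; first exact: measurable_inv.
apply: continuous_measurable2; apply: continuous_prad_comp => q.
  exact: cvg_fst.
exact: cvg_snd.
Qed.

Lemma disc_prad (r : R) (q : R * R) : 0 < r -> disc r q <-> prad q.1 q.2 < r.
Proof.
move=> r0; rewrite -(@ltr_sqr _ (prad q.1 q.2)) ?nnegrE ?prad_ge0 ?(ltW r0)//.
by rewrite prad_sqr.
Qed.

Lemma integral_inv_sqr (a b : R) : 0 < a -> a < b ->
  (\int[mu]_(s in `]a, b[) (s ^- 2)%:E = (a^-1 - b^-1)%:E)%E.
Proof.
move=> a0 ab.
have ds (s : R) : 0 < s -> is_derive s (1 : R) (fun s : R => - s^-1) (s ^- 2).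
  move=> s0; have sn0 : s != 0 by rewrite gt_eqF.
  apply: (is_derive_eq (is_deriveN (is_deriveV sn0 (is_derive_id _ _)))).
  by rewrite /GRing.scale/= mulr1 opprK.
have csub (s : R) : 0 < s -> {for s, continuous (fun s : R => s ^- 2)}.
  move=> s0; apply: (@continuous_comp R R R (fun s : R => s ^+ 2) (@GRing.inv R) s).
    exact: exprn_continuous.
  by apply: inv_continuous; rewrite gt_eqF// exprn_gt0.
have cN (s : R) : 0 < s -> {for s, continuous (fun s : R => - s^-1)}.
  by move=> s0; apply: cvgN; apply: inv_continuous; rewrite gt_eqF.
have b0 := lt_trans a0 ab.
have mf : measurable_fun `]a, b[ (fun s : R => s ^- 2).
  apply: measurable_funTS; apply: measurableT_comp; first exact: measurable_inv.
  exact: measurable_funX.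
rewrite -(integral_itv_bndoo true false)//; last exact/measurable_EFinP.
rewrite (@continuous_FTC2 _ _ (fun s : R => - s^-1))//.
- by rewrite -EFinB; congr EFin; ring.
- apply: continuous_in_subspaceT => s; rewrite inE/= in_itv/= => /andP[as_ _].
  by apply: csub; exact: lt_le_trans as_.
- split; [|by apply: cvg_at_right_filter; exact: cN|
           by apply: cvg_at_left_filter; exact: cN].
  move=> s; rewrite in_itv/= => /andP[as_ _].
  by apply: ex_derive; apply: ds; exact: lt_trans as_.
- move=> s; rewrite in_itv/= => /andP[as_ _]; rewrite derive1E.
  by apply: derive_val; apply: ds; exact: lt_trans as_.
Qed.

Lemma leb2_set1 (q : mR2 R) : measurable [set q] /\ leb2 [set q] = 0%E.
Proof.
have -> : [set q] = `[q.1, q.1]%classic `*` `[q.2, q.2]%classic :> set (mR2 R).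
  apply/seteqP; split => [_ ->|[x y] [/=]]; first by split; rewrite /= in_itv/= lexx.
  rewrite !in_itv/= -!eq_le => /eqP <- /eqP <-; by case: (q).
by split; [exact: measurableX|rewrite leb2_itv// !subrr mulr0].
Qed.

(* [1 / r] is the integral of [s ^- 2] over [r < s < rho] plus [1 / rho];
   exchanging the integrals gives the areas [pi * s ^+ 2] of the discs. *)
Lemma integral_inv_prad (rho : R) : 0 < rho ->
  (\int[@leb2 R]_(q in disc rho) ((prad q.1 q.2)^-1)%:E = (2 * pi * rho)%:E)%E.
Proof.
move=> r0.
pose A : set (mR3 R) := [set p | prad p.1.1 p.1.2 < p.2 /\ p.2 < rho].
have mA : measurable A.
  apply: open_measurable3.
  have -> : A = (fun p => p.2 - prad p.1.1 p.1.2) @^-1` [set x | 0 < x] `&`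
      (fun p => p.2) @^-1` [set x | x < rho].
    by apply/seteqP; split => p; rewrite /A /= subr_gt0.
  apply: openI; apply: open_comp; rewrite ?openE//; last exact: open_lt.
  - move=> p _; apply: cvgB; first exact: continuous_coord3.
    exact: (continuous_prad_comp continuous_coord1 continuous_coord2).
  - exact: open_gt.
  - by move=> p _; exact: continuous_coord3.
pose k (p : mR3 R) : \bar R := (\1_A p * (p.2 ^- 2))%:E.
have mk : measurable_fun [set: mR3 R] k.
  apply/measurable_EFinP; apply: measurable_funM; first exact: measurable_indic.
  apply: measurableT_comp; first exact: measurable_inv.
  by apply: measurable_funX.
have k0 p : (0 <= k p)%E by rewrite lee_fin mulr_ge0// invr_ge0 sqr_ge0.
have q_prad (q : mR2 R) : q != 0 -> 0 < prad q.1 q.2.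
  move=> q0; apply: prad_gt0; rewrite -negb_and; apply: contra q0 => /andP[].
  by case: q => x y /= /eqP -> /eqP ->.
have h0 (q : mR2 R) : rho <= prad q.1 q.2 -> (\int[mu]_s k (q, s) = 0)%E.
  move=> rq; apply: integral0_eq => s _; rewrite /k indicE memNset ?mul0r//.
  by case=> /= h1 h2; have := lt_trans h1 h2; rewrite ltNge rq.
have h1 (q : mR2 R) : q != 0 -> prad q.1 q.2 < rho ->
    (\int[mu]_s k (q, s) = ((prad q.1 q.2)^-1 - rho^-1)%:E)%E.
  move=> q0 qr; rewrite -integral_inv_sqr ?q_prad//.
  rewrite [RHS]integral_mkcond; apply: eq_integral => s _.
  rewrite patchE /k indicE.
  have [sq|sq] := pselect ((`]prad q.1 q.2, rho[%classic : set R) s).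
    rewrite (mem_set sq) mem_set ?mul1r//.
    by move: sq; rewrite /= in_itv/= => /andP.
  rewrite (memNset sq) memNset ?mul0r// => -[h2 h3]; apply: sq.
  by rewrite /= in_itv/= h2.
(* The area [pi * s ^ 2] cancels [s ^- 2], so the slice at height [s] contributes the constant
   [pi]. *)
have h2 s : (\int[@leb2 R]_q k (q, s) = ((fun=> pi%:E) \_ `]0%R, rho[) s)%E.
  rewrite patchE; have [sq|sq] := pselect ((`]0%R, rho[%classic : set R) s).
    have := sq; rewrite (mem_set sq)/= in_itv/= => /andP[s0 sr].
    transitivity (\int[@leb2 R]_(q in disc s) (s ^- 2)%:E)%E.
      rewrite [RHS]integral_mkcond; apply: eq_integral => q _.
      rewrite patchE /k indicE; have [qs|qs] := pselect (disc s q).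
        by rewrite (mem_set qs) mem_set ?mul1r//; split => //; apply/disc_prad.
      by rewrite (memNset qs) memNset ?mul0r// => -[/(disc_prad _ s0)].
    rewrite integral_cst; last exact: measurable_disc.
    rewrite [X in (_ * X)%E]leb2_disc ?(ltW s0)// -EFinM; congr EFin.
    by rewrite mulrCA mulVf ?mulr1// sqrf_eq0 gt_eqF.
  rewrite (memNset sq); apply: integral0_eq => q _.
  rewrite /k indicE memNset ?mul0r// => -[/= h3 h4]; apply: sq.
  by rewrite /= in_itv/= h4 (le_lt_trans (prad_ge0 _ _) h3).
have tot : (\int[@leb2 R]_q \int[mu]_s k (q, s) = (pi * rho)%:E)%E.
  rewrite -(fubini_tonelli_z mk k0).
  rewrite [LHS](@fubini_tonelli2 _ _ _ _ R (@leb2 R) mu)// /fubini_G.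
  under eq_integral do rewrite h2.
  rewrite -integral_mkcond integral_cst//= lebesgue_measure_itv/= lte_fin r0.
  by rewrite -EFinB -EFinM subr0.
have mj : measurable_fun [set: mR2 R] (fun q => \int[mu]_s k (q, s))%E.
  exact: (@measurable_fun_fubini_tonelli_F _ _ (mR2 R) (measurableTypeR R) R mu k mk k0).
have mD : measurable (disc rho : set (mR2 R)) by exact: measurable_disc.
transitivity (\int[@leb2 R]_(q in disc rho) (\int[mu]_s k (q, s) + (rho^-1)%:E))%E.
  apply: ae_eq_integral => //.
  - apply/measurable_EFinP; apply: measurable_funTS; exact: measurable_inv_prad.
  - by apply: emeasurable_funD => //; exact: measurable_funTS.
  (* The identity is claimed off the origin only: there the inverse of 0 is 0 by convention, whereas
     [s ^- 2] is not integrable near 0. *)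
  - exists [set 0]; split.
    + by have [] := leb2_set1 0.
    + by have [] := leb2_set1 0.
    + move=> q /= /not_implyP[/(disc_prad _ r0) qr]; apply: contra_notP => /eqP q0.
      by rewrite h1// -EFinD subrK.
rewrite ge0_integralD//; last 3 first.
- by move=> q _; exact: integral_ge0.
- exact: measurable_funTS.
- by move=> q _; rewrite lee_fin invr_ge0 ltW.
rewrite integral_cst// [X in (_ + _ * X)%E]leb2_disc ?(ltW r0)//.
have -> : (\int[@leb2 R]_(q in disc rho) \int[mu]_s k (q, s) = (pi * rho)%:E)%E.
  rewrite -tot [LHS]integral_mkcond; apply: eq_integral => q _.
  rewrite patchE; have [qs|qs] := pselect (disc rho q); first by rewrite mem_set.
  by rewrite memNset// h0// leNgt; apply/negP => /(disc_prad _ r0).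
rewrite -EFinM -EFinD; congr EFin; have := gt_eqF r0.
by move: (@pi R) => P rn; field; rewrite rn.
Qed.

(** [ocyl 1] is the interior of [cylinder], the domain of the problem; smaller [rho] gives the open
    part of the set that is removed. *)
Definition ocyl (rho : R) : set (R3 R) :=
  [set p | p.1.1 ^+ 2 + p.1.2 ^+ 2 < rho ^+ 2 /\ `|p.2| < rho].

Lemma open_ocyl rho : open (ocyl rho).
Proof.
have -> : ocyl rho =
    (fun p => p.1.1 * p.1.1 + p.1.2 * p.1.2) @^-1` [set x | x < rho ^+ 2] `&`
    (fun p => `|p.2|) @^-1` [set x | x < rho].
  by apply/seteqP; split => p; rewrite /ocyl /= -!expr2.
apply: openI; apply: open_comp; try exact: open_lt.
- move=> p _; apply: cvgD; apply: cvgM;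
    (exact: continuous_coord1 || exact: continuous_coord2).
- move=> p _; apply: (@continuous_comp _ _ _ snd (fun x : R => `|x|)).
    exact: cvg_snd.
  exact: norm_continuous.
Qed.

Lemma measurable_ocyl rho : measurable (ocyl rho : set (mR3 R)).
Proof. by apply: open_measurable3; exact: open_ocyl. Qed.

Lemma measurable_crack_energy (delta : R) :
  measurable_fun [set: mR3 R] (fun p => (\sum_(i < 3) crack_grad delta p i ^+ 2)%:E).
Proof.
apply/measurable_EFinP; apply: measurable_sum => i.
by apply: measurable_funX; exact: measurable_crack_grad.
Qed.

(** The density does not depend on [z], hence the factor [2 * rho]; the disc contributes [(2 *
    pi)^-1 * (2 * pi * rho) + delta ^ 2 * pi * rho ^ 2]. *)
Lemma crack_energy_ocyl (delta rho : R) : 0 < rho ->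
  (\int[@leb3 R]_(p in ocyl rho) (\sum_(i < 3) crack_grad delta p i ^+ 2)%:E =
   (2 * rho ^+ 2 + 2 * pi * delta ^+ 2 * rho ^+ 3)%:E)%E.
Proof.
move=> r0.
pose f (q : mR2 R) : R := (2 * pi)^-1 * (prad q.1 q.2)^-1 + delta ^+ 2.
have f0 q : 0 <= f q.
  by rewrite addr_ge0 ?sqr_ge0// mulr_ge0// invr_ge0 ?prad_ge0// mulr_ge0// pi_ge0.
have mf : measurable_fun [set: mR2 R] f.
  by apply: measurable_funD => //; apply: measurable_funM => //;
     exact: measurable_inv_prad.
have mD : measurable (disc rho : set (mR2 R)) by exact: measurable_disc.
rewrite integral_mkcond (tonelli_emb 2); last 2 first.
- apply/(measurable_restrictT _ (measurable_ocyl rho)).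
  by apply: measurable_funTS; exact: measurable_crack_energy.
- move=> p; apply: erestrict_ge0 => {}p _; rewrite lee_fin sumr_ge0// => i _.
  exact: sqr_ge0.
transitivity (\int[@leb2 R]_(q in disc rho) ((f q)%:E * (2 * rho)%:E))%E.
  rewrite [RHS]integral_mkcond; apply: eq_integral => q _.
  rewrite patchE; have [qr|qr] := pselect (disc rho q); last first.
    rewrite memNset//; apply: integral0_eq => z _.
    by rewrite patchE memNset// => -[].
  rewrite mem_set//.
  have -> : (2 * rho)%:E = mu `](- rho), rho[%classic.
    rewrite lebesgue_measure_itv/= lte_fin ifT; last lra.
    by rewrite -EFinB; congr EFin; lra.
  rewrite -integral_cst// [RHS]integral_mkcond; apply: eq_integral => z _.
  rewrite !patchE (_ : (z \in _) = (emb 2 q z \in ocyl rho)); last first.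
    apply/idP/idP; rewrite !inE/= in_itv/= -ltr_norml; last by case.
    by move=> zr; split.
  by case: ifP => // _; rewrite crack_grad_sqr.
rewrite ge0_integralZr//; last 3 first.
- by apply/measurable_EFinP; exact: measurable_funTS.
- by move=> q _; rewrite lee_fin.
- by rewrite lee_fin mulr_ge0// ltW.
under eq_integral do rewrite /f EFinD EFinM.
rewrite ge0_integralD//; last 3 first.
- move=> q _; rewrite -EFinM lee_fin mulr_ge0// invr_ge0 ?prad_ge0//.
  by rewrite mulr_ge0// pi_ge0.
- apply/measurable_EFinP; apply: measurable_funTS; apply: measurable_funM => //.
  exact: measurable_inv_prad.
- by move=> q _; rewrite lee_fin sqr_ge0.
rewrite ge0_integralZl//; last 3 first.
- by apply/measurable_EFinP; apply: measurable_funTS; exact: measurable_inv_prad.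
- by move=> q _; rewrite lee_fin invr_ge0 prad_ge0.
- by rewrite lee_fin invr_ge0 mulr_ge0// pi_ge0.
rewrite integral_inv_prad// integral_cst//.
rewrite [X in ((_ + _ * X) * _)%E]leb2_disc ?(ltW r0)//.
rewrite -!EFinM; congr EFin.
have := gt_eqF (pi_gt0 R); move: (@pi R) => P Pn; field; by rewrite Pn.
Qed.

End CylinderEnergy.

(** * The crack-tip function along lines *)

Section CrackLines.
Context {R : realType}.
Variable delta : R.
Notation mu := (@lebesgue_measure R).

Lemma is_derive_sqrt_comp (f : R -> R) (t df : R) : 0 < f t ->
  is_derive t (1 : R) f df ->
  is_derive t (1 : R) (fun t => Num.sqrt (f t)) (df / (2 * Num.sqrt (f t))).
Proof.
move=> ft0 fdf; have ds := is_derive1_sqrt ft0.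
have := is_derive1_comp ds fdf; rewrite /GRing.scale/= mulrC => H.
exact: H.
Qed.

Lemma is_derive_prad (y t : R) : 0 < prad t y ->
  is_derive t (1 : R) (fun t => prad t y) (t / prad t y).
Proof.
move=> r0; have f0 : 0 < t ^+ 2 + y ^+ 2.
  by rewrite -prad_sqr exprn_gt0.
have df : is_derive t (1 : R) (fun t : R => t ^+ 2 + y ^+ 2) (2 * t).
  by apply: is_derive_eq; rewrite /GRing.scale/=; ring.
apply: (is_derive_eq (@is_derive_sqrt_comp (fun t => t ^+ 2 + y ^+ 2) t _ f0 df)).
by rewrite -/(prad t y); field; rewrite gt_eqF.
Qed.

Lemma pradC (x y : R) : prad x y = prad y x.
Proof. by rewrite /prad addrC. Qed.

Lemma wup_gt0 (x y : R) : y != 0 -> 0 < wup x y.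
Proof.
move=> y0; rewrite sqrtr_gt0 divr_gt0 ?pi_gt0// subr_gt0.
apply: (le_lt_trans (ler_norm _)).
rewrite -ltr_sqr ?nnegrE ?prad_ge0// real_normK ?num_real// prad_sqr ltrDl.
by rewrite lt_neqAle sqr_ge0 eq_sym sqrf_eq0 y0.
Qed.

Lemma is_derive_wup1 (y t : R) : y != 0 ->
  is_derive t (1 : R) (fun t => wup t y) (- wup t y / (2 * prad t y)).
Proof.
move=> y0; have r0 : 0 < prad t y by apply: prad_gt0; rewrite y0 orbT.
have w0 := wup_gt0 t y0; have f0 : 0 < (prad t y - t) / pi by rewrite -sqrtr_gt0.
have dr := is_derive_prad r0.
have df : is_derive t (1 : R) (fun t => (prad t y - t) / pi)
    ((t / prad t y - 1) / pi).
  by apply: is_derive_eq; rewrite /GRing.scale/=; ring.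
apply: (is_derive_eq
  (@is_derive_sqrt_comp (fun t => (prad t y - t) / pi) t _ f0 df)).
rewrite -/(wup t y).
have -> : (t / prad t y - 1) / pi = - (wup t y ^+ 2) / prad t y.
  rewrite wup_sqr; have := pi_gt0 R; move: (@pi R) => P P0.
  by field; rewrite !gt_eqF.
by field; rewrite !gt_eqF.
Qed.

(** The conjugate factors [r - x] and [r + x] have product [t ^ 2], which turns the quotient by
    [wup] into a product. The sign of [t] appears because [wup] is even in its second argument. *)
Lemma is_derive_wup2 (x t : R) : t != 0 ->
  is_derive t (1 : R) (fun t => wup x t)
    (Num.sg t * (Num.sqrt ((prad x t + x) / pi) / (2 * prad x t))).
Proof.
move=> t0; have r0 : 0 < prad x t by apply: prad_gt0; rewrite t0 orbT.
have w0 := wup_gt0 x t0; have f0 : 0 < (prad x t - x) / pi by rewrite -sqrtr_gt0.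
have dr : is_derive t (1 : R) (fun t => prad x t) (t / prad x t).
  rewrite pradC in r0 *; under eq_fun do rewrite pradC; exact: is_derive_prad.
have df : is_derive t (1 : R) (fun t => (prad x t - x) / pi) (t / prad x t / pi).
  by apply: is_derive_eq; rewrite /GRing.scale/=; ring.
apply: (is_derive_eq
  (@is_derive_sqrt_comp (fun t => (prad x t - x) / pi) t _ f0 df)).
rewrite -/(wup x t).
have E : wup x t * Num.sqrt ((prad x t + x) / pi) = `|t| / pi.
  rewrite -sqrtrM ?prad_subr_ge0//.
  have -> : (prad x t - x) / pi * ((prad x t + x) / pi) = (t / pi) ^+ 2.
    have -> : (prad x t - x) / pi * ((prad x t + x) / pi) =
      (prad x t ^+ 2 - x ^+ 2) / pi ^+ 2.
      by have := pi_gt0 R; move: (@pi R) => P P0; field; rewrite gt_eqF.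
    by rewrite prad_sqr addrAC subrr add0r expr_div_n.
  by rewrite sqrtr_sqr normrM (gtr0_norm (_ : 0 < pi^-1)) ?invr_gt0 ?pi_gt0.
have -> : Num.sqrt ((prad x t + x) / pi) = `|t| / pi / wup x t.
  by rewrite -E; field; rewrite gt_eqF.
have -> : t / prad x t / pi = Num.sg t * `|t| / prad x t / pi by rewrite -numEsg.
have := pi_gt0 R; move: (@pi R) => P P0.
by field; rewrite !gt_eqF.
Qed.

(** The continuous function that agrees with [u_delta] on the half-line [t > 0] ([s = true]) or
    [t < 0]. Only direction 1 crosses the slit transversally and needs two branches. *)
Definition uside (i : nat) (s : bool) : R3 R -> R :=
  if i is 1 then (if s then uup delta else ulo delta) else u_delta delta.

Lemma uside_sign i (s : bool) q t : (if s then 0 < t else t < 0) -> 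
  u_delta delta (emb i q t) = uside i s (emb i q t).
Proof.
case: i => [|[|i]]//= st; rewrite u_deltaE /=.
by case: s st => [/ltW -> //|]; rewrite leNgt => ->.
Qed.

Lemma measurable_uside i s : measurable_fun [set: mR3 R] (uside i s : mR3 R -> R).
Proof.
case: i => [|[|i]]; [exact: measurable_u_delta| |exact: measurable_u_delta].
by case: s; apply: continuous_measurable3; [exact: continuous_uup|exact: continuous_ulo].
Qed.

Lemma continuous_pair (T U V : topologicalType) (f : T -> U) (g : T -> V) :
  continuous f -> continuous g -> continuous (fun x => (f x, g x)).
Proof. by move=> cf cg x; apply: (cvg_pair (cf x) (cg x)). Qed.

Lemma continuous_emb i q : continuous (emb i q : R -> R3 R).
Proof.
have cc (a : R) : continuous (fun _ : R => a) by move=> ?; exact: cvg_cst.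
have ci : continuous (fun t : R => t) by move=> ?; exact: cvg_id.
case: i => [|[|i]].
- exact: (continuous_pair (continuous_pair ci (cc q.1)) (cc q.2)).
- exact: (continuous_pair (continuous_pair (cc q.1) ci) (cc q.2)).
- case: q => a b; exact: (continuous_pair (continuous_pair (cc a) (cc b)) ci).
Qed.

Lemma u_delta_line0 (y z : R) : exists s : R, forall t,
  u_delta delta ((t, y), z) = s * wup t y + delta * z.
Proof.
exists (if 0 <= y then 1 else -1) => t; rewrite u_deltaE /uup /ulo /=.
by case: ifP => _; rewrite ?mul1r ?mulN1r.
Qed.

Lemma continuous_uside_line i s (q : R * R) : q.1 != 0 ->
  continuous (fun t : R => uside i s (emb i q t)).
Proof.
case: q => a b /= a0 t; case: i => [|[|i]] /=.
- have [e ue] := u_delta_line0 a b.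
  rewrite (_ : (fun t => _) = fun t => e * wup t a + delta * b); last exact/funext.
  apply: cvgD; last exact: cvg_cst; apply: cvgM; first exact: cvg_cst.
  by apply: (@continuous_wup_comp _ _ id (fun=> a)) => ?; [exact: cvg_id|exact: cvg_cst].
- apply: (@continuous_comp _ _ _ (emb 1 (a, b)) (if s then uup delta else ulo delta)).
    exact: continuous_emb.
  by case: s; [exact: continuous_uup|exact: continuous_ulo].
- under eq_fun do rewrite /u_delta/=.
  by apply: cvgD; [exact: cvg_cst|apply: cvgM; [exact: cvg_cst|exact: cvg_id]].
Qed.

(** In directions 0 and 1 the condition [q.1 != 0] keeps the line off the axis [r = 0], where the
    gradient is unbounded. *)
Lemma continuous_grad_line i (q : R * R) : q.1 != 0 ->
  continuous (fun t : R => crack_grad delta (emb i q t) i).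
Proof.
case: q => a b /= a0.
have cr : forall t : R, {for t, continuous (fun t : R => (2 * prad t a)^-1)}.
  move=> t; apply: (@continuous_comp R R R (fun t : R => 2 * prad t a) (@GRing.inv R) t).
    apply: cvgM; first exact: cvg_cst.
    by apply: (@continuous_prad_comp _ _ id (fun=> a)) => ?; [exact: cvg_id|exact: cvg_cst].
  apply: inv_continuous; rewrite mulf_neq0//.
  by rewrite gt_eqF// prad_gt0// a0 orbT.
move=> t; case: i => [|[|i]] /=; last exact: cvg_cst.
- apply: cvgM; last exact: cr; apply: cvgN.
  have h := @continuous_uside_line 0 true (a, b) a0 t.
  by apply: cvgB; [exact: h|exact: cvg_cst].
- apply: cvgM; last first.
    by under eq_fun do rewrite pradC; rewrite pradC; exact: cr.
  apply: (continuous_sqrt_comp (f := fun t : R => (prad a t + a) / pi)) => {}t.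
  apply: cvgM; last exact: cvg_cst; apply: cvgD; last exact: cvg_cst.
  by apply: (@continuous_prad_comp _ _ (fun=> a) id) => ?; [exact: cvg_cst|exact: cvg_id].
Qed.

Lemma is_derive_uside_line i (s : bool) (q : R * R) (t : R) : q.1 != 0 ->
  (if s then 0 < t else t < 0) ->
  is_derive t (1 : R) (fun t : R => uside i s (emb i q t))
    (crack_grad delta (emb i q t) i).
Proof.
case: q => a b /= a0; case: i => [|[|i]] /= st.
- have [e ue] := u_delta_line0 a b.
  rewrite ue addrK (_ : (fun t => _) = fun t => e * wup t a + delta * b); last exact/funext.
  have dw := is_derive_wup1 t a0.
  by apply: is_derive_eq; rewrite /GRing.scale/=; ring.
- have t0 : t != 0 by case: s st => st; rewrite ?(gt_eqF st)// lt_eqF.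
  have dw := is_derive_wup2 a t0.
  case: s st => st.
  + rewrite (_ : (fun t => _) = fun t => wup a t + delta * b)//.
    by apply: is_derive_eq; rewrite gtr0_sg//; ring.
  + rewrite (_ : (fun t => _) = fun t => - wup a t + delta * b)//.
    by apply: is_derive_eq; rewrite ltr0_sg//; ring.
- rewrite (_ : (fun t => _) = fun t => u_delta delta ((a, b), 0) + delta * t); last first.
    by apply/funext => x; rewrite /u_delta/= mulr0 addr0.
  by apply: is_derive_eq; rewrite /GRing.scale/=; ring.
Qed.

End CrackLines.

(** * Integration by parts along lines *)

Section LineIntegral.
Context {R : realType}.
Notation mu := (@lebesgue_measure R).

(** The fundamental theorem on []s, M[] and on []-M, -s[] separately; the values of [H] at the four
    end points do not affect the integral. The case [s = 0] is a jump at a single point, the case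
    [s > 0] a removed segment. *)
Lemma line_ftc (s M : R) (Fp Fm fp fm H : R -> R) : 0 <= s -> s < M ->
  continuous Fp -> continuous Fm -> continuous fp -> continuous fm ->
  (forall t, s < t < M -> is_derive t (1 : R) Fp (fp t)) ->
  (forall t, - M < t < - s -> is_derive t (1 : R) Fm (fm t)) ->
  Fp M = 0 -> Fm (- M) = 0 -> measurable_fun setT H ->
  (forall t, s < t < M -> H t = fp t) ->
  (forall t, - M < t < - s -> H t = fm t) ->
  (forall t, `|t| < s -> H t = 0) -> (forall t, M < `|t| -> H t = 0) ->
  (\int[mu]_t (H t)%:E = (- Fp s + Fm (- s))%:E)%E.
Proof.
move=> s0 sM cFp cFm cfp cfm dFp dFm FpM FmM mH Hp Hm Hs HM.
pose A : set (measurableTypeR R) := `]s, M[%classic.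
pose B : set (measurableTypeR R) := `](- M), (- s)[%classic.
have mA : measurable A by exact: measurable_itv.
have mB : measurable B by exact: measurable_itv.
have int (a b : R) (f : R -> R) : continuous f ->
    mu.-integrable setT ((EFin \o f) \_ (`]a, b[%classic : set (measurableTypeR R))).
  move=> cf.
  have mo : measurable (`]a, b[%classic : set (measurableTypeR R)).
    exact: measurable_itv.
  have mc : measurable (`[a, b]%classic : set (measurableTypeR R)).
    exact: measurable_itv.
  apply/(integrable_mkcond _ mo); apply: (integrableS mc mo).
    exact: subset_itv_oo_cc.
  apply: continuous_compact_integrable; first exact: segment_compact.
  exact: continuous_subspaceT.
have iA : mu.-integrable setT ((EFin \o fp) \_ A) by exact: int.
have iB : mu.-integrable setT ((EFin \o fm) \_ B) by exact: int.
have ftc (a b : R) (F f : R -> R) : a < b -> continuous F -> continuous f ->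
    (forall t, a < t < b -> is_derive t (1 : R) F (f t)) ->
    (\int[mu]_(t in `]a, b[) (f t)%:E = (F b - F a)%:E)%E.
  move=> ab cF cf dF.
  rewrite -(integral_itv_bndoo true false)//; last first.
    by apply/measurable_EFinP; apply: measurable_funTS; exact: continuous_measurable_fun.
  rewrite (@continuous_FTC2 _ _ F)//.
  - exact: continuous_subspaceT.
  - split; [|by apply: cvg_at_right_filter; exact: cF|
             by apply: cvg_at_left_filter; exact: cF].
    by move=> t; rewrite in_itv/= => /dF d; exact: ex_derive.
  - by move=> t; rewrite in_itv/= => /dF d; rewrite derive1E; exact: derive_val.
transitivity (\int[mu]_t (((EFin \o fp) \_ A) t + ((EFin \o fm) \_ B) t))%E.
  apply: ae_eq_integral => //.
  - exact/measurable_EFinP.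
  - by apply: emeasurable_funD; [exact: measurable_int iA|exact: measurable_int iB].
  - pose N : set (measurableTypeR R) := [set s] `|` [set - s] `|` [set M] `|` [set - M].
    have cN : countable N.
      by apply: finite_set_countable; rewrite !finite_setU; split; [split;[split|]|];
        exact: finite_set1.
    exists N; split; first by repeat (apply: measurableU => //).
      exact: countable_lebesgue_measure0.
    move=> t /= /not_implyP[_]; apply: contra_notP => tN.
    have ts : t <> s by move=> E; apply: tN; left; left; left.
    have tns : t <> - s by move=> E; apply: tN; left; left; right.
    have tM : t <> M by move=> E; apply: tN; left; right.
    have tnM : t <> - M by move=> E; apply: tN; right.
    rewrite !patchE.
    have [ltM|Mlt|/esym//] := ltgtP t M; last first.
      rewrite HM; last by rewrite ltr_normr Mlt.
      rewrite !memNset ?adde0//; rewrite /A /B/= in_itv/= => /andP[]; lra.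
    have [gtM|Mgt|/esym//] := ltgtP t (- M).
    + rewrite HM; last by rewrite ltr_normr (ltrNr M) gtM orbT.
      rewrite !memNset ?adde0//; rewrite /A /B/= in_itv/= => /andP[]; lra.
    + have [lts|slt|/esym//] := ltgtP t s; last first.
        rewrite mem_set /A/= ?in_itv/= ?slt// memNset ?adde0; last first.
          by rewrite /B/= in_itv/= => /andP[]; lra.
        by rewrite Hp// slt.
      have [ltns|nslt|/esym//] := ltgtP t (- s).
        rewrite memNset; last by rewrite /A/= in_itv/= => /andP[]; lra.
        by rewrite mem_set /B/= ?in_itv/= ?Mgt// add0e Hm// Mgt.
      rewrite Hs ?ltr_norml ?nslt// !memNset ?adde0//;
        by rewrite /A /B/= in_itv/= => /andP[]; lra.
rewrite integralD// -!integral_mkcond (ftc s M Fp fp)// (ftc _ _ Fm fm)//; last lra.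
by rewrite FpM FmM -EFinD; congr EFin; ring.
Qed.

End LineIntegral.

(** * Test functions on lines *)

Section TestFun.
Context {R : realType}.
Implicit Types (O : set (R3 R)) (phi : R3 R -> R).

Lemma emb_shift (i : 'I_3) (q : R * R) (t h : R) :
  h *: (basis_vec i : R3 R) + emb i q t = emb i q (h + t).
Proof.
have e3 (a b c a' b' c' : R) : a = a' -> b = b' -> c = c' ->
    ((a, b), c) = ((a', b'), c') by move=> -> -> ->.
case: q => a b; case: i => -[|[|[|//]]] ?; rewrite /basis_vec/=;
  apply: e3 => /=; rewrite /GRing.scale/= ?mulr1 ?mulr0 ?add0r//.
Qed.

Lemma is_derive_line (i : 'I_3) phi (q : R * R) (t : R) :
  derivable phi (emb i q t) (basis_vec i) ->
  is_derive t (1 : R) (fun t => phi (emb i q t))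
    ('D_(basis_vec i) phi (emb i q t)).
Proof.
have E (h : R) : h *: (1 : R) + t = h + t by rewrite /GRing.scale/= mulr1.
have EE : (fun h : R => h^-1 *: (phi (emb i q (h *: (1 : R) + t)) - phi (emb i q t))) =
    (fun h : R => h^-1 *: (phi (h *: (basis_vec i : R3 R) + emb i q t) - phi (emb i q t))).
  by apply/funext => h; rewrite E emb_shift.
rewrite /derivable -EE => d; split => //.
by rewrite /derive; congr lim; rewrite EE.
Qed.

Lemma test_fun_out_closure phi p : ~ closure [set x | phi x != 0] p ->
  phi p = 0 /\ forall i, 'D_(basis_vec i) phi p = 0.
Proof.
move=> nSp; have nb : nbhs p (~` [set x | phi x != 0]).
  by rewrite -[nbhs p _]/(interior _ p) interiorC.
have nb0 : \forall y \near p, phi y = (fun=> 0) y.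
  by apply: filterS nb => y /= /negP; rewrite negbK => /eqP.
split; first exact: (nbhs_singleton nb0).
by move=> i; rewrite (near_eq_derive _ nb0) derive_cst.
Qed.

Lemma test_fun_out O phi p : test_fun O phi -> ~ O p ->
  phi p = 0 /\ forall i, 'D_(basis_vec i) phi p = 0.
Proof. by move=> [_ _ _ _ sO] nOp; apply: test_fun_out_closure => /sO. Qed.

Lemma continuous_compact_support_bounded (C : set (R3 R)) (f : R3 R -> R) :
  compact C -> continuous f -> (forall p, ~ C p -> f p = 0) ->
  exists M, forall p, `|f p| <= M.
Proof.
move=> cC cf f0; have : compact (f @` C).
  by apply: continuous_compact => //; exact: continuous_subspaceT.
move=> /compact_bounded[M [Mr Mf]]; exists (`|M| + 1) => p.
have M1 : M < `|M| + 1 by rewrite (le_lt_trans (ler_norm _))// ltrDl.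
have [Cp|nCp] := pselect (C p); first by apply: (Mf _ M1); exists p.
by rewrite f0// normr0 addr_ge0.
Qed.

Lemma test_fun_bounded O phi : test_fun O phi -> exists C : R,
  (forall p, `|phi p| <= C) /\ forall i p, `|'D_(basis_vec i) phi p| <= C.
Proof.
move=> [cphi dphi cdphi cS sO].
have [C0 hC0] := continuous_compact_support_bounded cS cphi
  (fun p nSp => (test_fun_out_closure nSp).1).
have [C1 hC1] := choice (fun i => continuous_compact_support_bounded cS (cdphi i)
  (fun p nSp => (test_fun_out_closure nSp).2 i)).
exists (\big[Num.max/C0]_(i < 3) C1 i); split => [p|i p].
  by rewrite (le_trans (hC0 p))//; exact: bigmax_ge_id.
by rewrite (le_trans (hC1 i p))//; exact: le_bigmax.
Qed.

End TestFun.

(** * The competitor *)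

Section Competitor.
Context {R : realType}.
Variables delta rho : R.
Hypothesis rho1 : rho < 1.
Notation mu := (@lebesgue_measure R).
Notation O := (@ocyl R 1).
Implicit Types (p : R3 R) (q : R * R) (t : R).

(** Empty for [rho < 0], a case that is kept on purpose: it turns the competitor into [u_delta]. *)
Definition ccyl : set (R3 R) :=
  [set p | p.1.1 ^+ 2 + p.1.2 ^+ 2 <= rho ^+ 2 /\ `|p.2| <= rho].

(* [hits i q] tells whether the line of direction [i] through [q] meets the
   closed cylinder, along the segment [`|t| <= hw i q]. *)
Definition hits (i : nat) q : bool :=
  if (i < 2)%N then (q.1 ^+ 2 <= rho ^+ 2) && (`|q.2| <= rho)
  else (q.1 ^+ 2 + q.2 ^+ 2 <= rho ^+ 2) && (0 <= rho).

Definition hw (i : nat) q : R :=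
  if hits i q then (if (i < 2)%N then Num.sqrt (rho ^+ 2 - q.1 ^+ 2) else rho)
  else 0.

Lemma hw_ge0 i q : 0 <= hw i q.
Proof.
rewrite /hw /hits; case: (ltnP i 2) => _; case: ifPn => //.
by case/andP.
Qed.

Lemma hw_lt1 i q : hw i q < 1.
Proof.
rewrite /hw /hits; case: (ltnP i 2) => _; case: ifPn => //.
move=> /andP[_ qr]; have r0 : 0 <= rho by exact: le_trans qr.
apply: (@le_lt_trans _ _ (Num.sqrt (rho ^+ 2))).
  by rewrite ler_wsqrtr// gerBl sqr_ge0.
by rewrite sqrtr_sqr ger0_norm.
Qed.

Lemma ccyl_emb i q t : ccyl (emb i q t) <-> hits i q && (`|t| <= hw i q).
Proof.
have key (a b : R) : (a ^+ 2 + b ^+ 2 <= rho ^+ 2) =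
    (a ^+ 2 <= rho ^+ 2) && (`|b| <= Num.sqrt (rho ^+ 2 - a ^+ 2)).
  have [h|h] := leP (a ^+ 2) (rho ^+ 2); last first.
    by apply/negbTE; rewrite -ltNge; have := sqr_ge0 b; lra.
  rewrite -sqrtr_sqr ler_sqrt ?subr_ge0//; apply/idP/idP; lra.
case: q => a b; rewrite /ccyl /hw /hits; case: i => [|[|i]] /=.
- rewrite (addrC (t ^+ 2)) key; split; last first.
    by move=> /andP[/andP[h1 h2]]; rewrite h1 h2.
  by move=> [/andP[h1 h2] h3]; rewrite h1 h3.
- rewrite key; split; last first.
    by move=> /andP[/andP[h1 h2]]; rewrite h1 h2.
  by move=> [/andP[h1 h2] h3]; rewrite h1 h3.
- split.
    by move=> [h1 h2]; rewrite h1 (le_trans _ h2)//= h2.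
  by move=> /andP[/andP[h1 h2]]; rewrite h1 h2.
Qed.

Lemma closed_ccyl : closed ccyl.
Proof.
have -> : ccyl =
    (fun p => p.1.1 * p.1.1 + p.1.2 * p.1.2) @^-1` [set x | x <= rho ^+ 2] `&`
    (fun p => `|p.2|) @^-1` [set x | x <= rho].
  by apply/seteqP; split => p; rewrite /ccyl /= -!expr2.
apply: closedI; apply: closed_comp; try exact: closed_le.
- move=> p _; apply: cvgD; apply: cvgM;
    (exact: continuous_coord1 || exact: continuous_coord2).
- move=> p _; apply: (@continuous_comp _ _ _ snd (fun x : R => `|x|)).
    exact: cvg_snd.
  exact: norm_continuous.
Qed.

Definition competitor p : R := if `[< ccyl p >] then 0 else u_delta delta p.

Lemma measurable_ccyl : measurable (ccyl : set (mR3 R)).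
Proof. by apply: closed_measurable3; exact: closed_ccyl. Qed.

Lemma ccyl_ocyl : ccyl `<=` O.
Proof.
move=> p [h1 h2]; split; last exact: le_lt_trans rho1.
have r0 : 0 <= rho by exact: le_trans h2.
apply: (le_lt_trans h1); rewrite expr1n -(expr1n R 2) ltr_sqr ?nnegrE//.
Qed.

Lemma competitorE p : competitor p = \1_(~` ccyl) p * u_delta delta p.
Proof.
rewrite /competitor indicE; case: asboolP => h.
  by rewrite memNset ?mul0r//; apply.
by rewrite mem_set ?mul1r.
Qed.

Lemma measurable_competitor : measurable_fun [set: mR3 R] (competitor : mR3 R -> R).
Proof.
rewrite (_ : competitor = fun p => \1_(~` ccyl) p * u_delta delta p); last first.
  by apply/funext => p; exact: competitorE.
apply: measurable_funM; last exact: measurable_u_delta.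
by apply: measurable_indic; apply: measurableC; exact: measurable_ccyl.
Qed.

Lemma ocyl1_cube : O `<=` cube (0 : R3 R) 1.
Proof.
move=> p [h1 h2]; split; rewrite /= ?subr0//.
  rewrite -ltr_sqr ?nnegrE// real_normK ?num_real//.
  by rewrite (le_lt_trans _ h1)// lerDl sqr_ge0.
rewrite -ltr_sqr ?nnegrE// real_normK ?num_real//.
by rewrite (le_lt_trans _ h1)// lerDr sqr_ge0.
Qed.

Lemma uside_bounded i s p : cube (0 : R3 R) 1 p ->
  `|uside delta i s p| <= 2 + `|delta|.
Proof.
case: p => -[x y] z [/=]; rewrite !subr0 => x1 y1 z1.
have sq1 (a : R) : `|a| < 1 -> a ^+ 2 < 1.
  by move=> a1; rewrite -(real_normK (num_real a)) expr_lt1.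
have w2 : wup x y <= 2.
  rewrite -ler_sqr ?nnegrE ?sqrtr_ge0// wup_sqr ler_pdivrMr ?pi_gt0//.
  have := prad_abs x y; rewrite ler_norml => /andP[h _].
  have r1 : prad x y <= 2.
    rewrite -ler_sqr ?nnegrE ?prad_ge0// prad_sqr.
    by have := sq1 _ x1; have := sq1 _ y1; lra.
  have := pi_ge2 R; nra.
have w0 : 0 <= wup x y by exact: sqrtr_ge0.
have dz : `|delta * z| <= `|delta|.
  by rewrite normrM ler_piMr// ltW.
have up : `|uup delta ((x, y), z)| <= 2 + `|delta|.
  by apply: (le_trans (ler_normD _ _)); rewrite lerD// ger0_norm.
have lo : `|ulo delta ((x, y), z)| <= 2 + `|delta|.
  by apply: (le_trans (ler_normD _ _)); rewrite lerD// normrN ger0_norm.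
have ud : `|u_delta delta ((x, y), z)| <= 2 + `|delta|.
  by rewrite u_deltaE; case: ifP.
by case: i => [|[|i]] //=; case: s.
Qed.

Lemma u_delta_bounded p : O p -> `|u_delta delta p| <= 2 + `|delta|.
Proof. by move=> /ocyl1_cube; exact: (@uside_bounded 0 true). Qed.

Lemma leb3_ocyl1_fin : (leb3 O < +oo)%E.
Proof.
have [mc lc] := leb3_cube (0 : R3 R) (@ltr01 R).
apply: (@le_lt_trans _ _ (leb3 (cube (0 : R3 R) 1))); last by rewrite lc ltry.
apply: le_measure; rewrite ?inE//; first exact: measurable_ocyl.
exact: ocyl1_cube.
Qed.

Lemma integrable_competitor : (@leb3 R).-integrable O (EFin \o competitor).
Proof.
apply: measurable_bounded_integrable.
- exact: measurable_ocyl.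
- exact: leb3_ocyl1_fin.
- by apply: measurable_funTS; exact: measurable_competitor.
- exists (2 + `|delta|); split; first exact: num_real.
  move=> M hM p /= Op; apply: le_trans (ltW hM); rewrite /competitor.
  by case: ifP => _; [rewrite normr0 addr_ge0|exact: u_delta_bounded].
Qed.

Lemma integrable_crack_energy : (@leb3 R).-integrable O
  (fun p => (\sum_(i < 3) crack_grad delta p i ^+ 2)%:E).
Proof.
apply/integrableP; split.
  by apply: measurable_funTS; exact: measurable_crack_energy.
have E := crack_energy_ocyl delta (@ltr01 R).
suff I : (\int[@leb3 R]_(p in O) `|(\sum_(i < 3) crack_grad delta p i ^+ 2)%:E| =
    \int[@leb3 R]_(p in O) (\sum_(i < 3) crack_grad delta p i ^+ 2)%:E)%E.
  by rewrite [ltLHS]I [ltLHS]E ltry.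
apply: eq_integral => p _.
by rewrite gee0_abs// lee_fin sumr_ge0// => i _; exact: sqr_ge0.
Qed.

(** On a domain of finite measure, [|a| <= 1 + a ^ 2] bounds each component by an integrable
    function built from the energy density. *)
Lemma integrable_crack_grad (i : 'I_3) :
  (@leb3 R).-integrable O (fun p => (crack_grad delta p i)%:E).
Proof.
have ic : (@leb3 R).-integrable O (fun=> 1%:E).
  apply: measurable_bounded_integrable; [exact: measurable_ocyl|
    exact: leb3_ocyl1_fin|exact: measurable_cst|].
  exists 1; split; first exact: num_real.
  by move=> M hM p /= _; rewrite normr1 ltW.
have iD := integrableD (measurable_ocyl 1) ic integrable_crack_energy.
apply: le_integrable iD; first exact: measurable_ocyl.
  apply/measurable_EFinP; apply: measurable_funTS; exact: measurable_crack_grad.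
move=> p _ /=; rewrite lee_fin.
have S0 : 0 <= \sum_(i < 3) crack_grad delta p i ^+ 2.
  by rewrite sumr_ge0// => j _; exact: sqr_ge0.
rewrite [leRHS]ger0_norm; last by rewrite addr_ge0.
have : crack_grad delta p i ^+ 2 <= \sum_(i < 3) crack_grad delta p i ^+ 2.
  by rewrite (bigD1 i)//= lerDl sumr_ge0// => j _; exact: sqr_ge0.
have := real_normK (num_real (crack_grad delta p i)).
have := normr_ge0 (crack_grad delta p i); set a := `|_| => a0 <-.
nra.
Qed.

(* Traces of [u_delta] on the jump set of the competitor along the lines of
   direction [i]: the two sides of the slit, or the two faces of the cylinder
   where the line meets it. *)
Definition face (i : nat) (s : bool) (q : mR2 R) : mR3 R :=
  emb i q (if s then hw i q else - hw i q).

(** All lines that meet the domain have their parameter in this box. Cutting there makes the density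
    integrable, and no test function sees the cut. *)
Definition face_density (i : nat) (s : bool) (q : mR2 R) : R :=
  \1_[set q : mR2 R | `|q.1| < 1 /\ `|q.2| < 1] q * uside delta i s (face i s q).

Lemma measurable_box : measurable [set q : mR2 R | `|q.1| < 1 /\ `|q.2| < 1].
Proof.
apply: open_measurable2.
have -> : [set q : R * R | `|q.1| < 1 /\ `|q.2| < 1] =
    (fun q => `|q.1|) @^-1` [set x | x < 1] `&` (fun q => `|q.2|) @^-1` [set x | x < 1].
  by [].
apply: openI; apply: open_comp; try exact: open_lt; move=> q _.
  apply: (@continuous_comp _ _ _ fst (fun x : R => `|x|)); first exact: cvg_fst.
  exact: norm_continuous.
apply: (@continuous_comp _ _ _ snd (fun x : R => `|x|)); first exact: cvg_snd.
exact: norm_continuous.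
Qed.

Lemma measurable_hw i : measurable_fun [set: mR2 R] (hw i : mR2 R -> R).
Proof.
have c1 : continuous (fun q : R * R => q.1) by move=> q; exact: cvg_fst.
have c2 : continuous (fun q : R * R => q.2) by move=> q; exact: cvg_snd.
have csq (f : R * R -> R) : continuous f -> continuous (fun q => f q ^+ 2).
  by move=> cf q; apply: (@cvgM _ _ _ _ f f); exact: cf.
have cle (f : R * R -> R) (c : R) : continuous f ->
    measurable_fun [set: mR2 R] (fun q : mR2 R => f q <= c).
  move=> cf; apply: (measurable_fun_bool true); rewrite setTI.
  apply: closed_measurable2; apply: (@closed_comp _ _ f [set x | x <= c]).
    by move=> q _; exact: cf.
  exact: closed_le.
rewrite /hw /hits; case: (ltnP i 2) => _; apply: measurable_fun_ifT => //.
- apply: measurable_and; first by apply: cle; exact: csq.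
  apply: cle => q; apply: (@continuous_comp _ _ _ snd (fun x : R => `|x|)).
    exact: cvg_snd.
  exact: norm_continuous.
- apply: continuous_measurable2; apply: continuous_sqrt_comp => q.
  by apply: cvgB; [exact: cvg_cst|exact: csq].
- apply: measurable_and => //; apply: cle => q.
  by apply: cvgD; exact: csq.
Qed.

Lemma measurable_face i s : measurable_fun [set: mR2 R] (face i s).
Proof.
have mh : measurable_fun [set: mR2 R] (fun q : mR2 R => if s then hw i q else - hw i q).
  by case: s; [exact: measurable_hw|apply: measurableT_comp => //; exact: measurable_hw].
have mp : measurable_fun [set: mR2 R] (fun q : mR2 R =>
    ((q, if s then hw i q else - hw i q) : mR3 R)).
  exact: measurable_fun_pair.
exact: (measurableT_comp (measurable_perm3 i) mp).
Qed.

Lemma face_cube i s q : `|q.1| < 1 -> `|q.2| < 1 -> cube (0 : R3 R) 1 (face i s q).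
Proof.
move=> q1 q2; have h0 := hw_ge0 i q; have h1 := hw_lt1 i q.
have t1 : `|if s then hw i q else - hw i q| < 1.
  by case: s; rewrite ?normrN ger0_norm.
by rewrite /face; case: i h0 h1 t1 => [|[|i]] _ _ t1; split; rewrite /= subr0.
Qed.

Lemma face_density_bounded i s q : `|face_density i s q| <= 2 + `|delta|.
Proof.
rewrite /face_density indicE.
have [[q1 q2]|nq] := pselect (`|q.1| < 1 /\ `|q.2| < 1).
  by rewrite mem_set ?mul1r//; apply: uside_bounded; exact: face_cube.
by rewrite memNset ?mul0r ?normr0 ?addr_ge0.
Qed.

Lemma measurable_face_density i s :
  measurable_fun [set: mR2 R] (face_density i s).
Proof.
apply: measurable_funM; first by apply: measurable_indic; exact: measurable_box.
exact: (measurableT_comp (measurable_uside delta i s) (measurable_face i s)).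
Qed.

Lemma integrable_face_density i s :
  (@leb2 R).-integrable setT (EFin \o face_density i s).
Proof.
have mB := measurable_box.
have E : EFin \o face_density i s =
    (EFin \o face_density i s) \_ [set q : mR2 R | `|q.1| < 1 /\ `|q.2| < 1].
  apply/funext => q; rewrite patchE; case: ifPn => // qB.
  by rewrite /= /face_density indicE (negbTE qB) mul0r.
rewrite E; apply/(integrable_mkcond _ mB).
apply: measurable_bounded_integrable => //.
- have -> : [set q : mR2 R | `|q.1| < 1 /\ `|q.2| < 1] =
     `]-1, 1[%classic `*` `]-1, 1[%classic.
    by apply/seteqP; split => q; rewrite /= !in_itv/= -!ltr_norml.
  rewrite [ltLHS]product_measure1E//= !lebesgue_measure_itv/= lte_fin.
  by case: ifP => _; rewrite ?mul0e// -!EFinB -EFinM ltry.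
- by apply: measurable_funTS; exact: measurable_face_density.
- exists (2 + `|delta|); split; first exact: num_real.
  move=> M hM q /= _; apply: le_trans (ltW hM); exact: face_density_bounded.
Qed.

End Competitor.

(** * Distributional derivative of the competitor *)

Section CompetitorDerivative.
Context {R : realType}.
Variables delta rho : R.
Hypothesis rho1 : rho < 1.
Notation mu := (@lebesgue_measure R).
Notation O := (@ocyl R 1).
Implicit Types (p : R3 R) (q : R * R) (t : R) (phi : R3 R -> R).

Lemma ocyl1_emb i q t : O (emb i q t) -> [/\ `|q.1| < 1, `|q.2| < 1 & `|t| < 1].
Proof. by move=> /ocyl1_cube; case: q => a b; case: i => [|[|i]] /= []; rewrite /= !subr0. Qed.

(** The derivative of [competitor * phi] in direction [i], away from the jumps. *)
Definition ibp_integrand (i : 'I_3) phi p : R :=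
  \1_(~` ccyl rho) p *
  (u_delta delta p * 'D_(basis_vec i) phi p + crack_grad delta p i * phi p).

Lemma measurable_ibp_integrand i phi : test_fun O phi ->
  measurable_fun [set: mR3 R] (ibp_integrand i phi).
Proof.
move=> [cphi _ cdphi _ _]; apply: measurable_funM.
  by apply: measurable_indic; apply: measurableC; exact: measurable_ccyl.
apply: measurable_funD; apply: measurable_funM.
- exact: measurable_u_delta.
- exact: continuous_measurable3.
- exact: measurable_crack_grad.
- exact: continuous_measurable3.
Qed.

(** On the line the integrand is the derivative of [uside * phi] on either side of the segment of
    half-length [hw]. The outer end point 2 is safe: [hw < 1], and [phi] vanishes for [|t| >= 1]. *)
Lemma ibp_line (i : 'I_3) phi q : test_fun O phi -> q.1 != 0 ->
  (\int[mu]_t (ibp_integrand i phi (emb i q t))%:E =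
   (- (uside delta i true (face rho i true q) * phi (face rho i true q)) +
    uside delta i false (face rho i false q) * phi (face rho i false q))%:E)%E.
Proof.
move=> tphi q0; have [cphi dphi cdphi _ _] := tphi.
have out t : 1 <= `|t| -> phi (emb i q t) = 0 /\ 'D_(basis_vec i) phi (emb i q t) = 0.
  move=> t1; have [|-> ->//] := @test_fun_out _ _ _ (emb i q t) tphi.
  by move=> /ocyl1_emb[_ _]; rewrite ltNge t1.
have cpl : continuous (fun t => phi (emb i q t)).
  by move=> t; apply: (@continuous_comp _ _ _ (emb i q) phi); [exact: continuous_emb|exact: cphi].
have cdpl : continuous (fun t => 'D_(basis_vec i) phi (emb i q t)).
  by move=> t; apply: (@continuous_comp _ _ _ (emb i q) ('D_(basis_vec i) phi));
    [exact: continuous_emb|exact: cdphi].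
have cu s : continuous (fun t => uside delta i s (emb i q t)).
  exact: continuous_uside_line.
have cg : continuous (fun t => crack_grad delta (emb i q t) i).
  exact: continuous_grad_line.
have hw0 := hw_ge0 rho i q; have h1 := hw_lt1 rho1 i q.
have hw2 : hw rho i q < 2 by lra.
pose F s t := uside delta i s (emb i q t) * phi (emb i q t).
pose f s t := uside delta i s (emb i q t) * 'D_(basis_vec i) phi (emb i q t) +
  crack_grad delta (emb i q t) i * phi (emb i q t).
have cF s : continuous (F s) by move=> t; apply: cvgM; [exact: cu|exact: cpl].
have cf s : continuous (f s).
  by move=> t; apply: cvgD; apply: cvgM;
    [exact: cu|exact: cdpl|exact: cg|exact: cpl].
have dF (s : bool) t : (if s then 0 < t else t < 0) -> is_derive t (1 : R) (F s) (f s t).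
  move=> st; have d1 := is_derive_uside_line delta i q0 st.
  have d2 := is_derive_line (dphi i (emb i q t)).
  apply: (is_derive_eq (is_deriveM d1 d2)).
  by rewrite /f /GRing.scale/=; ring.
have H1 (s : bool) t : (if s then hw rho i q < t else t < - hw rho i q) ->
    ibp_integrand i phi (emb i q t) = f s t.
  move=> st; rewrite /ibp_integrand indicE mem_set ?mul1r; last first.
    move=> /ccyl_emb/andP[_]; apply/negP; rewrite -ltNge.
    by case: s st => st; rewrite ltr_normr ?st// (ltrNr (hw rho i q)) st orbT.
  by rewrite /f (@uside_sign _ _ _ s)//; case: s st => st; lra.
transitivity ((- F true (hw rho i q) + F false (- hw rho i q))%:E); last by [].
apply: (@line_ftc _ (hw rho i q) 2 (F true) (F false) (f true) (f false)) => //.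
- by move=> t /andP[t1 _]; apply: dF; lra.
- by move=> t /andP[_ t1]; apply: dF; lra.
- by rewrite /F (out _ _).1 ?mulr0// ger0_norm// ler1n.
- by rewrite /F (out _ _).1 ?mulr0// normrN ger0_norm// ler1n.
- apply: (measurableT_comp (measurable_ibp_integrand i tphi)).
  exact: (measurableT_comp (measurable_perm3 i) (measurable_pair1 q)).
- by move=> t /andP[t1 _]; exact: (H1 true).
- by move=> t /andP[_ t1]; exact: (H1 false).
- move=> t th; rewrite /ibp_integrand indicE memNset ?mul0r//= => h; apply: h.
  apply/ccyl_emb; rewrite (ltW th) andbT.
  by move: th; rewrite /hw; case: ifP => // _; rewrite ltNge normr_ge0.
- move=> t t2; rewrite /ibp_integrand; have [|-> ->] := out t; first by rewrite (le_trans _ (ltW t2))// ler1n.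
  by rewrite !mulr0 addr0 mulr0.
Qed.

Lemma leb2_fst (a : R) : {ae @leb2 R, forall q : mR2 R, q.1 != a}.
Proof.
exists ([set a] `*` setT); split; first exact: measurableX.
  by rewrite [LHS]product_measure1E//= lebesgue_measure_set1 mul0e.
by move=> q /= /negP; rewrite negbK => /eqP ->.
Qed.

Lemma leb2_snd (a : R) : {ae @leb2 R, forall q : mR2 R, q.2 != a}.
Proof.
exists (setT `*` [set a]); split; first exact: measurableX.
  by rewrite [LHS]product_measure1E//= lebesgue_measure_set1 mule0.
by move=> q /= /negP; rewrite negbK => /eqP ->.
Qed.

Lemma integrableM_bounded d (T : measurableType d) (m : {measure set T -> \bar R})
    (D : set T) (f h : T -> R) (C : R) : measurable D ->
  m.-integrable D (EFin \o f) -> measurable_fun D h ->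
  (forall x, D x -> `|h x| <= C) ->
  m.-integrable D (fun x => (h x * f x)%:E).
Proof.
move=> mD if_ mh hC; apply: (integrableMr mD mh _ if_).
exists C; split; first exact: num_real.
by move=> M hM x /= Dx; exact: le_trans (hC _ Dx) (ltW hM).
Qed.

Lemma integrable_ocylT (f : mR3 R -> R) : (forall p, ~ O p -> f p = 0) ->
  (@leb3 R).-integrable O (EFin \o f) -> (@leb3 R).-integrable setT (EFin \o f).
Proof.
move=> f0 iF; rewrite (_ : EFin \o f = (EFin \o f) \_ O).
  by apply/(integrable_mkcond _ (measurable_ocyl 1)).
apply/funext => p; rewrite patchE; case: ifPn => //=.
by rewrite notin_setE => /f0 ->.
Qed.

Lemma integral_ocylT (f : mR3 R -> R) : (forall p, ~ O p -> f p = 0) ->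
  (\int[@leb3 R]_(p in O) (f p)%:E = \int[@leb3 R]_p (f p)%:E)%E.
Proof.
move=> f0; rewrite integral_mkcond; apply: eq_integral => p _.
by rewrite patchE; case: ifPn => //=; rewrite notin_setE => /f0 ->.
Qed.

Definition jump_flux (i : 'I_3) s phi : \bar R :=
  (\int[@leb2 R]_q (phi (face rho i s q) * face_density delta rho i s q)%:E)%E.

Lemma integrable_jump_flux (i : 'I_3) s phi : test_fun O phi ->
  (@leb2 R).-integrable setT
    (fun q => (phi (face rho i s q) * face_density delta rho i s q)%:E).
Proof.
move=> tphi; have [cphi _ _ _ _] := tphi.
have [C [phiC _]] := test_fun_bounded tphi.
apply: (integrableM_bounded (C := C)) => //.
- exact: integrable_face_density.
- apply: (measurableT_comp _ (measurable_face rho i s)).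
  exact: continuous_measurable3.
Qed.

Lemma integrable_competitor_test (i : 'I_3) phi : test_fun O phi ->
  (@leb3 R).-integrable setT
    (fun p => (competitor delta rho p * 'D_(basis_vec i) phi p)%:E).
Proof.
move=> tphi; have [_ _ cdphi _ _] := tphi.
have [C [_ phiC]] := test_fun_bounded tphi.
apply: integrable_ocylT.
  by move=> p /(test_fun_out tphi)[_ ->]; rewrite mulr0.
rewrite (_ : EFin \o _ =
    fun p => ('D_(basis_vec i) phi p * competitor delta rho p)%:E).
  apply: (integrableM_bounded (C := C)) => //.
  - exact: measurable_ocyl.
  - exact: integrable_competitor.
  - by apply: measurable_funTS; exact: continuous_measurable3.
by apply/funext => p /=; rewrite mulrC.
Qed.

Lemma integrable_chi_grad (i : 'I_3) : (@leb3 R).-integrable setT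
  (EFin \o (fun p => \1_(O `\` ccyl rho) p * crack_grad delta p i)).
Proof.
apply: integrable_ocylT.
  by move=> p nO; rewrite indicE memNset ?mul0r// => -[].
apply: (integrableM_bounded (C := 1)).
- exact: measurable_ocyl.
- exact: integrable_crack_grad.
- apply: measurable_indic; apply: measurableD; first exact: measurable_ocyl.
  exact: measurable_ccyl.
- by move=> p _; rewrite indicE; case: (_ \in _); rewrite ?normr1 ?normr0.
Qed.

Lemma integrable_grad_test (i : 'I_3) phi : test_fun O phi ->
  (@leb3 R).-integrable setT
    (fun p => (phi p * (\1_(O `\` ccyl rho) p * crack_grad delta p i))%:E).
Proof.
move=> tphi; have [cphi _ _ _ _] := tphi.
have [C [phiC _]] := test_fun_bounded tphi.
apply: (integrableM_bounded (C := C)) => //.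
  exact: integrable_chi_grad.
exact: continuous_measurable3.
Qed.

Lemma ibp_integrandE (i : 'I_3) phi p : test_fun O phi ->
  ibp_integrand i phi p = competitor delta rho p * 'D_(basis_vec i) phi p +
    phi p * (\1_(O `\` ccyl rho) p * crack_grad delta p i).
Proof.
move=> tphi; rewrite /ibp_integrand competitorE.
have [Op|nOp] := pselect (O p); last first.
  by have [-> ->] := test_fun_out tphi nOp; rewrite !mulr0 mul0r !addr0 mulr0.
have -> : \1_(O `\` ccyl rho) p = \1_(~` ccyl rho) p :> R.
  rewrite !indicE; suff -> : (p \in O `\` ccyl rho) = (p \in ~` ccyl rho) by [].
  by apply/idP/idP; rewrite !inE; [case|split].
by ring.
Qed.

(** The integral of [ibp_integrand] is computed twice, as a sum of two volume integrals and line by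
    line, which leaves only the values on the faces. *)
Lemma competitor_ibp (i : 'I_3) phi : test_fun O phi ->
  (\int[@leb3 R]_(p in O) (competitor delta rho p * 'D_(basis_vec i) phi p)%:E =
   - (\int[@leb3 R]_p (phi p * (\1_(O `\` ccyl rho) p * crack_grad delta p i))%:E +
      (jump_flux i true phi - jump_flux i false phi)))%E.
Proof.
move=> tphi.
have iA := integrable_competitor_test i tphi.
have iB := integrable_grad_test i tphi.
have iJ s := integrable_jump_flux i s tphi.
have iI : (@leb3 R).-integrable setT (fun p => (ibp_integrand i phi p)%:E).
  rewrite (_ : (fun p => _) = (fun p =>
    (competitor delta rho p * 'D_(basis_vec i) phi p)%:E +
    (phi p * (\1_(O `\` ccyl rho) p * crack_grad delta p i))%:E)%E).
    exact: integrableD.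
  by apply/funext => p; rewrite ibp_integrandE.
have E1 : (\int[@leb3 R]_p (ibp_integrand i phi p)%:E =
    \int[@leb3 R]_p (competitor delta rho p * 'D_(basis_vec i) phi p)%:E +
    \int[@leb3 R]_p (phi p * (\1_(O `\` ccyl rho) p * crack_grad delta p i))%:E)%E.
  rewrite -integralD//; apply: eq_integral => p _.
  by rewrite ibp_integrandE.
have E2 : (\int[@leb3 R]_p (ibp_integrand i phi p)%:E =
    - jump_flux i true phi + jump_flux i false phi)%E.
  rewrite (fubini_emb i iI).
  transitivity (\int[@leb2 R]_q
     (- (phi (face rho i true q) * face_density delta rho i true q)%:E +
      (phi (face rho i false q) * face_density delta rho i false q)%:E))%E; last first.
    rewrite integralD//; last exact: integrableN.
    by rewrite integralN//; exact: integrable_add_def.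
  apply: ae_eq_integral => //.
  - have [_ iP] := integral_perm3 i iI.
    exact: (@measurable_fubini_F _ _ _ _ R (@leb2 R) mu _ iP).
  - apply: (@measurable_int _ _ _ (@leb2 R)); apply: integrableD => //.
    exact: integrableN.
  - have := (leb2_fst 0); apply: filterS => q q0 _ /=.
    rewrite ibp_line//.
    (* A face outside the domain is harmless because [phi] vanishes there; inside, the indicator of
       the box equals 1. *)
    have B s : phi (face rho i s q) * face_density delta rho i s q =
        uside delta i s (face rho i s q) * phi (face rho i s q).
      have [Of|nOf] := pselect (O (face rho i s q)); last first.
        by rewrite (test_fun_out tphi nOf).1 mul0r mulr0.
      have [q1 q2 _] := ocyl1_emb Of.
      by rewrite /face_density indicE mem_set ?mul1r 1?mulrC.
    by rewrite !B EFinD EFinN.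
have fin (d : measure_display) (T : measurableType d) (m : {measure set T -> \bar R})
    (f : T -> \bar R) : m.-integrable setT f -> (\int[m]_x f x)%E \is a fin_num.
  by move=> ?; exact: integrable_fin_num.
rewrite integral_ocylT; last first.
  by move=> p /(test_fun_out tphi)[_ ->]; rewrite mulr0.
move: (fin _ _ _ _ iA) (fin _ _ _ _ iB) (fin _ _ _ _ (iJ true)) (fin _ _ _ _ (iJ false)).
move: E1; rewrite E2 -/(jump_flux i true phi) -/(jump_flux i false phi).
move: (\int[_]_p (competitor _ _ _ * _)%:E)%E => a.
move: (integral _ _ _) => b.
move: (jump_flux _ _ _) (jump_flux _ _ _) => c e.
move: a b c e => [a| |] [b| |] [c| |] [e| |]//= [] h _ _ _ _.
by congr EFin; lra.
Qed.

End CompetitorDerivative.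

Lemma charge_pushforward d d' (T : measurableType d) (T' : measurableType d')
    (R : realType) (nu : {charge set T -> \bar R}) (f : T -> T') :
  measurable_fun setT f -> exists nuf : {charge set T' -> \bar R},
    forall A, nuf A = nu (f @^-1` A).
Proof. by move=> mf; unshelve eexists (pushforward nu f). Qed.

Section CompetitorCharge.
Context {R : realType}.
Variables delta rho : R.
Hypothesis rho1 : rho < 1.
Notation O := (@ocyl R 1).

(** The derivative is the charge of density [crack_grad] off the cylinder plus the images under
    [face] of the two face densities, taken with opposite signs. Pushing forward from the parameter
    plane handles the slit, the lids and the lateral surface alike. *)
Lemma competitor_charge (i : 'I_3) : exists D : {charge set (mR3 R) -> \bar R},
  (forall A, measurable A -> A `<=` O -> D A =
    \int[@leb3 R]_(p in A) (\1_(~` ccyl rho) p * crack_grad delta p i)%:E +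
    (\int[@leb2 R]_(q in face rho i true @^-1` A) (face_density delta rho i true q)%:E -
     \int[@leb2 R]_(q in face rho i false @^-1` A) (face_density delta rho i false q)%:E))%E
  /\ forall phi, test_fun O phi ->
    (\int[@leb3 R]_(p in O) (competitor delta rho p * 'D_(basis_vec i) phi p)%:E =
     - charge_integral D phi)%E.
Proof.
have ig := integrable_chi_grad delta rho i.
have ih s := integrable_face_density delta rho1 i s.
have [Dp DpE] := charge_pushforward (induced_charge (ih true)) (measurable_face rho i true).
have [Dm DmE] := charge_pushforward (induced_charge (ih false)) (measurable_face rho i false).
exists (cadd (induced_charge ig) (cadd Dp (copp Dm))); split.
  move=> A mA AO; transitivity (induced_charge ig A + (Dp A - Dm A))%E => //.
  rewrite DpE DmE /induced_charge; congr (_ + _)%E.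
  apply: eq_integral => p; rewrite inE => Ap; congr ((_ * _)%:E).
  rewrite !indicE; suff -> : (p \in O `\` ccyl rho) = (p \in ~` ccyl rho) by [].
  by apply/idP/idP; rewrite !inE; [case|split; [exact: AO|]].
move=> phi tphi; rewrite (competitor_ibp delta rho1 i tphi); congr (- _)%E.
have [cphi _ _ _ _] := tphi.
have mphi := continuous_measurable3 cphi.
have [C [phiC _]] := test_fun_bounded tphi.
rewrite (charge_integral_cadd _ _ mphi phiC) (charge_integral_cadd _ _ mphi phiC).
rewrite (charge_integral_copp _ mphi phiC) (charge_integral_induced _ mphi phiC).
have J (s : bool) (Ds : {charge set (mR3 R) -> \bar R}) : (forall A, Ds A = induced_charge (ih s) (face rho i s @^-1` A)) ->
    charge_integral Ds phi = jump_flux delta rho i s phi.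
  move=> DsE.
  rewrite (charge_integral_pushforward (measurable_face rho i s)
    (fun A _ => DsE A) mphi phiC).
  have mf := measurableT_comp mphi (measurable_face rho i s).
  have fC q : `|(phi \o face rho i s) q| <= C by exact: phiC.
  by rewrite (charge_integral_induced _ mf fC).
by rewrite (J _ _ DpE) (J _ _ DmE).
Qed.

End CompetitorCharge.

(** * Points of the approximate discontinuity set *)

Section Discontinuities.
Context {R : realType}.
Variables delta rho : R.
Hypothesis rho1 : rho < 1.
Notation mu := (@lebesgue_measure R).
Notation O := (@ocyl R 1).
Notation v := (competitor delta rho).
Implicit Types (p : R3 R) (q : R * R) (t : R).

(* [u_delta] rationalized, in order to cross the half-plane [y = 0, x > 0]. *)
Definition ualt p : R :=
  p.1.2 / Num.sqrt (pi * (prad p.1.1 p.1.2 + p.1.1)) + delta * p.2.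

Lemma ualtE p : 0 < prad p.1.1 p.1.2 + p.1.1 -> u_delta delta p = ualt p.
Proof.
case: p => -[x y] z /= r0; rewrite u_deltaE /uup /ulo /ualt /=.
have pr0 : 0 < pi * (prad x y + x) by rewrite mulr_gt0// pi_gt0.
have E : wup x y * Num.sqrt (pi * (prad x y + x)) = `|y|.
  rewrite -sqrtrM ?prad_subr_ge0// -sqrtr_sqr; congr Num.sqrt.
  have -> : y ^+ 2 = prad x y ^+ 2 - x ^+ 2 by rewrite prad_sqr addrAC subrr add0r.
  by have := pi_gt0 R; move: (@pi R) => P P0; field; rewrite gt_eqF.
have s0 : 0 < Num.sqrt (pi * (prad x y + x)) by rewrite sqrtr_gt0.
have -> : wup x y = `|y| / Num.sqrt (pi * (prad x y + x)) by rewrite -E mulfK// gt_eqF.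
case: ifPn => y0; first by rewrite ger0_norm.
by rewrite ltr0_norm ?ltNge// mulNr opprK.
Qed.

Lemma continuous_ualt p : 0 < prad p.1.1 p.1.2 + p.1.1 -> {for p, continuous ualt}.
Proof.
move=> r0; apply: cvgD; last by apply: cvgM; [exact: cvg_cst|exact: continuous_coord3].
apply: cvgM; first exact: continuous_coord2.
apply: (@continuous_comp _ _ _ (fun p => Num.sqrt (pi * (prad p.1.1 p.1.2 + p.1.1)))
  (@GRing.inv R)).
  apply: continuous_sqrt_comp => p'; apply: cvgM; first exact: cvg_cst.
  apply: cvgD; last exact: continuous_coord1.
  exact: (continuous_prad_comp continuous_coord1 continuous_coord2).
apply: inv_continuous; rewrite gt_eqF// sqrtr_gt0 mulr_gt0// pi_gt0//.
Qed.

Lemma off_slit_gt0 (x y : R) : (y != 0) || (0 < x) -> 0 < prad x y + x.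
Proof.
have := prad_abs x y; rewrite ler_norml => /andP[h _].
have [y0 _|_ /= x0] := boolP (y != 0); last by have := prad_ge0 x y; lra.
have := wup_gt0 (- x) y0; rewrite sqrtr_gt0 /prad sqrrN opprK.
by rewrite pmulr_lgt0 ?invr_gt0 ?pi_gt0.
Qed.

Lemma continuous_u_delta p : (p.1.2 != 0) || (0 < p.1.1) ->
  {for p, continuous (u_delta delta)}.
Proof.
move=> /off_slit_gt0 r0.
have U : \forall y \near p, ualt y = u_delta delta y.
  have : \forall y \near p, 0 < prad y.1.1 y.1.2 + y.1.1.
    have c : {for p, continuous (fun y : R3 R => prad y.1.1 y.1.2 + y.1.1)}.
      apply: cvgD; last exact: continuous_coord1.
      exact: (continuous_prad_comp continuous_coord1 continuous_coord2).
    exact: (c _ (open_nbhs_nbhs (conj (@open_gt _ 0) r0))).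
  by apply: filterS => y y0; rewrite ualtE.
apply: (cvg_trans (near_eq_cvg U)).
have -> : nbhs (u_delta delta p) = nbhs (ualt p) by rewrite ualtE.
exact: continuous_ualt.
Qed.

Lemma competitor_near p : ~ ccyl rho p ->
  exists2 d : R, 0 < d & forall y, eball p d y -> v y = u_delta delta y.
Proof.
move=> nK; have oK : open (~` ccyl rho) by apply: closed_openC; exact: closed_ccyl.
have [d d0 dK] := eball_nbhs (open_nbhs_nbhs (conj oK nK)).
by exists d => // y /dK yK; rewrite /competitor; case: asboolP.
Qed.

(** Cubes of half-side [r / 8] centred at distance [r / 4] on either side of the slit force a mean
    limit to equal both branches at [p], which differ by twice [wup], positive for [x < 0]. *)
Lemma slit_discontinuity p : O p -> ~ ccyl rho p -> p.1.2 = 0 -> p.1.1 < 0 ->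
  disc_set O v p.
Proof.
move=> Op nK y0 x0; split => // -[a lim].
have [d d0 vu] := competitor_near nK.
have mv := measurable_competitor delta rho.
have oO := @open_ocyl R 1.
have k4 : 0 < (8^-1 : R) <= 4^-1.
  by rewrite invr_gt0 ltr0n lef_pV2 ?posrE ?ltr0n// ler_nat.
have side (e : R) g : (e = 1 \/ e = -1) -> continuous g ->
    (forall y, 0 < e * y.1.2 -> u_delta delta y = g y) -> a = g p.
  move=> e1 cg ug.
  pose c : R3 R := ((0, e / 4), 0).
  have c2 : enorm c <= 2^-1.
    apply: enorm_le; rewrite ?invr_ge0 //= expr0n/= addr0 add0r.
    by case: e1 => ->; lra.
  apply: (mean_limit_cone oO Op mv _ k4 c2 _ lim); first exact: cg.
  near=> r => y yC.
  have r0 : 0 < r by [].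
  rewrite vu; last first.
    have /= h := cone_eball (p := p) k4 c2 r0 yC.
    by apply: lt_le_trans h _; near: r; exact: nbhs_right_le.
  apply: ug; case: yC => _ + _; rewrite /= y0 add0r ltr_norml.
  by case: e1 => ->; lra.
have h1 := side 1 (uup delta) (or_introl erefl) (@continuous_uup R delta).
have h2 := side (-1) (ulo delta) (or_intror erefl) (@continuous_ulo R delta).
have : uup delta p = ulo delta p.
  rewrite -h1; last by move=> y; rewrite mul1r u_deltaE => /ltW ->.
  by apply: h2 => y; rewrite mulN1r oppr_gt0 u_deltaE ltNge; case: (0 <= _).
rewrite /uup /ulo y0 => /addIr; rewrite /wup.
have : 0 < Num.sqrt ((prad p.1.1 0 - p.1.1) / pi).
  rewrite sqrtr_gt0 divr_gt0 ?pi_gt0// subr_gt0 (lt_le_trans x0)//.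
  exact: prad_ge0.
lra.
Unshelve. all: by end_near. Qed.

(** The cylinder is star-shaped about the origin. Cubes centred at [(1 - r / 4) * p] lie in it and
    cubes centred at [(1 + r / 4) * p] avoid it: the dilation moves the boundary by [rho * r / 4],
    more than the [rho * r / 8] lost to the size of the cubes. A mean limit would be both 0 and
    [u_delta delta p]. *)
Lemma face_discontinuity p : 0 < rho -> ccyl rho p -> ~ ocyl rho p ->
  p.1.2 != 0 -> u_delta delta p != 0 -> disc_set O v p.
Proof.
move=> r0 Kp nop y0 u0; have Op := ccyl_ocyl rho1 Kp.
split => // -[a lim].
have mv := measurable_competitor delta rho.
have oO := @open_ocyl R 1.
have k4 : 0 < rho / 16 <= 4^-1 by have r1 := rho1; apply/andP; split; lra.
have [Kxy Kz] := Kp.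
have rho2 : rho ^+ 2 < 1 by rewrite expr_lt1// ltW.
have z2 : p.2 ^+ 2 <= rho ^+ 2.
  by rewrite -(real_normK (num_real p.2)) ler_sqr ?nnegrE// ltW.
have c2 (e : R) : e ^+ 2 = 1 ->
    enorm ((e * p.1.1 / 4, e * p.1.2 / 4), e * p.2 / 4) <= 2^-1.
  move=> e2; apply: enorm_le; rewrite ?invr_ge0 //= !exprMn e2; lra.
have a0 : a = (cst 0 : R3 R -> R) p.
  apply: (mean_limit_cone (c := ((- 1 * p.1.1 / 4, - 1 * p.1.2 / 4), - 1 * p.2 / 4))
    oO Op mv _ k4 _ _ lim); first exact: cvg_cst.
    by apply: c2; rewrite sqrrN expr1n.
  near=> r => y yC.
  have s0 : 0 < r by [].
  have s1 : r <= 1 by near: r; exact: nbhs_right_le.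
  rewrite /competitor asboolT//; case: yC => /=.
  set h := rho / 16 * r => h1 h2 h3.
  have h0 : 0 < h by apply: mulr_gt0 => //; rewrite divr_gt0.
  have q0 : 0 <= 1 - r / 4 by lra.
  have hr : h <= rho / 16 by rewrite /h ler_piMr// ltW// divr_gt0.
  split.
    apply: ltW; have t0 : 0 <= (1 - r / 4) * rho by rewrite mulr_ge0// ltW.
    apply: (lt_le_trans (disc_thicken t0 h0 (_ : ((1 - r / 4) * p.1.1) ^+ 2 +
      ((1 - r / 4) * p.1.2) ^+ 2 <= _) _ _)).
    - by rewrite !exprMn -mulrDr ler_wpM2l// exprn_ge0.
    - by apply: ltW; apply: le_lt_trans h1; rewrite le_eqVlt; apply/orP; left;
        apply/eqP; congr `|_|; field.
    - by apply: ltW; apply: le_lt_trans h2; rewrite le_eqVlt; apply/orP; left;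
        apply/eqP; congr `|_|; field.
    - rewrite ler_sqr ?nnegrE; rewrite /h in h0 *; nra.
  have -> : y.2 = (1 - r / 4) * p.2 + (y.2 - (p.2 + r * (- 1 * p.2 / 4))) by field.
  apply: (le_trans (ler_normD _ _)); rewrite normrM (ger0_norm q0).
  have : (1 - r / 4) * `|p.2| <= (1 - r / 4) * rho by rewrite ler_wpM2l.
  rewrite /h in h3; nra.
have : a = u_delta delta p.
  apply: (mean_limit_cone (c := ((1 * p.1.1 / 4, 1 * p.1.2 / 4), 1 * p.2 / 4))
    oO Op mv _ k4 _ _ lim); first by apply: continuous_u_delta; rewrite y0.
    by apply: c2; rewrite expr1n.
  near=> r => y yC.
  have s0 : 0 < r by [].
  rewrite /competitor asboolF//; case: yC => /=.
  set h := rho / 16 * r => h1 h2 h3 [Ky Kyz].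
  have h0 : 0 < h by apply: mulr_gt0 => //; rewrite divr_gt0.
  have q0 : 0 <= 1 + r / 4 by lra.
  have rr : 0 < rho * r by apply: mulr_gt0.
  apply: nop; split.
    rewrite ltNge; apply/negP => pr.
    have := @disc_thicken _ rho h _ _ ((1 + r / 4) * p.1.1) ((1 + r / 4) * p.1.2)
      (ltW r0) h0 Ky; move=> /(_ _ _)/wrap[||].
    - by apply: ltW; apply: le_lt_trans h1; rewrite distrC le_eqVlt; apply/orP; left;
        apply/eqP; congr `|_|; field.
    - by apply: ltW; apply: le_lt_trans h2; rewrite distrC le_eqVlt; apply/orP; left;
        apply/eqP; congr `|_|; field.
    rewrite !exprMn -mulrDr; apply/negP; rewrite -leNgt.
    apply: (@le_trans _ _ ((1 + r / 4) ^+ 2 * rho ^+ 2)); last first.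
      by rewrite ler_wpM2l// exprn_ge0.
    rewrite -exprMn ler_sqr ?nnegrE; rewrite /h in h0 *; nra.
  rewrite ltNge; apply/negP => pr.
  have : (1 + r / 4) * rho <= `|(1 + r / 4) * p.2|.
    by rewrite normrM (ger0_norm q0) ler_wpM2l.
  have -> : (1 + r / 4) * p.2 = y.2 - (y.2 - (p.2 + r * (1 * p.2 / 4))) by field.
  have := ler_normB y.2 (y.2 - (p.2 + r * (1 * p.2 / 4))).
  rewrite /h in h3; nra.
by rewrite a0 => /esym/eqP; apply/negP.
Unshelve. all: by end_near. Qed.

End Discontinuities.

(** Each line of direction [i] meets [Z] in at most two points. *)
Lemma leb3_graph {R : realType} (i : nat) (Z : set (mR3 R)) (h : R * R -> R) :
  measurable Z -> (forall q t, Z (emb i q t) -> `|t| = h q) -> leb3 Z = 0%E.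
Proof.
move=> mZ Zh; have <- : (\int[@leb3 R]_p (\1_Z p)%:E = leb3 Z)%E.
  by rewrite integral_indic// setIT.
rewrite (@tonelli_emb _ i); last 2 first.
- by apply/measurable_EFinP; exact: measurable_indic.
- by move=> p; rewrite lee_fin.
apply: integral0_eq => q _.
have -> : (\int[@lebesgue_measure R]_t (\1_Z (emb i q t))%:E =
    \int[@lebesgue_measure R]_t (cst 0%E t))%E; last by rewrite integral_cst// mul0e.
have n2 : (@lebesgue_measure R).-negligible [set h q; - h q].
  have c : countable [set h q; - h q] by apply: finite_set_countable.
  exists [set h q; - h q]; split => //; first exact: measurableU.
  exact: countable_lebesgue_measure0.
apply: ae_eq_integral => //.
- have mI : measurable_fun [set: mR3 R] (\1_Z : mR3 R -> R) by exact: measurable_indic.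
  apply/measurable_EFinP; apply: (measurableT_comp mI).
  exact: (measurableT_comp (measurable_perm3 i) (measurable_pair1 q)).
- apply: (negligibleS _ n2) => t /=; apply: contra_notP => nt _.
  rewrite indicE memNset// => /Zh tq; apply: nt; rewrite -tq.
  by case: (ger0P t) => _; rewrite ?opprK; [left|right].
Qed.

(** * The competitor is a special function of bounded variation *)

Section CompetitorSBV.
Context {R : realType}.
Variables delta rho : R.
Hypothesis rho1 : rho < 1.
Notation mu := (@lebesgue_measure R).
Notation O := (@ocyl R 1).
Notation v := (competitor delta rho).
Implicit Types (p : R3 R) (q : R * R) (t : R).

(** A null set, larger than the actual jump set but simpler, which serves as the exceptional set of
    the Lebesgue decomposition. *)
Definition jump_carrier : set (R3 R) :=
  [set p | p.1.1 ^+ 2 + p.1.2 ^+ 2 = rho ^+ 2] `|` [set p | `|p.2| = rho] `|`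
  [set p | p.1.2 = 0].

Lemma jump_carrier_null :
  measurable (jump_carrier : set (mR3 R)) /\ leb3 jump_carrier = 0%E.
Proof.
have cl (f : R3 R -> R) (a : R) : continuous f ->
    measurable ([set p | f p = a] : set (mR3 R)).
  move=> cf; apply: closed_measurable3.
  by apply: (@closed_comp _ _ f [set x | x = a]) => [p _|]; [exact: cf|exact: closed_eq].
have sq (f : R3 R -> R) : continuous f -> continuous (fun p => f p ^+ 2).
  by move=> cf p; apply: (@cvgM _ _ _ _ f f); exact: cf.
have m1 : measurable ([set p | p.1.1 ^+ 2 + p.1.2 ^+ 2 = rho ^+ 2] : set (mR3 R)).
  apply: (cl (fun p => p.1.1 ^+ 2 + p.1.2 ^+ 2)) => p; apply: cvgD.
    by apply: (sq (fun p => p.1.1)); exact: continuous_coord1.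
  by apply: (sq (fun p => p.1.2)); exact: continuous_coord2.
have m2 : measurable ([set p | `|p.2| = rho] : set (mR3 R)).
  apply: (cl (fun p => `|p.2|)) => p.
  apply: (@continuous_comp _ _ _ snd (fun x : R => `|x|)); first exact: cvg_snd.
  exact: norm_continuous.
have m3 : measurable ([set p | p.1.2 = 0] : set (mR3 R)).
  by apply: cl; exact: continuous_coord2.
have z1 : leb3 ([set p | p.1.1 ^+ 2 + p.1.2 ^+ 2 = rho ^+ 2] : set (mR3 R)) = 0%E.
  apply: (@leb3_graph _ 0 _ (fun q => Num.sqrt (rho ^+ 2 - q.1 ^+ 2))) => //.
  by move=> q t /= <-; rewrite addrK sqrtr_sqr.
have z2 : leb3 ([set p | `|p.2| = rho] : set (mR3 R)) = 0%E.
  exact: (@leb3_graph _ 2 _ (fun=> rho)).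
have z3 : leb3 ([set p | p.1.2 = 0] : set (mR3 R)) = 0%E.
  by apply: (@leb3_graph _ 1 _ (fun=> 0)) => // q t /= ->; rewrite normr0.
have m12 := measurableU _ _ m1 m2.
split; first exact: measurableU.
apply/eqP; rewrite -measure_le0; apply: (le_trans (measureU2 _ m12 m3)).
rewrite [X in (_ + X)%E]z3 adde0; apply: (le_trans (measureU2 _ m1 m2)).
by rewrite [X in (X + _)%E]z1 [X in (_ + X)%E]z2 adde0.
Qed.

Lemma face_edge i s q : 0 < hw rho i q ->
  (face rho i s q).1.1 ^+ 2 + (face rho i s q).1.2 ^+ 2 = rho ^+ 2 \/
  `|(face rho i s q).2| = rho.
Proof.
have sq : (if s then hw rho i q else - hw rho i q) ^+ 2 = hw rho i q ^+ 2.
  by case: s; rewrite ?sqrrN.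
rewrite /face; move: sq; set t := if s then _ else _; rewrite /hw /hits.
case: (ltnP i 2) => i2; (case: ifP => [|_ _]; last by rewrite ltxx); last first.
  move=> /andP[_ r0] tr _; right; case: i i2 t tr => [|[|i]]//= _ t tr.
  by apply/eqP; rewrite -(eqrXn2 (n := 2))// real_normK ?num_real// tr.
move=> /andP[qr _] ts _; left.
have {}ts : t ^+ 2 = rho ^+ 2 - q.1 ^+ 2 by rewrite ts sqr_sqrtr// subr_ge0.
by case: i i2 t ts => [|[|i]]//= _ t ts; rewrite /= ts; ring.
Qed.

Lemma face_jump_carrier i s q : (0 < hw rho i q) || (i == 1%N) ->
  jump_carrier (face rho i s q).
Proof.
have [h0 _|] := ltrP 0 (hw rho i q).
  by left; case: (face_edge s h0); [left|right].
rewrite le_eqVlt ltNge hw_ge0 orbF => /eqP h0 /= /eqP i1; right.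
by rewrite /face h0 oppr0 if_same i1.
Qed.

Lemma face_ccyl i s q : 0 < hw rho i q ->
  [/\ 0 < rho, ccyl rho (face rho i s q) & ~ ocyl rho (face rho i s q)].
Proof.
move=> h0; have hq : hits rho i q by move: h0; rewrite /hw; case: ifP; rewrite ?ltxx.
have Kf : ccyl rho (face rho i s q).
  apply/ccyl_emb; rewrite hq /=.
  by case: s; rewrite ?normrN ger0_norm// ltW.
have r0 : 0 <= rho by case: Kf => _ h; exact: le_trans h.
have rn0 : rho != 0.
  apply: contraTneq h0 => r0'; rewrite /hw hq -leNgt r0'.
  by case: ifP => // _; rewrite ler0_sqrtr// expr0n sub0r oppr_le0 sqr_ge0.
split => //; first by rewrite lt_neqAle eq_sym rn0.
case: (face_edge s h0) => e []; first by rewrite e ltxx.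
by rewrite e ltxx.
Qed.

Definition face_flux (i : nat) (A : set (mR3 R)) : \bar R :=
  (\int[@leb2 R]_(q in face rho i true @^-1` A) (face_density delta rho i true q)%:E -
   \int[@leb2 R]_(q in face rho i false @^-1` A) (face_density delta rho i false q)%:E)%E.

(** A line contributes nothing in two ways: its faces in [A] have density 0, or its two faces
    coincide with equal densities and cancel. *)
Lemma face_flux0 i (A : set (mR3 R)) : measurable A ->
  {ae @leb2 R, forall q : mR2 R,
    (forall s, A (face rho i s q) -> face_density delta rho i s q = 0) \/
    face rho i true q = face rho i false q /\
    face_density delta rho i true q = face_density delta rho i false q} ->
  face_flux i A = 0%E.
Proof.
move=> mA aeA.
have mF s : measurable (face rho i s @^-1` A).
  by rewrite -[X in measurable X]setTI; exact: measurable_face.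
have ih s : (@leb2 R).-integrable (face rho i s @^-1` A)
    (fun q => (face_density delta rho i s q)%:E).
  by apply: integrableS (integrable_face_density delta rho1 i s).
suff E : (\int[@leb2 R]_(q in face rho i true @^-1` A) (face_density delta rho i true q)%:E =
   \int[@leb2 R]_(q in face rho i false @^-1` A) (face_density delta rho i false q)%:E)%E.
  rewrite /face_flux E subee//; exact: (integrable_fin_num (mF false) (ih false)).
rewrite [LHS]integral_mkcond [RHS]integral_mkcond; apply: ae_eq_integral => //.
- by have /integrableP[+ _] := ih true; move/(measurable_restrictT _ (mF true)).
- by have /integrableP[+ _] := ih false; move/(measurable_restrictT _ (mF false)).
apply: filterS aeA => q [h _|[fE dE] _]; rewrite !patchE; last first.
  suff -> : (q \in face rho i true @^-1` A) = (q \in face rho i false @^-1` A) by rewrite dE.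
  by apply/idP/idP; rewrite !inE /= fE.
have z s : (if q \in face rho i s @^-1` A then (face_density delta rho i s q)%:E else 0%E) = 0%E.
  by case: ifPn => //; rewrite inE => /h ->.
by rewrite (z true) (z false).
Qed.

(** With [hw > 0] the faces lie on the boundary of the cylinder. With [hw = 0] they merge at
    [t = 0]: in direction 1 this point is on the plane [y = 0], in the other directions the two
    densities agree. *)
Lemma face_flux_off_carrier i (A : set (mR3 R)) : measurable A ->
  A `<=` ~` jump_carrier -> face_flux i A = 0%E.
Proof.
move=> mA AN; apply: face_flux0 => //; apply/aeW => q.
have [h|] := boolP ((0 < hw rho i q) || (i == 1%N)).
  by left => s /AN nN; case: nN; exact: face_jump_carrier.
rewrite negb_or -leNgt le_eqVlt ltNge hw_ge0 orbF => /andP[/eqP h0 i1]; right.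
have fE : face rho i true q = face rho i false q by rewrite /face h0 oppr0.
split => //; rewrite /face_density fE.
by congr (_ * _); case: i i1 {h0 fE} => [|[|i]].
Qed.

(** For almost every line, a face with nonzero density on the cylinder is a discontinuity point, as
    is a point of the slit with [x < 0]; for [x >= 0] the two branches agree. The discarded lines
    are those with a coordinate 0, where a face may lie on the plane [y = 0], and those with
    [q.1 = rho] or [q.1 = - rho], which in direction 1 can touch the cylinder with width 0. *)
Lemma face_flux_off_disc i (A : set (mR3 R)) : measurable A ->
  A `<=` O `\` disc_set O v -> face_flux i A = 0%E.
Proof.
move=> mA AO; apply: face_flux0 => //.
apply: filterS3 (leb2_fst 0) (leb2_snd 0) _; last first.
  by apply: filterI; [exact: (leb2_fst rho)|exact: (leb2_fst (- rho))].
move=> q q1 q2 [qr qr'].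
have [h0|] := ltrP 0 (hw rho i q).
  left=> s Af; have [Of nd] := AO _ Af; apply/eqP/negPn/negP => d0.
  have [r0 Kf nf] := face_ccyl s h0.
  apply: nd; apply: face_discontinuity => //.
    rewrite /face; case: (i) h0 => [|[|j]] //= h0.
    by case: s {Af Of Kf nf d0}; rewrite ?oppr_eq0 gt_eqF.
  move: d0; rewrite /face_density mulf_eq0 negb_or => /andP[_].
  by rewrite /face -uside_sign//; case: (s); rewrite ?oppr_lt0.
rewrite le_eqVlt ltNge hw_ge0 orbF => /eqP h0.
have [i1|i1] := eqVneq i 1%N; last first.
  right; have fE : face rho i true q = face rho i false q by rewrite /face h0 oppr0.
  split => //; rewrite /face_density fE.
  by congr (_ * _); case: i i1 {h0 fE} => [|[|i]].
have fE s : face rho i s q = ((q.1, 0), q.2) by rewrite /face h0 oppr0 if_same i1.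
have nK : ~ ccyl rho ((q.1, 0), q.2).
  move=> K0; have /ccyl_emb/andP[hq _] : ccyl rho (emb 1 q 0) by [].
  have /andP[qr1 qr2] := hq; have r0 : 0 <= rho by exact: le_trans qr2.
  move: h0; rewrite i1 /hw hq /= => /eqP; rewrite sqrtr_eq0 subr_le0 => qr3.
  have /eqP : q.1 ^+ 2 = rho ^+ 2 by apply/le_anti/andP.
  by rewrite eqf_sqr (negbTE qr) (negbTE qr').
have [x0|x0] := ltrP q.1 0.
  left=> s; rewrite fE => /AO[Of nd]; case: nd; exact: slit_discontinuity.
right; rewrite !fE; split => //; rewrite /face_density !fE i1 /uside /uup /ulo /wup /=.
by rewrite /prad expr0n addr0 sqrtr_sqr ger0_norm// subrr mul0r sqrtr0 oppr0.
Qed.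

Definition competitor_grad p (i : 'I_3) : R :=
  \1_(~` ccyl rho) p * crack_grad delta p i.

Lemma competitor_grad_sqr p : \sum_(i < 3) competitor_grad p i ^+ 2 =
  \1_(~` ccyl rho) p * \sum_(i < 3) crack_grad delta p i ^+ 2.
Proof.
rewrite mulr_sumr; apply: eq_bigr => i _; rewrite exprMn; congr (_ * _).
by rewrite indicE; case: (_ \in _); rewrite ?expr1n ?expr0n.
Qed.

(** The face flux vanishes off a null set, which identifies the absolutely continuous part, and off
    the discontinuity set, which excludes a Cantor part. *)
Lemma competitor_SBV : SBV O v /\ exists2 D : 'I_3 -> {charge set (mR3 R) -> \bar R},
  is_distr_deriv O v D & is_ac_density O D competitor_grad.
Proof.
have [D DP] := choice (fun i => competitor_charge delta rho1 i).
have DE i A : measurable A -> A `<=` O -> (D i A =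
    \int[@leb3 R]_(p in A) (competitor_grad p i)%:E + face_flux i A)%E.
  by have [h _] := DP i; exact: h.
have dD : is_distr_deriv O v D by move=> i phi tphi; have [_ h] := DP i; exact: h.
have [mN N0] := jump_carrier_null.
have ig i : (@leb3 R).-integrable O (fun p => (competitor_grad p i)%:E).
  apply: (integrableM_bounded (C := 1)).
  - exact: measurable_ocyl.
  - exact: integrable_crack_grad.
  - apply: measurable_indic; apply: measurableC; exact: measurable_ccyl.
  - by move=> p _; rewrite indicE; case: (_ \in _); rewrite ?normr1 ?normr0.
have ac : is_ac_density O D competitor_grad.
  split; first exact: ig.
  exists jump_carrier; split => // i A mA AO.
  have mAC : measurable (A `\` jump_carrier) by exact: measurableD.
  have AC : A `\` jump_carrier `<=` O by move=> p [/AO].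
  have igA : (@leb3 R).-integrable A (fun p => (competitor_grad p i)%:E).
    by apply: integrableS (ig i) => //; exact: measurable_ocyl.
  rewrite (chargeDI (D i) mA mN) (DE i _ mAC AC) face_flux_off_carrier ?adde0//.
  by rewrite -(negligible_integral mN mA igA N0).
split; last by exists D.
split; first exact: integrable_competitor.
exists D, competitor_grad; split => // i A mA AO.
rewrite DE//; last by move=> p /AO[].
by rewrite face_flux_off_disc// adde0.
Qed.
End CompetitorSBV.

(** * Uniqueness of the distributional derivative *)

Section SmoothFunctions.
Context {R : realType}.
Implicit Types (f g : R3 R -> R) (p v : R3 R) (t : R).

Definition C1 f : Prop := continuous f /\ forall i : 'I_3,
  exists2 df : R3 R -> R, continuous df & forall p, is_derive p (basis_vec i) f (df p).

Lemma is_derive_lineP f p v (d : R) :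
  is_derive p v f d <-> is_derive (0 : R) (1 : R) (fun h => f (h *: v + p)) d.
Proof.
have E : (fun h : R => h^-1 *: (f (h *: v + p) - f p)) =
    (fun h : R => h^-1 *: (f ((h *: (1 : R) + 0) *: v + p) - f (0 *: v + p))).
  apply/funext => h.
  by rewrite addr0 scale0r add0r /GRing.scale/= mulr1.
split=> -[dd dv]; split.
- by rewrite /derivable -E.
- by rewrite -dv /derive E.
- by rewrite /derivable E.
- by rewrite -dv /derive E.
Qed.

Lemma C1_comp (h dh : R -> R) f : continuous dh ->
  (forall t, is_derive t (1 : R) h (dh t)) -> C1 f -> C1 (h \o f).
Proof.
move=> cdh hd [cf df].
have ch : continuous h.
  by move=> t; apply/differentiable_continuous/derivable1_diffP; have [] := hd t.
split; first by move=> p; apply: continuous_comp; [exact: cf|exact: ch].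
move=> i; have [d cd dd] := df i.
exists (fun p => dh (f p) * d p).
  move=> p; apply: cvgM; last exact: cd.
  by apply: (@continuous_comp _ _ _ f dh); [exact: cf|exact: cdh].
move=> p; apply/is_derive_lineP.
have /is_derive_lineP d1 := dd p.
have d2 : is_derive (f (0 *: (basis_vec i : R3 R) + p)) (1 : R) h (dh (f p)).
  by rewrite scale0r add0r.
have := is_derive1_comp d2 d1; rewrite /GRing.scale/= => H; exact: H.
Qed.

Lemma C1_cst (c : R) : C1 (cst c).
Proof.
split; first by move=> p; exact: cvg_cst.
by move=> i; exists (cst 0) => [p|p]; [exact: cvg_cst|exact: is_derive_cst].
Qed.

Lemma C1M f g : C1 f -> C1 g -> C1 (f \* g).
Proof.
move=> [cf df] [cg dg]; split; first by move=> p; apply: cvgM; [exact: cf|exact: cg].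
move=> i; have [d cd dd] := df i; have [e ce de] := dg i.
exists (fun p => f p *: e p + g p *: d p) => [p|p].
  by apply: cvgD; apply: cvgM; [exact: cf|exact: ce|exact: cg|exact: cd].
exact: (is_deriveM (dd p) (de p)).
Qed.

Lemma C1B f g : C1 f -> C1 g -> C1 (f \- g).
Proof.
move=> [cf df] [cg dg]; split; first by move=> p; apply: cvgB; [exact: cf|exact: cg].
move=> i; have [d cd dd] := df i; have [e ce de] := dg i.
exists (fun p => d p - e p) => [p|p]; first by apply: cvgB; [exact: cd|exact: ce].
exact: (is_deriveB (dd p) (de p)).
Qed.

Lemma C1_affine f (c : 'I_3 -> R) : continuous f ->
  (forall i p h, f (h *: (basis_vec i : R3 R) + p) = f p + h * c i) -> C1 f.
Proof.
move=> cf fE; split => // i; exists (cst (c i)) => [p|p]; first exact: cvg_cst.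
apply/is_derive_lineP; rewrite (_ : (fun _ => _) = fun h => f p + h * c i); last first.
  by apply/funext => h.
by apply: is_derive_eq; rewrite /GRing.scale/=; ring.
Qed.

Lemma C1_coord1 : C1 (fun p : R3 R => p.1.1).
Proof.
apply: (@C1_affine _ (fun i => (i == 0 :> nat)%:R)); first exact: continuous_coord1.
by move=> i p h; rewrite addrC.
Qed.

Lemma C1_coord2 : C1 (fun p : R3 R => p.1.2).
Proof.
apply: (@C1_affine _ (fun i => (i == 1 :> nat)%:R)); first exact: continuous_coord2.
by move=> i p h; rewrite addrC.
Qed.

Lemma C1_coord3 : C1 (fun p : R3 R => p.2).
Proof.
apply: (@C1_affine _ (fun i => (i == 2 :> nat)%:R)); first exact: continuous_coord3.
by move=> i p h; rewrite addrC.
Qed.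

(** Of class C^1 only, which is all the regularity asked of a test function; it replaces the usual
    smooth cut-off. *)
Definition sqpos t : R := Num.max 0 t ^+ 2.

Lemma is_derive_sqpos t : is_derive t (1 : R) sqpos (2 * Num.max 0 t).
Proof.
(* A quadratic bound on the remainder, uniform in the signs of [t] and [h + t], gives the derivative
   also at 0. *)
have key h : `|sqpos (h + t) - sqpos t - h * (2 * Num.max 0 t)| <= h ^+ 2.
  rewrite /sqpos; rewrite ler_norml.
  have q := sqr_ge0 (h + t); have q' := sqr_ge0 t; have q'' := sqr_ge0 h.
  have [t0|t0] := leP 0 t; have [h0|h0] := leP 0 (h + t); apply/andP; split;
    rewrite ?expr0n/= ?mulr0 ?subr0 ?sub0r; by nra.
have lim : h^-1 *: (sqpos (h *: (1 : R) + t) - sqpos t) @[h --> 0^'] --> 2 * Num.max 0 t.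
  apply/cvgrPdist_le => e e0; near=> h.
  have h0 : h != 0 by near: h; exact: nbhs_dnbhs_neq.
  have he : `|h| <= e.
    near: h; apply: dnbhs0_le; exact: e0.
  rewrite /GRing.scale/= mulr1.
  have -> : 2 * Num.max 0 t - h^-1 * (sqpos (h + t) - sqpos t) =
      - (h^-1 * (sqpos (h + t) - sqpos t - h * (2 * Num.max 0 t))).
    by field.
  rewrite normrN normrM normfV; apply: le_trans he.
  by rewrite ler_pdivrMl ?normr_gt0// -expr2 real_normK ?num_real.
split; last exact: (cvg_lim _ lim).
by apply/cvg_ex; exists (2 * Num.max 0 t).
Unshelve. all: by end_near. Qed.

Lemma C1_sqpos f : C1 f -> C1 (sqpos \o f).
Proof.
apply: (@C1_comp _ (fun t => 2 * Num.max 0 t)) is_derive_sqpos => t.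
apply: cvgM; first exact: cvg_cst.
by apply: continuous_max; [exact: cvg_cst|exact: cvg_id].
Qed.

Lemma sqpos_ge0 t : 0 <= sqpos t. Proof. exact: sqr_ge0. Qed.

Lemma sqpos_eq0 t : (sqpos t == 0) = (t <= 0).
Proof. by rewrite sqrf_eq0 eq_le ge_max lexx/= le_max lexx andbT. Qed.

(* Vanishes on [t <= 1], so that [bump (n * q ^+ 2)] is supported in the compact
   set [1 <= n * q ^+ 2] as soon as [q] vanishes off a bounded open set. *)
Definition bump t : R := 1 - (1 + sqpos (t - 1))^-1.

Lemma bump_itv t : 0 <= bump t <= 1.
Proof.
have h := sqpos_ge0 (t - 1); rewrite /bump lerBlDr lerDl subr_ge0 invr_ge0.
by rewrite invf_le1 ?lerDl ?h ?addr_ge0//= ltr_pwDl.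
Qed.

Lemma bump0 t : t <= 1 -> bump t = 0.
Proof.
by move=> t1; rewrite /bump (eqP (_ : sqpos (t - 1) == 0)) ?addr0 ?invr1 ?subrr ?sqpos_eq0 ?subr_le0.
Qed.

Lemma bump_dist t : 0 < t -> `|1 - bump t| <= 2 / t.
Proof.
move=> t0; have h := sqpos_ge0 (t - 1).
rewrite /bump opprB addrCA subrr addr0 ger0_norm ?invr_ge0 ?addr_ge0//.
rewrite -[2 / t]invf_div lef_pV2 ?posrE ?divr_gt0 ?ltr_pwDl//.
(* For [t >= 1] the claim [t / 2 <= 1 + (t - 1) ^ 2] follows by completing the square at [5 / 4]. *)
rewrite /sqpos; have [t1|t1] := leP 0 (t - 1); last by rewrite expr0n/=; lra.
have := sqr_ge0 (t - 5 / 4); nra.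
Qed.

Lemma C1_bump f : C1 f -> C1 (bump \o f).
Proof.
move=> Cf; have Cs := C1_sqpos (C1B Cf (C1_cst 1)).
have [cs ds] := Cs.
have s0 p : 1 + sqpos (f p - 1) != 0 by rewrite gt_eqF// ltr_pwDl ?sqpos_ge0.
have E : bump \o f = (cst 1 : R3 R -> R) \- (fun p => (1 + sqpos (f p - 1))^-1).
  by apply/funext.
have Cd : C1 (fun p => 1 + sqpos (f p - 1)).
  by have := C1B (C1_cst 1) (C1M (C1_cst (-1)) Cs);
    congr C1; apply/funext => p /=; rewrite mulN1r opprK.
rewrite E; apply: C1B; first exact: C1_cst.
have [cd dd] := Cd; split.
  by move=> p; apply: cvgV; [exact: s0|exact: cd].
move=> i; have [e ce de] := dd i.
exists (fun p => - (1 + sqpos (f p - 1)) ^- 2 *: e p) => [p|p]; last first.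
  have [dp <-] := de p.
  split; [exact: derivableV|exact: deriveV].
apply: cvgM; last exact: ce.
apply: cvgN; apply: cvgV; first by rewrite expf_neq0.
by apply: (@cvgM _ _ _ _ (fun p => 1 + sqpos (f p - 1)) (fun p => 1 + sqpos (f p - 1))); exact: cd.
Qed.
End SmoothFunctions.

(** * Approximation of indicators by test functions *)

Section CutOff.
Context {R : realType}.
Notation O := (@ocyl R 1).
Implicit Types (f : R3 R -> R) (p : R3 R).

Definition cutoff p : R :=
  sqpos (1 - (p.1.1 * p.1.1 + p.1.2 * p.1.2)) * sqpos (1 - p.2 * p.2).

Lemma C1_cutoff : C1 cutoff.
Proof.
have D f g : C1 f -> C1 g -> C1 (fun p : R3 R => 1 - (f p * f p + g p * g p)).
  move=> Cf Cg.
  have := C1B (C1B (C1_cst 1) (C1M Cf Cf)) (C1M Cg Cg).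
  by congr C1; apply/funext => p /=; rewrite opprD addrA.
apply: (@C1M _ (sqpos \o (fun p => 1 - (p.1.1 * p.1.1 + p.1.2 * p.1.2)))
  (sqpos \o (fun p => 1 - p.2 * p.2))); apply: C1_sqpos.
  by apply: D; [exact: C1_coord1|exact: C1_coord2].
by apply: C1B; [exact: C1_cst|apply: C1M; exact: C1_coord3].
Qed.

Lemma cutoff_neq0 p : cutoff p != 0 <-> O p.
Proof.
rewrite mulf_eq0 negb_or !sqpos_eq0 -!ltNge !subr_gt0 -!expr2 /ocyl /= expr1n.
have -> : (p.2 ^+ 2 < 1) = (`|p.2| < 1).
  by rewrite -(real_normK (num_real p.2)) expr_lt1.
by split => [/andP|[-> ->]].
Qed.

(** Tends to the indicator of the set where [f] is nonzero, within the domain; squaring admits [f]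
    of either sign. *)
Definition approx_fun f (n : nat) p : R := bump (n%:R * ((f p * cutoff p) * (f p * cutoff p))).

Lemma test_fun_approx f n : C1 f -> test_fun O (approx_fun f n).
Proof.
move=> Cf; have Cq : C1 (fun p => n%:R * ((f p * cutoff p) * (f p * cutoff p))).
  have Cfc := C1M Cf C1_cutoff.
  exact: (C1M (C1_cst n%:R) (C1M Cfc Cfc)).
have [cphi dphi] := C1_bump Cq.
pose S := [set p : R3 R | 1 <= n%:R * ((f p * cutoff p) * (f p * cutoff p))].
have cS : closed S.
  apply: (@closed_comp _ _ (fun p => n%:R * ((f p * cutoff p) * (f p * cutoff p)))
    [set x | 1 <= x]); last exact: closed_ge.
  by move=> p _; case: Cq => + _; exact.
have SO : S `<=` O.
  move=> p Sp; apply/cutoff_neq0; apply: contraTneq Sp => c0.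
  by rewrite /S/= c0 !mulr0 -ltNge.
have suppS : closure [set p | approx_fun f n p != 0] `<=` S.
  rewrite [X in _ `<=` X](closure_id S).1//; apply: closure_subset => p /=.
  by apply: contraTT => pS; rewrite negbK /approx_fun bump0// ltW// ltNge.
split.
- exact: cphi.
- by move=> i p; have [d _ /(_ p)[]] := dphi i.
- move=> i; have [d cd dd] := dphi i.
  rewrite (_ : 'D_(basis_vec i) (approx_fun f n) = d)//.
  by apply/funext => p; have [_] := dd p.
- have cI : compact (`[-1, 1]%classic `*` `[-1, 1]%classic `*` `[-1, 1]%classic : set (R3 R)).
    by do 2 (apply: compact_setX; last exact: segment_compact); exact: segment_compact.
  apply: (subclosed_compact _ cI); first exact: closed_closure.
  move=> p /suppS/SO/ocyl1_cube[]; rewrite /= !subr0 => /ltW h1 /ltW h2 /ltW h3.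
  by rewrite !in_itv/= -!ler_norml.
- exact: subset_trans SO.
Qed.

Lemma approx_fun_itv f n p : 0 <= approx_fun f n p <= 1.
Proof. exact: bump_itv. Qed.

Lemma approx_fun_cvg f p :
  approx_fun f n p @[n --> \oo] --> (\1_([set p | f p != 0] `&` O) p : R).
Proof.
set q := f p * cutoff p.
have -> : \1_([set p | f p != 0] `&` O) p = (q != 0)%:R :> R.
  rewrite indicE mulf_eq0 negb_or; congr (_ %:R); congr nat_of_bool.
  apply/idP/idP => [|/andP[f0 c0]]; rewrite inE /=.
    by move=> [-> /cutoff_neq0].
  by split => //; apply/cutoff_neq0.
have [q0|q0] := eqVneq q 0.
  rewrite (_ : (fun n => _) = cst 0); first exact: cvg_cst.
  by apply/funext => n; rewrite /approx_fun -/q q0 !mulr0 bump0.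
have qq : 0 < q * q by rewrite -expr2 lt_neqAle eq_sym sqrf_eq0 q0 sqr_ge0.
apply/cvgrPdist_le => e e0; near=> n.
have n0 : 0 < n%:R :> R by rewrite ltr0n; near: n; exact: nbhs_infty_gt.
have nq : 0 < n%:R * (q * q) by rewrite mulr_gt0.
apply: (le_trans (bump_dist nq)); rewrite ler_pdivrMr//.
have : 2 / (e * (q * q)) <= n%:R by near: n; exact: nbhs_infty_ger.
have eq0 : 0 < e * (q * q) by exact: mulr_gt0.
by rewrite ler_pdivrMr// => h; rewrite mulrCA.
Unshelve. all: by end_near. Qed.

Lemma charge_integral_approx (D : {charge set (mR3 R) -> \bar R}) f : C1 f ->
  charge_integral D (approx_fun f n) @[n --> \oo] --> D ([set p | f p != 0] `&` O).
Proof.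
move=> Cf; have [m1 [m2 DE]] := charge_jordan D.
set U : set (mR3 R) := [set p | f p != 0] `&` O.
have mU : measurable U.
  apply: open_measurable3; apply: openI; last exact: open_ocyl.
  by apply: (@open_comp _ _ f [set x | x != 0]) => [p _|]; [case: Cf => + _; exact|exact: open_neq].
have ma n : measurable_fun [set: mR3 R] (approx_fun f n).
  by apply: continuous_measurable3; have [] := test_fun_approx n Cf.
have a1 n p : `|approx_fun f n p| <= 1.
  by have /andP[h0 h1] := approx_fun_itv f n p; rewrite ger0_norm.
have lim (m : {finite_measure set (mR3 R) -> \bar R}) :
    (\int[m]_p (approx_fun f n p)%:E @[n --> \oo] --> m U)%E.
  have <- : (\int[m]_p (\1_U p)%:E = m U)%E.
    by rewrite integral_indic// setIT.
  apply: (@dominated_cvg _ _ _ m setT measurableT (fun n p => (approx_fun f n p)%:E) _ (cst 1%E)) => //.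
  - by move=> n; apply/measurable_EFinP.
  - by move=> p _; apply: cvg_EFin; [exact: nearW|exact: approx_fun_cvg].
  - apply: (@bounded_integrable _ _ _ m (cst 1) 1) => //; first exact: finite_measureT.
    by move=> p; rewrite normr1.
  - by move=> n p _; rewrite lee_fin.
rewrite DE//.
rewrite (_ : (fun n => _) = fun n => (\int[m1]_p (approx_fun f n p)%:E -
    \int[m2]_p (approx_fun f n p)%:E)%E); last first.
  by apply/funext => n; apply: (charge_integral_diff (finite_measureT m1) (finite_measureT m2) DE (ma n) (a1 n)).
apply: cvgeB; [|exact: lim|exact: lim].
by rewrite fin_num_adde_defl// fin_numN fin_num_measure.
Qed.

End CutOff.

(** * A charge on the domain is determined by test functions *)

Section ChargeUniqueness.
Context {R : realType}.
Notation O := (@ocyl R 1).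
Implicit Types (f : R3 R -> R) (p : R3 R) (A : set (mR3 R)).

Definition cozero : set (set (mR3 R)) :=
  [set A | exists2 f : R3 R -> R, C1 f & A = [set p | f p != 0]].

Lemma cozero_gt f (a : R) : C1 f -> cozero [set p | a < f p].
Proof.
move=> Cf; exists (sqpos \o (f \- cst a)).
  by apply: C1_sqpos; apply: C1B => //; exact: C1_cst.
by apply/seteqP; split => p /=; rewrite sqpos_eq0 -ltNge subr_gt0.
Qed.

Lemma cozero_measurable : cozero `<=` measurable.
Proof.
move=> _ [f [cf _] ->]; apply: open_measurable3.
by apply: (@open_comp _ _ f [set x | x != 0]) => [p _|]; [exact: cf|exact: open_neq].
Qed.

(** The coordinates are C^1 and the sets [{a < f}] are cozero sets of C^1 functions, so the identity
    is measurable from the generated sigma-algebra to the Borel one. *)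
Lemma measurable_cozero A : measurable A -> <<s cozero >> A.
Proof.
move=> mA; pose T := g_sigma_algebraType cozero.
have mC (f : R3 R -> R) : C1 f -> measurable_fun [set: T] (f : T -> measurableTypeR R).
  move=> Cf; apply: (measurability _ (RGenOInfty.measurableE R)).
  move=> _ [_ [a ->] <-]; rewrite setTI; apply: sub_sigma_algebra.
  have := cozero_gt a Cf; congr cozero.
  by apply/seteqP; split => p /=; rewrite in_itv/= andbT.
have mid : measurable_fun [set: T] (fun p : T => ((p.1.1, p.1.2), p.2) : mR3 R).
  apply: measurable_fun_pair; first apply: measurable_fun_pair.
  - exact: mC C1_coord1.
  - exact: mC C1_coord2.
  - exact: mC C1_coord3.
have := mid measurableT A mA; rewrite setTI; congr (measurable _).
by apply/seteqP; split => -[[x y] z].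
Qed.

(** By dominated convergence the charges agree on cozero sets cut by the domain. These are stable
    under intersection, through the product of the functions. Moving the negative parts across turns
    the claim into an equality of measures, to which uniqueness on a generating pi-system
    applies. *)
Lemma charge_unique (D D' : {charge set (mR3 R) -> \bar R}) :
  (forall phi, test_fun O phi -> charge_integral D phi = charge_integral D' phi) ->
  forall A, measurable A -> A `<=` O -> D A = D' A.
Proof.
move=> DD' A mA AO.
have DU f : C1 f -> D ([set p | f p != 0] `&` O) = D' ([set p | f p != 0] `&` O).
  move=> Cf; have h := charge_integral_approx (D := D) Cf.
  have h' := charge_integral_approx (D := D') Cf.
  have E : (fun n => charge_integral D (approx_fun f n)) =
      (fun n => charge_integral D' (approx_fun f n)).
    by apply/funext => n; apply: DD'; exact: test_fun_approx.
  move: h; rewrite E => /(cvg_lim (@ereal_hausdorff R)) <-.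
  exact: (cvg_lim (@ereal_hausdorff R) h').
have [m1 [m2 DE]] := charge_jordan D; have [m3 [m4 D'E]] := charge_jordan D'.
have mO : measurable (O : set (mR3 R)) by exact: measurable_ocyl.
have cross B : measurable B -> D B = D' B <-> (m1 B + m4 B = m3 B + m2 B)%E.
  move=> mB; rewrite DE// D'E//.
  rewrite -(fineK (fin_num_measure m1 B mB)) -(fineK (fin_num_measure m2 B mB)).
  rewrite -(fineK (fin_num_measure m3 B mB)) -(fineK (fin_num_measure m4 B mB)).
  by rewrite -!EFinB -!EFinD; split => -[e]; congr EFin; lra.
have mX A' : measurable A' -> (mrestr (measure_add m1 m4) mO A' =
    mrestr (measure_add m3 m2) mO A')%E.
  move=> mA'; have := measurable_cozero mA'.
  apply: (@g_sigma_algebra_measure_unique _ R (mR3 R) cozero cozero_measurable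
    (fun=> setT)).
  - by move=> _; exists (cst 1); [exact: C1_cst|apply/seteqP; split => p //= _; rewrite oner_neq0].
  - by apply/seteqP; split => // p _; exists 0%N.
  - move=> _ _ [f Cf ->] [g Cg ->]; exists (f \* g); first exact: C1M.
    by apply/seteqP; split => p /=; rewrite mulf_eq0 negb_or => /andP.
  - move=> _ [f Cf ->]; rewrite /mrestr [LHS]measure_addE [RHS]measure_addE.
    by apply/cross; [apply: measurableI => //; apply: cozero_measurable; exists f|exact: DU].
  - move=> _; rewrite /mrestr [ltLHS]measure_addE.
    have mTO := measurableI _ _ measurableT mO.
    by rewrite lte_add_pinfty// -ge0_fin_numE// fin_num_measure.
apply/cross => //; have := mX A mA; rewrite /mrestr [LHS]measure_addE [RHS]measure_addE.
by rewrite setIidl.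
Qed.

(** Off the union of the two exceptional null sets the singular terms disappear, so both densities
    have the same integral over every measurable subset. *)
Lemma ac_density_unique u (D D' : 'I_3 -> {charge set (mR3 R) -> \bar R}) g g' :
  is_distr_deriv O u D -> is_distr_deriv O u D' ->
  is_ac_density O D g -> is_ac_density O D' g' ->
  forall i, ae_eq (@leb3 R) O (fun p => (g p i)%:E) (fun p => (g' p i)%:E).
Proof.
move=> dD dD' [ig [N [mN N0 gE]]] [ig' [N' [mN' N'0 gE']]] i.
have mO : measurable (O : set (mR3 R)) by exact: measurable_ocyl.
have DD' A : measurable A -> A `<=` O -> D i A = D' i A.
  apply: charge_unique => phi tphi; apply: oppe_inj.
  by rewrite -dD// -dD'.
have mNN := measurableU _ _ mN mN'.
have mOD := measurableD mO mNN.
have sO : O `\` (N `|` N') `<=` O by move=> p [].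
have : ae_eq (@leb3 R) (O `\` (N `|` N')) (fun p => (g p i)%:E) (fun p => (g' p i)%:E).
  apply: integral_ae_eq => //.
  - exact: integrableS (ig i).
  - by apply: (measurable_funS mO sO); case/integrableP: (ig' i).
  move=> E EO mE; have EO' : E `<=` O by move=> p /EO[].
  have c0 (C : {charge set (mR3 R) -> \bar R}) (M : set (mR3 R)) :
      M `<=` N `|` N' -> C (E `&` M) = 0%E.
    move=> MN; rewrite (_ : E `&` M = set0) ?charge0//.
    by apply/seteqP; split => // p [/EO[_ nN] /MN].
  have := DD' E mE EO'; rewrite gE// gE'// !c0 ?adde0//.
have nN : (@leb3 R).-negligible (N `|` N').
  exists (N `|` N'); split => //; apply/eqP; rewrite -measure_le0.
  apply: (le_trans (measureU2 _ mN mN')).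
  by rewrite [X in (X + _)%E]N0 [X in (_ + X)%E]N'0 adde0.
move=> [Z [mZ Z0 hZ]]; apply: (negligibleS _ (negligibleU (ex_intro _ Z (And3 mZ Z0 (@subset_refl _ Z))) nN)).
move=> p /= /not_implyP[Op ne]; have [|nNp] := pselect ((N `|` N') p); first by right.
by left; apply: hZ => /= h; apply: ne; apply: h.
Qed.

(** [approx_grad] is a chosen density; by uniqueness its energy is that of any explicit one. *)
Lemma approx_gradE u (D : 'I_3 -> {charge set (mR3 R) -> \bar R}) g :
  is_distr_deriv O u D -> is_ac_density O D g ->
  (\int[@leb3 R]_(p in O) (\sum_(i < 3) approx_grad O u p i ^+ 2)%:E =
   \int[@leb3 R]_(p in O) (\sum_(i < 3) g p i ^+ 2)%:E)%E.
Proof.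
move=> dD ac; have [D' dD' ac'] : exists2 D, is_distr_deriv O u D & is_ac_density O D (approx_grad O u).
  by apply: (@xgetPex _ (fun _ _ => 0) [set g | exists2 D, is_distr_deriv O u D & is_ac_density O D g]); exists g, D.
have ae := ac_density_unique dD' dD ac' ac.
have mO : measurable (O : set (mR3 R)) by exact: measurable_ocyl.
have ms h : (forall i : 'I_3, (@leb3 R).-integrable O (fun p => (h p i)%:E)) ->
    measurable_fun (O : set (mR3 R)) (fun p => (\sum_(i < 3) h p i ^+ 2)%:E).
  move=> ih; apply/measurable_EFinP; apply: measurable_sum => i.
  by apply: measurable_funX; apply/measurable_EFinP; case/integrableP: (ih i).
apply: ae_eq_integral => //.
- by apply: ms; case: ac'.
- by apply: ms; case: ac.
have := ae ord0; have := ae (inord 1); have := ae (inord 2).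
apply: filterS3 => p h2 h1 h0 Op; congr EFin; apply: eq_bigr => -[[|[|[|//]]]] k _.
- by case: (h0 Op) => e; congr (_ ^+ 2); rewrite (_ : Ordinal k = ord0)//; exact: val_inj.
- by case: (h1 Op) => e; congr (_ ^+ 2); rewrite (_ : Ordinal k = inord 1)//; apply: val_inj; rewrite /= inordK.
- by case: (h2 Op) => e; congr (_ ^+ 2); rewrite (_ : Ordinal k = inord 2)//; apply: val_inj; rewrite /= inordK.
Qed.

End ChargeUniqueness.

(** * Energy comparison *)

Lemma interior_cylinder {R : realType} : interior (@cylinder R) = ocyl 1.
Proof.
apply/seteqP; split => p; last first.
  move=> Op; have : nbhs p (ocyl 1) by apply: open_nbhs_nbhs; split=> //; exact: open_ocyl.
  apply: filterS => q [h1 h2]; rewrite expr1n in h1.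
  by split => //; rewrite -ler_norml ltW.
move=> /eball_nbhs[d d0 pd].
(* Only the vertical condition is not open; moving [p] up and down by [d / 2] inside the cylinder
   makes it strict. *)
have inC (s : R) : `|s| = 1 -> cylinder (p + ((0, 0), s * (d / 2))).
  move=> s1; apply: pd; rewrite /eball/= addrAC subrr add0r.
  apply: (@le_lt_trans _ _ (d / 2)); last by lra.
  apply: enorm_le; first by lra.
  by rewrite /= expr0n/= !add0r exprMn -(real_normK (num_real s)) s1 expr1n mul1r.
have [h1 h2] := inC 1 (normr1 _); have [_ h3] : cylinder (p + ((0, 0), -1 * (d / 2))).
  by apply: inC; rewrite normrN normr1.
rewrite /= !addr0 in h1 h2 h3; split; rewrite ?expr1n// ltr_norml.
by apply/andP; split; lra.
Qed.

Section Energies.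
Context {R : realType}.
Variables delta rho : R.
Hypothesis rho1 : rho < 1.
Notation O := (@ocyl R 1).
Notation v := (competitor delta rho).
Notation S := (fun p => (\sum_(i < 3) crack_grad delta p i ^+ 2)%:E).
Implicit Types (p : R3 R).

Lemma competitor_energy : (energy O v =
  \int[@leb3 R]_(p in O) ((\1_(~` ccyl rho) p)%:E * S p) + hausdorff2 (disc_set O v))%E.
Proof.
have [_ [D dD ac]] := competitor_SBV delta rho1.
rewrite /energy (approx_gradE dD ac); congr (_ + _)%E.
by apply: eq_integral => p _; rewrite competitor_grad_sqr.
Qed.

(** The indicators of the complement of the closed cylinder and of the open cylinder have sum at
    most 1. *)
Lemma competitor_grad_energy : 0 < rho ->
  (\int[@leb3 R]_(p in O) ((\1_(~` ccyl rho) p)%:E * S p) <=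
   (2 + 2 * pi * delta ^+ 2 - (2 * rho ^+ 2 + 2 * pi * delta ^+ 2 * rho ^+ 3))%:E)%E.
Proof.
move=> r0; rewrite EFinB leeBrDr//.
have := crack_energy_ocyl delta (@ltr01 R); rewrite !expr1n !mulr1 => <-.
rewrite -(crack_energy_ocyl delta r0).
have mO (r : R) : measurable (ocyl r : set (mR3 R)) by exact: measurable_ocyl.
have KO : ocyl rho `<=` O.
  by move=> p [h1 h2]; apply: (ccyl_ocyl rho1); split; exact: ltW.
have S0 p : (0 <= S p)%E by rewrite lee_fin sumr_ge0// => i _; exact: sqr_ge0.
have mS : measurable_fun [set: mR3 R] S by exact: measurable_crack_energy.
have mI (A : set (mR3 R)) : measurable A ->
    measurable_fun [set: mR3 R] (fun p => ((\1_A p)%:E * S p)%E).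
  move=> mA; apply: emeasurable_funM => //.
  by apply/measurable_EFinP; exact: measurable_indic.
have mC : measurable (~` ccyl rho : set (mR3 R)).
  by apply: measurableC; exact: measurable_ccyl.
have I0 (A : set (mR3 R)) p : (0 <= (\1_A p)%:E * S p)%E.
  by rewrite mule_ge0// lee_fin.
have -> : (\int[@leb3 R]_(p in ocyl rho) S p =
    \int[@leb3 R]_(p in O) ((\1_(ocyl rho) p)%:E * S p))%E.
  rewrite -(setIidl KO) [LHS]integral_mkcondl; apply: eq_integral => p _.
  rewrite patchE (setIidl KO) indicE.
  by case: (_ \in _); rewrite ?mul1e ?mul0e.
rewrite -ge0_integralD//; try by apply: measurable_funTS; exact: mI.
apply: ge0_le_integral => //.
- by move=> p _; rewrite adde_ge0.
- by apply: measurable_funTS; apply: emeasurable_funD; exact: mI.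
- exact: measurable_funTS.
- move=> p _; rewrite -EFinM -EFinM -EFinD lee_fin -mulrDl ler_piMl//; first exact: S0.
  rewrite !indicE; have [Kp|nKp] := pselect (ccyl rho p).
    by rewrite (memNset (_ : ~ (~` ccyl rho) p)) ?add0r ?lern1; [case: (_ \in _)|apply].
  rewrite (memNset (_ : ~ ocyl rho p)) ?addr0 ?lern1; first by case: (_ \in _).
  by move=> [h1 h2]; apply: nKp; split; exact: ltW.
Qed.

Lemma has_mean_limit_frontier p a : frontier O p ->
  has_mean_limit O v p a <-> has_mean_limit O (u_delta delta) p a.
Proof.
move=> [_]; rewrite ((interior_id O).1 (@open_ocyl R 1)) => nO.
have nK : ~ ccyl rho p by move=> /(ccyl_ocyl rho1).
have [d d0 vu] := competitor_near delta nK.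
have E : \forall r \near 0^'+, mean_dev O v p a r = mean_dev O (u_delta delta) p a r.
  near=> r; rewrite /mean_dev; congr (_ * _)%E; apply: eq_integral => y.
  rewrite inE => -[_ yr]; rewrite vu//; apply: lt_le_trans yr _.
  by near: r; exact: nbhs_right_le.
split; apply: cvg_trans; apply: near_eq_cvg => //.
by move: E; apply: filterS => r ->.
Unshelve. all: by end_near. Qed.

Lemma competitor_trace : same_trace O (u_delta delta) (u_delta delta) ->
  same_trace O v (u_delta delta).
Proof.
rewrite /same_trace => <-; congr hausdorff2; apply/seteqP.
split => p [fp np]; split => // -[a [h1 h2]]; apply: np; exists a; split => //.
exact/has_mean_limit_frontier.
Qed.

End Energies.

(** * Area of the discontinuity sets *)

Section Discontinuity.
Context {R : realType}.
Variables delta rho : R.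
Hypotheses (rho0 : 0 < rho) (rho1 : rho < 1).
Notation O := (@ocyl R 1).
Notation v := (competitor delta rho).
Implicit Types (p : R3 R).

Definition slit (x z a b : R) : set (R3 R) :=
  [set p | [/\ x <= p.1.1 <= x + a, p.1.2 = 0 & z <= p.2 <= z + b]].

Lemma fcost_slit (x z a b : R) : 0 < a -> 0 < b -> fcost (slit x z a b) (a * b).
Proof.
move=> a0 b0; pose f (p : R3 R) : R3 R := ((x + p.1.1, 0), z + p.1.2).
apply: (@fcost_le _ _ (f @` [set p | [/\ 0 <= p.1.1 <= a, 0 <= p.1.2 <= b & p.2 = 0]]) (a * b)) => //.
  move=> -[[y1 y2] y3] [/= h1 h2 h3]; exists ((y1 - x, y3 - z), 0).
    by split => //=; lra.
  by rewrite /f /= h2; congr (_, _, _); lra.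
apply: fcost_image; last exact: fcost_rectangle.
move=> p q _ _; apply: enorm_le; rewrite ?enorm_ge0// enorm_sqr /=.
have -> : x + p.1.1 - (x + q.1.1) = p.1.1 - q.1.1 by ring.
have -> : z + p.1.2 - (z + q.1.2) = p.1.2 - q.1.2 by ring.
by rewrite subr0 expr0n addr0 lerDl sqr_ge0.
Qed.

Lemma fcost_lid (z : R) :
  fcost [set p | p.1.1 ^+ 2 + p.1.2 ^+ 2 <= rho ^+ 2 /\ p.2 = z] (pi * rho ^+ 2).
Proof.
pose f (p : R3 R) : R3 R := (p.1, p.2 + z).
apply: (@fcost_le _ _ (f @` [set p | p.1.1 ^+ 2 + p.1.2 ^+ 2 <= rho ^+ 2 /\ p.2 = 0])
  (pi * rho ^+ 2)) => //.
  move=> -[y1 y2] [/= h1 h2]; exists (y1, 0) => //.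
  by rewrite /f /= h2 add0r.
apply: fcost_image; last exact: fcost_disc.
move=> p q _ _; apply: enorm_le; rewrite ?enorm_ge0// enorm_sqr /=.
by rewrite opprD addrACA subrr addr0.
Qed.

(** Everywhere else the competitor agrees near [p] with a continuous function: 0 inside the
    cylinder, [u_delta] outside it and off the slit. The rest of the slit is enclosed in a strip
    [x <= - rho] of full height and two strips above and below the cylinder, which may overlap the
    first. *)
Lemma disc_set_cover : disc_set O v `<=`
  ([set p | p.1.1 ^+ 2 + p.1.2 ^+ 2 = rho ^+ 2 /\ `|p.2| <= rho] `|`
   ([set p | p.1.1 ^+ 2 + p.1.2 ^+ 2 <= rho ^+ 2 /\ p.2 = rho] `|`
    [set p | p.1.1 ^+ 2 + p.1.2 ^+ 2 <= rho ^+ 2 /\ p.2 = - rho])) `|`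
  (slit (-1) (-1) (1 - rho) 2 `|`
   (slit (-1) rho 1 (1 - rho) `|` slit (-1) (-1) 1 (1 - rho))).
Proof.
move=> p [Op nlim].
have cont : ~ {for p, continuous v}.
  move=> cv; apply: nlim; exists (v p); apply: has_mean_limit_continuous => //.
    exact: open_ocyl.
  exact: measurable_competitor.
have near_cont (g : R3 R -> R) (U : set (R3 R)) : open U -> U p ->
    (forall y, U y -> v y = g y) -> {for p, continuous g} -> {for p, continuous v}.
  move=> oU Up vg cg.
  have E : \forall y \near p, g y = v y.
    by have := open_nbhs_nbhs (conj oU Up); apply: filterS => y /vg.
  apply: (cvg_trans (near_eq_cvg E)).
  by rewrite (vg _ Up); exact: cg.
have [Kp|nKp] := pselect (ccyl rho p); last first.
  right; have [y0|y0] := eqVneq p.1.2 0; last first.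
    case: cont; apply: (near_cont (u_delta delta) (~` ccyl rho)) => //.
    - by apply: closed_openC; exact: closed_ccyl.
    - by move=> y nKy; rewrite /competitor asboolF.
    - by apply: continuous_u_delta; rewrite y0.
  have [x0|x0] := ltrP 0 p.1.1.
    case: cont; apply: (near_cont (u_delta delta) (~` ccyl rho)) => //.
    - by apply: closed_openC; exact: closed_ccyl.
    - by move=> y nKy; rewrite /competitor asboolF.
    - by apply: continuous_u_delta; rewrite x0 orbT.
  have [x1 _ z1] := ocyl1_cube Op; rewrite /= !subr0 !ltr_norml in x1 z1.
  have [xr|xr] := leP p.1.1 (- rho); first by left; split => //; lra.
  right; have [zr|zr] := leP rho p.2; first by left; split => //; lra.
  right; have [zr'|zr'] := leP p.2 (- rho); first by split => //; lra.
  case: nKp; split; last by rewrite ler_norml; lra.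
  by rewrite y0 expr0n addr0/=; nra.
left; have [Kxy Kz] := Kp.
have [nq|nq] := boolP (p.1.1 ^+ 2 + p.1.2 ^+ 2 == rho ^+ 2).
  by left; split => //; apply/eqP.
have [zr|zr] := eqVneq `|p.2| rho.
  right; move: zr; case: (ger0P p.2) => _ zr; [left|right] => //.
  by split => //; rewrite -zr opprK.
case: cont; apply: (near_cont (cst 0) (ocyl rho)); first exact: open_ocyl.
- by split; rewrite lt_neqAle ?nq ?zr.
- move=> y [h1 h2]; rewrite /competitor asboolT//; split; exact: ltW.
- exact: cvg_cst.
Qed.

Lemma hausdorff2_competitor : (hausdorff2 (disc_set O v) <=
  (2 * pi * rho * (2 * rho) + (pi * rho ^+ 2 + pi * rho ^+ 2) +
   ((1 - rho) * 2 + (1 * (1 - rho) + 1 * (1 - rho))))%:E)%E.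
Proof.
have r1 : 0 < 1 - rho by rewrite subr_gt0.
apply: fcost_hausdorff2; apply: fcost_le disc_set_cover (lexx _) _.
apply: fcostU; apply: fcostU.
- exact: fcost_lateral.
- by apply: fcostU; exact: fcost_lid.
- exact: fcost_slit.
- by apply: fcostU; exact: fcost_slit.
Qed.

End Discontinuity.

(** Makes the results on the competitor available for [u_delta]. *)
Lemma competitor_empty {R : realType} (delta : R) : competitor delta (-1) = u_delta delta.
Proof.
apply/funext => p; rewrite /competitor asboolF// => -[_ h].
by have := le_trans (normr_ge0 _) h; lra.
Qed.

Lemma hausdorff2_u_delta {R : realType} (delta : R) :
  (2%:E <= hausdorff2 (disc_set (ocyl 1) (u_delta delta)))%E.
Proof.
have r1 : (-1 : R) < 1 by lra.
pose S : set (mR2 R) := `]-1, 0[%classic `*` `]-1, 1[%classic.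
have -> : 2%:E = leb2 S.
  rewrite [RHS]product_measure1E//= !lebesgue_measure_itv/= !lte_fin ltrN10 r1.
  by rewrite -!EFinB -EFinM; congr EFin; ring.
apply: hausdorff2_slit; first exact: measurableX.
move=> x z [/=]; rewrite !in_itv/= => hx hz.
rewrite -(competitor_empty delta); apply: slit_discontinuity => //=; last by case/andP: hx.
  split; rewrite /= ?ltr_norml// expr0n addr0 expr1n; nra.
by move=> [_ /=] h; have := le_trans (normr_ge0 _) h; lra.
Qed.

Theorem proposition1p1 (R : realType) (delta : R) :
  Num.sqrt (3 - 2 / pi) < delta ->
  ~ is_minimizer (interior cylinder) (u_delta delta) (u_delta delta).
Proof.
rewrite interior_cylinder => hd [[_ tr] hmin].
have pi0 := pi_gt0 R; have pi2 := pi_ge2 R.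
have d2 : 3 * pi - 2 < pi * delta ^+ 2.
  have p2 : 0 <= 3 - 2 / pi :> R.
    by rewrite subr_ge0 ler_pdivrMr//; lra.
  have : 3 - 2 / pi < delta ^+ 2 :> R.
    rewrite -(sqr_sqrtr p2) ltr_sqr ?nnegrE ?sqrtr_ge0//.
    exact: le_trans (sqrtr_ge0 _) (ltW hd).
  rewrite -(ltr_pM2l pi0) mulrBr [pi * (2 / pi)]mulrC divfK ?gt_eqF//.
  by rewrite [pi * 3]mulrC.
set P := (@pi R) in pi0 pi2 d2 *; set E := P * delta ^+ 2 in d2.
pose g := 2 * E + 4 - 6 * P; have g0 : 0 < g by rewrite /g; lra.
have E0 : 0 < E by lra.
(* With [rho = 1 - e] the energy gap is [g] at [e = 0], and [8 + 6 * E] collects the first-order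
   losses in [e]; this choice lets them consume at most [g / 2]. *)
pose e := Num.min 2^-1 (g / (2 * (8 + 6 * E))).
have e0 : 0 < e by rewrite lt_min invr_gt0 ltr0n/= divr_gt0// mulr_gt0//; lra.
have e2 : e <= 2^-1 by rewrite ge_min lexx.
have eg : e * (2 * (8 + 6 * E)) <= g.
  by rewrite -ler_pdivlMr ?ge_min ?lexx ?orbT// mulr_gt0//; lra.
pose rho := 1 - e; have r0 : 0 < rho by rewrite /rho; lra.
have r1 : rho < 1 by rewrite /rho; lra.
have [vSBV _] := competitor_SBV delta r1.
have := hmin _ (conj vSBV (competitor_trace r1 tr)).
apply/negP; rewrite -ltNge.
have hv := leeD (competitor_grad_energy delta r1 r0) (hausdorff2_competitor delta r0 r1).
rewrite -competitor_energy// in hv; apply: (le_lt_trans hv).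
have rN : (-1 : R) < 1 by lra.
rewrite -(competitor_empty delta) competitor_energy//.
have hu := hausdorff2_u_delta delta.
have Iu : (\int[@leb3 R]_(p in ocyl 1) ((\1_(~` ccyl (-1 : R)) p)%:E *
    (\sum_(i < 3) crack_grad delta p i ^+ 2)%:E) = (2 + 2 * pi * delta ^+ 2)%:E)%E.
  have := crack_energy_ocyl delta (@ltr01 R); rewrite !expr1n !mulr1 => <-.
  apply: eq_integral => p _; rewrite indicE mem_set ?mul1e// => -[_ h].
  by have := le_trans (normr_ge0 _) h; lra.
rewrite -{1}(competitor_empty delta) in hu.
apply: (@lt_le_trans _ _ ((2 + 2 * pi * delta ^+ 2)%:E + 2%:E)%E); last first.
  by rewrite Iu leeD.
rewrite -!EFinD lte_fin -/P.
have h3 : 0 <= e * e by apply: mulr_ge0; exact: ltW.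
have h1 : 0 <= e * P * (2 - e).
  by apply: mulr_ge0; [apply: mulr_ge0; exact: ltW|lra].
have h2 : 0 <= e * e * E * (3 - e).
  by apply: mulr_ge0; [apply: mulr_ge0 => //; exact: ltW|lra].
(* The gap is split into [g / 2], the unspent part of the other half, and terms that are nonnegative
   because [0 < e < 2]. *)
rewrite -subr_gt0 [ltRHS](_ : _ = g / 2 + (g / 2 - e * (8 + 6 * E)) +
  6 * (e * P * (2 - e)) + 2 * (e * e * E * (3 - e)) + 2 * (e * e)); first lra.
by rewrite /g /E /rho; field.
Qed.
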